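(* Let $X$ be an infinite-dimensional real Banach space, let $X_0\subset X$ be an infinite-dimensional closed subspace with a Schauder basis $\{v_n\}_{n=1}^\infty$ such that $\|v_n\|_X=1$ for all $n$, and let $\{v_n^*\}_{n=1}^\infty\subset X_0^*$ satisfy $\|v_n^*\|_{X_0^*}=1$ for all $n$ and $x=\sum_{n=1}^\infty v_n^*(x)v_n$ for all $x\in X_0$. Let $\alpha\in(0,1)$. Then there exists a function $f_\alpha:[0,\infty)\times X\to X$ which is continuous and locally Lipschitz, and which does not map every bounded set into a bounded set, such that the problem $$cD_t^\alpha u(t)=f_\alpha(t,u(t)),\quad t>0,\qquad u(0)=v_1\in X,$$ possesses a bounded maximal local solution $u:[0,1)\to X$.
   Context: For $\beta>0$ let $g_\beta(t)=t^{\beta-1}/\Gamma(\beta)$ for $t>0$ and $g_\beta(t)=0$ for $t\le 0$; for $h\in L^1(0,\tau;X)$ (Bochner integrable) put $J_t^\beta h(t)=(h*g_\beta)(t)=\int_0^t g_\beta(t-r)h(r)\,dr$. Caputo derivative: for $\alpha\in(0,1)$, $\tau>0$ and $h\in C([0,\tau],X)$ with $h*g_{1-\alpha}\in W^{1,1}(0,\tau;X)$, $$cD_t^\alpha h(t):=\frac{d}{dt}\,J_t^{1-\alpha}\big(h-h(0)\big)(t)\quad\text{for a.e. } t\in[0,\tau].$$ $C^\alpha([0,\tau],X)$ denotes the set of $u\in C([0,\tau],X)$ such that $cD_t^\alpha u$ is defined and belongs to $C([0,\tau],X)$ (i.e. has a continuous representative, with which it is identified). Locally Lipschitz: $f:[0,\infty)\times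 X\to X$ is locally Lipschitz if for each $(t_0,x_0)\in[0,\infty)\times X$ there are $L,r>0$ such that $\|f(t,x)-f(t,y)\|_X\le L\|x-y\|_X$ for all $(t,x),(t,y)\in B_r(t_0,x_0)$ (ball in $[0,\infty)\times X$). Solutions of $cD_t^\alpha u(t)=f(t,u(t))$, $u(0)=u_0$: a local solution on $[0,\tau]$, $0<\tau<\infty$, is a function $u\in C^\alpha([0,\tau],X)$ with $u(0)=u_0$ satisfying the equation on $[0,\tau]$. A continuation of a solution is a local solution on a larger closed interval $[0,\tau^*]$ that coincides with the given solution on its domain (for a solution defined on $[0,\omega)$, this means a local solution on some $[0,\tau^*]$ with $\tau^*\ge\omega$ coinciding with it on $[0,\omega)$). A function $u:[0,\omega)\to X$ is a maximal local solution in $[0,\omega)$ if for every $\tau\in(0,\omega)$ its restriction to $[0,\tau]$ is the unique local solution on $[0,\tau]$, and $u$ has no continuation. *)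

(* Defs.v *)
(* Functions on an interval, on [0, oo) x X or on a subspace are represented by
   total functions that are constrained only on that domain. *)
From HB Require Import structures.
From mathcomp Require Import all_boot all_order all_algebra.
From mathcomp Require Import all_classical all_reals all_analysis.
Set Implicit Arguments.
Unset Strict Implicit.
Unset Printing Implicit Defensive.
Import Order.TTheory GRing.Theory Num.Theory.
Import numFieldNormedType.Exports.
Local Open Scope classical_set_scope.
Local Open Scope ring_scope.

Section Bochner.
Context {d : measure_display} {T : measurableType d} {R : realType}.
Context {X : normedModType R}.
Variables (mu : {measure set T -> \bar R}) (D : set T).

Definition integrable_simple (s : T -> X) : Prop :=
  [/\ finite_set (range s),
      forall x, measurable (D `&` s @^-1` [set x]) &
      forall x, x != 0 -> (mu (D `&` s @^-1` [set x]) < +oo)%E].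

(* [fine] sends an infinite measure to 0, which is harmless: it can only occur
   for the value x = 0. *)
Definition simple_integral (s : T -> X) : X :=
  \sum_(x \in range s) fine (mu (D `&` s @^-1` [set x])) *: x.

(* The pointwise convergence is strong measurability; it is also what makes the
   integrands `|h - s_n| measurable up to a null set, so that their
   (MathComp-Analysis) integrals are meaningful. *)
Definition is_bochner_integral (h : T -> X) (v : X) : Prop :=
  exists s : nat -> T -> X,
    [/\ forall n, integrable_simple (s n),
        {ae mu, forall t, D t -> s n t @[n --> \oo] --> h t},
        (\int[mu]_(t in D) (`|h t - s n t|)%:E)%E @[n --> \oo] --> 0%E &
        simple_integral (s n) @[n --> \oo] --> v].

Definition bochner_integrable (h : T -> X) : Prop :=
  exists v, is_bochner_integral h v.

(* An arbitrary value when [h] is not Bochner integrable on [D]. *)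
Definition bochner_integral (h : T -> X) : X := get (is_bochner_integral h).

End Bochner.

Section Sobolev.
Context {R : realType} {X : normedModType R}.

Definition test_function (a b : R) (phi : R -> R) : Prop :=
  [/\ forall n t, derivable (derive1n n phi) t 1,
      compact (closure [set t | phi t != 0]) &
      closure [set t | phi t != 0] `<=` `]a, b[].

Definition weak_derivative (a b : R) (w w' : R -> X) : Prop :=
  forall phi, test_function a b phi ->
    bochner_integral lebesgue_measure `]a, b[ (fun t => derive1 phi t *: w t) =
    - bochner_integral lebesgue_measure `]a, b[ (fun t => phi t *: w' t).

Definition W11 (a b : R) (w : R -> X) : Prop :=
  bochner_integrable lebesgue_measure `]a, b[ w /\
  exists w' : R -> X, bochner_integrable lebesgue_measure `]a, b[ w' /\
    weak_derivative a b w w'.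

End Sobolev.

Section Caputo.
Context {R : realType} {X : normedModType R}.

Definition Gamma (b : R) : R :=
  \int[lebesgue_measure]_(t in `]0, +oo[) (t `^ (b - 1) * expR (- t)).

Definition rl_kernel (b t : R) : R := if 0 < t then t `^ (b - 1) / Gamma b else 0.

Definition rl_integral (b : R) (h : R -> X) (t : R) : X :=
  bochner_integral lebesgue_measure `]0, t[ (fun r => rl_kernel b (t - r) *: h r).

(* cD_t^alpha h is defined on [0, tau], and w is a version of it.  The a.e.
   derivative is asked at interior points only, where it does not depend on
   the values of the functions outside [0, tau]. *)
Definition is_caputo (alpha tau : R) (h w : R -> X) : Prop :=
  [/\ {within `[0, tau], continuous h},
      W11 0 tau (rl_integral (1 - alpha) h) &
      {ae lebesgue_measure, forall t, t \in `]0, tau[ ->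
         is_derive t (1 : R) (rl_integral (1 - alpha) (fun r => h r - h 0)) (w t)}].

(* The continuous representative w of cD_t^alpha u, whose existence says that
   u is in C^alpha([0, tau], X), satisfies the equation at every point. *)
Definition local_solution (alpha : R) (f : R * X -> X) (u0 : X) (tau : R)
    (u : R -> X) : Prop :=
  [/\ 0 < tau, u 0 = u0 &
      exists w : R -> X,
        [/\ {within `[0, tau], continuous w}, is_caputo alpha tau u w &
            {in `[0, tau], forall t, w t = f (t, u t)}]].

Definition unique_local_solution (alpha : R) (f : R * X -> X) (u0 : X)
    (tau : R) (u : R -> X) : Prop :=
  local_solution alpha f u0 tau u /\
  forall v, local_solution alpha f u0 tau v -> {in `[0, tau], v =1 u}.

(* v, on [0, tau], is a continuation of u, defined on [0, omega[. *)
Definition is_continuation (alpha : R) (f : R * X -> X) (u0 : X) (omega : R)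
    (u : R -> X) (tau : R) (v : R -> X) : Prop :=
  [/\ omega <= tau, local_solution alpha f u0 tau v &
      {in `[0, omega[, v =1 u}].

Definition maximal_local_solution (alpha : R) (f : R * X -> X) (u0 : X)
    (omega : R) (u : R -> X) : Prop :=
  (forall tau, 0 < tau < omega -> unique_local_solution alpha f u0 tau u) /\
  ~ exists tau v, is_continuation alpha f u0 omega u tau v.

End Caputo.

Section NonlinearTerm.
Context {R : realType} {X : normedModType R}.

Definition half_space : set (R * X) := [set p | 0 <= p.1].

Definition locally_lipschitz (f : R * X -> X) : Prop :=
  forall p0 : R * X, half_space p0 ->
  exists L r : R, [/\ 0 < L, 0 < r &
    forall t x y, half_space (t, x) ->
      ball p0 r (t, x) -> ball p0 r (t, y) ->
      `|f (t, x) - f (t, y)| <= L * `|x - y|].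

Definition maps_bounded_to_bounded (f : R * X -> X) : Prop :=
  forall B : set (R * X), B `<=` half_space ->
    bounded_set B -> bounded_set (f @` B).

End NonlinearTerm.

Section Subspaces.
Context {R : realType} {X : normedModType R}.

Definition closed_subspace (V : set X) : Prop :=
  closed V /\ GRing.submod_closed [in V].

Definition infinite_dimensional (V : set X) : Prop :=
  ~ exists (n : nat) (e : 'I_n -> X), (forall i, V (e i)) /\
      forall x, V x -> exists a : 'I_n -> R, x = \sum_(i < n) a i *: e i.

Definition schauder_basis (V : set X) (v : nat -> X) : Prop :=
  (forall n, V (v n)) /\
  forall x, V x ->
    exists! a : nat -> R, series (fun n => a n *: v n) @ \oo --> x.

Definition in_dual (V : set X) (phi : X -> R) : Prop :=
  (forall (a : R) (x y : X), V x -> V y ->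
     phi (a *: x + y) = a * phi x + phi y) /\
  {within V, continuous phi}.

Definition dual_norm (V : set X) (phi : X -> R) : \bar R :=
  ereal_sup [set (`|phi x|)%:E | x in V `&` [set x | `|x| <= 1]].

End Subspaces.

(* Main.v *)
(** The solution u runs at constant speed from v_k to v_(k+1) on the k-th
   interval of the partition 1 - 1/(k+1) of [0, 1).  The coordinate functionals
   keep u(s) and u(t) at distance at least 1/2 when s and t are not in adjacent
   intervals, so u has no limit point as t -> 1.  Its Caputo derivative w is
   explicit and continuous on [0, 1), with w(1 - 1/(n+2)) of order at least
   (n+1)^alpha.  Put f(t, x) = cutoff(|x - u(t)| / (1 - t)) w(t), and 0 for
   t >= 1.  As t -> 1 the tube round the graph of u shrinks while u leaves the
   neighbourhoods of every point, so f vanishes near {1} x X and is continuous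
   and locally Lipschitz.  Inside the tube the equation is cD^alpha y = w(t), so
   uniqueness reduces to: if cD^alpha y = cD^alpha u and y(0) = u(0) then y = u.
   Norming functionals make this scalar; testing the weak derivative of
   J^(1-alpha) against smooth steps turns it into an absolutely continuous
   function, hence J^(1-alpha)(y - u) = 0, and convolving with t^(alpha-1)
   (Fubini and the Beta integral) gives y = u. *)
Require Import Defs.
From HB Require Import structures.
From mathcomp Require Import all_boot all_order all_algebra.
From mathcomp Require Import all_classical all_reals all_analysis.
From mathcomp Require Import measurable_realfun.
From mathcomp Require Import ring lra.
Set Implicit Arguments.
Unset Strict Implicit.
Unset Printing Implicit Defensive.
Import Order.TTheory GRing.Theory Num.Theory.
Import numFieldNormedType.Exports.
Local Open Scope classical_set_scope.
Local Open Scope ring_scope.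

(** * Norming functionals *)

Section NormingFunctional.
Context {R : realType} {X : normedModType R}.
Implicit Types p : X -> R.

Definition sublinear p : Prop :=
  (forall x y, p (x + y) <= p x + p y) /\
  (forall a x, 0 < a -> p (a *: x) <= a * p x).

Lemma sublinear0 p : sublinear p -> 0 <= p 0.
Proof. by move=> [pD _]; have := pD 0 0; rewrite addr0; lra. Qed.

Lemma sublinearZ p a x : sublinear p -> 0 < a -> p (a *: x) = a * p x.
Proof.
move=> [_ pZ] a0; apply/eqP; rewrite eq_le pZ//=.
have := pZ a^-1 (a *: x); rewrite invr_gt0 scalerA mulVf ?gt_eqF// scale1r.
by move=> /(_ a0); rewrite ler_pdivlMl.
Qed.

Lemma sublinearN p x : sublinear p -> - p (- x) <= p x.
Proof.
by move=> hp; have := hp.1 x (- x); rewrite subrr; have := sublinear0 hp; lra.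
Qed.

Lemma norm_sublinear : sublinear (fun x : X => `|x|).
Proof.
split=> [x y|a x a0]; first exact: ler_normD.
by rewrite normrZ gtr0_norm.
Qed.

(* The largest sublinear [q <= p] with [q (x + t *: x0) = q x + t * p x0] for
   [t >= 0]. *)
Definition tilt p x0 x : R := inf [set p (x + t *: x0) - t * p x0 | t in [set t | 0 <= t]].

Lemma tilt_lbound p x0 x : sublinear p ->
  lbound [set p (x + t *: x0) - t * p x0 | t in [set t | 0 <= t]] (- p (- x)).
Proof.
move=> hp _ [t /= t_ge0 <-]; have [t0|t0] := leP t 0.
  have -> : t = 0 by apply/eqP; rewrite eq_le t0 t_ge0.
  by rewrite scale0r addr0 mul0r subr0 sublinearN.
rewrite -(sublinearZ x0 hp t0).
by have := hp.1 (x + t *: x0) (- x); rewrite addrAC subrr add0r; lra.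
Qed.

Lemma tilt_le p x0 x t : sublinear p -> 0 <= t ->
  tilt p x0 x <= p (x + t *: x0) - t * p x0.
Proof.
move=> hp t0; apply: ge_inf; last by exists t.
by exists (- p (- x)); exact: tilt_lbound.
Qed.

Lemma le_tilt p x0 x c : sublinear p ->
  (forall t, 0 <= t -> c <= p (x + t *: x0) - t * p x0) -> c <= tilt p x0 x.
Proof.
move=> hp h; apply: lb_le_inf.
  by exists (p (x + 0 *: x0) - 0 * p x0), 0 => //=.
by move=> _ [t t0 <-]; exact: h.
Qed.

Lemma tilt_le_id p x0 x : sublinear p -> tilt p x0 x <= p x.
Proof.
by move=> hp; have := tilt_le x0 x hp (lexx 0); rewrite scale0r addr0 mul0r subr0.
Qed.

Lemma tilt_sublinear p x0 : sublinear p -> sublinear (tilt p x0).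
Proof.
move=> hp; split=> [x y|a x a0].
- rewrite -lerBlDr; apply: le_tilt => // t t0; rewrite lerBlDr -lerBlDl.
  apply: le_tilt => // s s0; rewrite lerBlDl.
  apply: le_trans (tilt_le x0 (x + y) hp (addr_ge0 t0 s0)) _.
  have := hp.1 (x + t *: x0) (y + s *: x0); rewrite addrACA -scalerDl; lra.
- rewrite -ler_pdivrMl//; apply: le_tilt => // t t0; rewrite ler_pdivrMl//.
  apply: le_trans (tilt_le x0 (a *: x) hp (mulr_ge0 (ltW a0) t0)) _.
  by rewrite -scalerA -scalerDr sublinearZ// mulrBr mulrA.
Qed.

Lemma sublinear_inf (A : set (X -> R)) (m : X -> R) : A !=set0 ->
  (forall p, A p -> sublinear p) -> (forall p, A p -> forall x, m x <= p x) ->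
  (forall p q, A p -> A q -> (forall x, p x <= q x) \/ (forall x, q x <= p x)) ->
  let q := fun x => inf [set p x | p in A] in
  sublinear q /\ forall p, A p -> forall x, q x <= p x.
Proof.
move=> [p0 Ap0] Asub Am Atot q.
have qle p x : A p -> q x <= p x.
  move=> Ap; apply: ge_inf; last by exists p.
  by exists (m x) => _ [r Ar <-]; exact: Am.
have leq x c : (forall p, A p -> c <= p x) -> c <= q x.
  move=> h; apply: lb_le_inf; first by exists (p0 x), p0.
  by move=> _ [r Ar <-]; exact: h.
split=> [|p Ap x]; last exact: qle.
split=> [x y|a x a0].
- rewrite -lerBlDr; apply: (leq x) => p Ap; rewrite lerBlDr -lerBlDl.
  apply: (leq y) => r Ar; rewrite lerBlDl.
  have [pr|rp] := Atot _ _ Ap Ar.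
  + apply: le_trans (qle _ _ Ap) _; apply: le_trans ((Asub _ Ap).1 _ _) _.
    by rewrite lerD2l.
  + apply: le_trans (qle _ _ Ar) _; apply: le_trans ((Asub _ Ar).1 _ _) _.
    by rewrite lerD2r.
- rewrite -ler_pdivrMl//; apply: (leq x) => p Ap; rewrite ler_pdivrMl//.
  exact: le_trans (qle _ _ Ap) ((Asub _ Ap).2 _ _ a0).
Qed.

(* Hahn-Banach: a minimal sublinear functional coincides with all its tilts,
   hence is linear. *)
Lemma norming_functional (x0 : X) :
  exists phi : {linear X -> R^o}, (forall x, `|phi x| <= `|x|) /\ phi x0 = `|x0|.
Proof.
pose p0 := tilt (fun x => `|x|) x0.
have p0s : sublinear p0 by apply: tilt_sublinear; exact: norm_sublinear.
pose T := {p : X -> R | sublinear p /\ forall x, p x <= p0 x}.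
pose Rl (s t : T) := `[< forall x, sval t x <= sval s x >].
have [|||A Atot|[p [ps pp0]] pmin] := @Zorn T Rl.
- by move=> t; apply/asboolP.
- move=> r s t /asboolP h1 /asboolP h2; apply/asboolP => x.
  exact: le_trans (h2 x) (h1 x).
- move=> [s hs] [t ht] /asboolP/= h1 /asboolP/= h2; apply: eq_exist.
  by apply/funext => x; apply/eqP; rewrite eq_le h1 h2.
- have [[s0 As0]|A0] := pselect (A !=set0); last first.
    exists (exist _ p0 (conj p0s (fun x => lexx (p0 x)))) => s As.
    by exfalso; apply: A0; exists s.
  have := @sublinear_inf [set sval s | s in A] (fun x => - p0 (- x)).
  case=> [|p [s As <-]|p [s As <-] x|p q [s As <-] [t At <-]|].
  + by exists (sval s0), s0.
  + by case: s As => /= ? [].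
  + case: s As => /= s [ss sp] _.
    by apply: le_trans (sublinearN _ ss); rewrite lerN2.
  + by have [/asboolP ?|/asboolP ?] := Atot _ _ As At; [right|left].
  + set q := (fun x => inf _) => qs qle.
    have qp0 x : q x <= p0 x.
      apply: (@le_trans _ _ (sval s0 x)); first by apply: qle; exists s0.
      by case: (s0) => /= ? [].
    exists (exist _ q (conj qs qp0)) => s As; apply/asboolP => x /=.
    by apply: qle; exists s.
have ptilt x : tilt p x = p.
  have h y : tilt p x y <= p0 y by apply: le_trans (tilt_le_id _ _ ps) _.
  have := pmin (exist _ (tilt p x) (conj (tilt_sublinear x ps) h)).
  have /[swap]/[apply] : Rl (exist _ p (conj ps pp0))
      (exist _ (tilt p x) (conj (tilt_sublinear x ps) h)).
    by apply/asboolP => y /=; exact: tilt_le_id.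
  by move=> /(congr1 sval).
have pD x y : p (x + y) = p x + p y.
  apply/eqP; rewrite eq_le ps.1/=.
  by have := @tilt_le p y x 1 ps ler01; rewrite ptilt scale1r mul1r; lra.
have p_0 : p 0 = 0 by have := pD 0 0; rewrite addr0; lra.
have pN x : p (- x) = - p x by have := pD x (- x); rewrite subrr p_0; lra.
have pZ a x : p (a *: x) = a * p x.
  have [a0|a0|->] := ltgtP a 0; last by rewrite scale0r mul0r.
  - rewrite -(opprK a) scaleNr pN sublinearZ ?oppr_gt0//; lra.
  - exact: sublinearZ.
have plin : linear (p : X -> R^o) by move=> a x y; rewrite pD pZ.
pose plM := GRing.isLinear.Build _ _ _ _ (p : X -> R^o) plin.
pose phi : {linear X -> R^o} := HB.pack (p : X -> R^o) plM.
have ple x : p x <= `|x|.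
  by apply: le_trans (pp0 x) _; exact: (tilt_le_id _ _ norm_sublinear).
have phile x : `|phi x| <= `|x|.
  rewrite ler_norml ple andbT.
  by have := ple (- x); rewrite pN normrN; rewrite lerNl.
exists phi; split => //; apply/eqP; rewrite eq_le (le_trans (ler_norm _) (phile _))/=.
have := pp0 (- x0); rewrite pN.
have := @tilt_le _ x0 (- x0) 1 norm_sublinear ler01.
by rewrite scale1r addNr normr0 -/(p0 _) /=; lra.
Qed.

End NormingFunctional.

(** * The Bochner integral *)

Section SimpleFunctions.
Context {d : measure_display} {T : measurableType d}.
Variables (D : set T) (mD : measurable D).

Definition simple_on (Y : Type) (s : T -> Y) : Prop :=
  finite_set (range s) /\ forall y, measurable (D `&` s @^-1` [set y]).

Lemma simple_on_preimage (Y : Type) (s : T -> Y) (A : set Y) :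
  simple_on s -> measurable (D `&` s @^-1` A).
Proof.
move=> [fs ms].
rewrite (_ : _ `&` _ = \bigcup_(y in range s `&` A) (D `&` s @^-1` [set y])).
  apply: fin_bigcup_measurable; last by move=> y _; exact: ms.
  by apply: sub_finite_set fs => y [].
apply/seteqP; split=> [t [Dt At]|t [y [_ Ay]] [Dt /= sty]].
  by exists (s t) => //; split => //; exists t.
by split => //=; rewrite sty.
Qed.

Lemma simple_on_comp (Y Z : Type) (F : Y -> Z) (s : T -> Y) :
  simple_on s -> simple_on (F \o s).
Proof.
move=> hs; split=> [|z]; last exact: (simple_on_preimage (F @^-1` [set z]) hs).
rewrite (_ : range _ = F @` range s); first exact: finite_image hs.1.
by rewrite image_comp.
Qed.

Lemma simple_on_pair (Y Z : Type) (s : T -> Y) (r : T -> Z) :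
  simple_on s -> simple_on r -> simple_on (fun t => (s t, r t)).
Proof.
move=> hs hr; split=> [|[y z]].
  apply: (@sub_finite_set _ _ (range s `*` range r)).
    by move=> _ [t _ <-]; split; exists t.
  exact: finite_setX hs.1 hr.1.
rewrite (_ : _ `&` _ = (D `&` s @^-1` [set y]) `&` (D `&` r @^-1` [set z])).
  exact: measurableI (hs.2 y) (hr.2 z).
by apply/seteqP; split=> [t [Dt [<- <-]]|t [[Dt <-] [_ <-]]].
Qed.

Lemma simple_on_mem (E : set T) : measurable E -> simple_on (fun t => t \in E).
Proof.
move=> mE; split=> [|b]; first exact: finite_finset.
case: b.
  rewrite (_ : _ `&` _ = D `&` E); first exact: measurableI.
  by apply/seteqP; split=> t [Dt] /= Et; split => //=; [exact: set_mem|exact: mem_set].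
rewrite (_ : _ `&` _ = D `\` E); first exact: measurableD.
apply/seteqP; split=> t [Dt] /=.
  by move=> /negbT; rewrite notin_setE.
by move=> ?; split => //=; apply/negbTE; rewrite notin_setE.
Qed.

Lemma simple_on_if (Y : Type) (E : set T) (s r : T -> Y) : measurable E ->
  simple_on s -> simple_on r -> simple_on (fun t => if t \in E then s t else r t).
Proof.
move=> mE hs hr.
exact: (simple_on_comp (fun p : bool * (Y * Y) => if p.1 then p.2.1 else p.2.2)
  (simple_on_pair (simple_on_mem mE) (simple_on_pair hs hr))).
Qed.

Lemma simple_on_cst (Y : Type) (y : Y) : simple_on (fun=> y).
Proof.
split=> [|z].
  by apply: sub_finite_set (finite_set1 y); move=> _ [t _ <-].
have [->|zy] := pselect (z = y).
  by rewrite (_ : _ `&` _ = D)//; apply/seteqP; split=> [t []|t].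
by rewrite (_ : _ `&` _ = set0)//; apply/seteqP; split=> [t [_ /= /esym]|t].
Qed.

Lemma simple_on_measurable {R : realType} (s : T -> R) :
  simple_on s -> measurable_fun D s.
Proof. by move=> hs _ A _; exact: simple_on_preimage. Qed.

End SimpleFunctions.

Section NonmeasurableIntegrands.
Context {d : measure_display} {T : measurableType d} {R : realType}.
Variables (mu : {measure set T -> \bar R}) (D : set T) (mD : measurable D).
Local Open Scope ereal_scope.

(* No measurability: the integral of a nonnegative function is a supremum over
   the simple functions below it. *)
Lemma le_integral_nonmeasurable (f g : T -> \bar R) :
  (forall t, D t -> 0 <= f t) -> (forall t, D t -> f t <= g t) ->
  \int[mu]_(t in D) f t <= \int[mu]_(t in D) g t.
Proof.
move=> f0 fg; rewrite !ge0_integralE//; last first.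
  by move=> t Dt; exact: le_trans (f0 _ Dt) (fg _ Dt).
apply: ereal_sup_le => _ [h hf <-]; exists h => //= t.
apply: le_trans (hf t) _; rewrite !patchE; case: ifPn => // /set_mem; exact: fg.
Qed.

Lemma ae_eq_integral_nonmeasurable (N : set T) (f g : T -> \bar R) :
  measurable N -> mu N = 0 -> (forall t, D t -> 0 <= f t) ->
  (forall t, D t -> 0 <= g t) -> measurable_fun D g ->
  (forall t, D t -> ~ N t -> f t = g t) ->
  \int[mu]_(t in D) f t = \int[mu]_(t in D) g t.
Proof.
move=> mN N0 f0 g0 mg fg.
have mif (c : \bar R) : measurable_fun D (fun t => if t \in N then c else g t).
  apply: measurable_fun_if => //.
  - apply: (@measurable_fun_bool _ _ _ _ true) => //.
    rewrite (_ : _ `&` _ = D `&` N); first exact: measurableI.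
    by apply/seteqP; split=> t [Dt] /= Nt; split => //; [exact: set_mem|exact: mem_set].
  - by apply: measurable_funS mg.
have gE (c : \bar R) : 0 <= c ->
    \int[mu]_(t in D) g t = \int[mu]_(t in D) (if t \in N then c else g t).
  move=> c0; apply: ge0_ae_eq_integral => //.
    by move=> t Dt; case: ifPn => // _; exact: g0.
  exists N; split => // t /=; apply: contraPP => Nt; apply => Dt.
  by rewrite memNset.
apply/eqP; rewrite eq_le; apply/andP; split.
  rewrite (gE +oo)//; apply: le_integral_nonmeasurable => // t Dt.
  case: ifPn; first by rewrite leey.
  by rewrite notin_setE => Nt; rewrite fg.
rewrite (gE 0)//; apply: le_integral_nonmeasurable => t Dt; case: ifPn => //.
- by move=> _; exact: g0.
- by move=> _; exact: f0.
- by rewrite notin_setE => Nt; rewrite fg.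
Qed.

End NonmeasurableIntegrands.

Section IntegrableEFin.
Context {d : measure_display} {T : measurableType d} {R : realType}.
Variables (mu : {measure set T -> \bar R}) (D : set T) (mD : measurable D).
Variables (f g : T -> R).
Hypotheses (fi : mu.-integrable D (EFin \o f)) (gi : mu.-integrable D (EFin \o g)).

Lemma integrable_addr : mu.-integrable D (EFin \o (fun x => f x + g x)).
Proof. by have := integrableD mD fi gi. Qed.

Lemma integrable_subr : mu.-integrable D (EFin \o (fun x => f x - g x)).
Proof. by have := integrableB mD fi gi. Qed.

Lemma integrable_mulr c : mu.-integrable D (EFin \o (fun x => c * f x)).
Proof. by have := integrableZl mD c fi. Qed.

End IntegrableEFin.

Definition unit_functional {R : realType} {X : normedModType R}
  (phi : {linear X -> R^o}) : Prop := forall x, `|phi x| <= `|x|.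

Lemma unit_functional_continuous {R : realType} {X : normedModType R}
  (phi : {linear X -> R^o}) : unit_functional phi -> continuous phi.
Proof.
move=> hphi; apply: bounded_linear_continuous.
exists 1; split => // M M1; apply: filterS (nbhs0_le (ltr01)) => x /= x1.
by apply: le_trans (hphi x) _; exact: le_trans x1 (ltW M1).
Qed.

Section BochnerIntegral.
Context {d : measure_display} {T : measurableType d} {R : realType}.
Context {X : completeNormedModType R}.
Variables (mu : {measure set T -> \bar R}) (D : set T) (mD : measurable D).
Hypothesis muD : (mu D < +oo)%E.
Implicit Types (h : T -> X) (s : T -> X) (phi : {linear X -> R^o}).

Lemma measure_subD_fin (A : set T) : measurable A -> A `<=` D -> (mu A < +oo)%E.
Proof. by move=> mA AD; apply: le_lt_trans muD; apply: le_measure; rewrite ?inE. Qed.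

Lemma simple_on_integrable_simple s : simple_on D s -> integrable_simple mu D s.
Proof.
move=> [fs ms]; split => // x _; apply: measure_subD_fin (ms x) _.
exact: subIsetl.
Qed.

Lemma simple_on_integrable (r : T -> R) : simple_on D r ->
  mu.-integrable D (EFin \o r).
Proof.
move=> hr; apply: measurable_bounded_integrable => //.
  exact: (simple_on_measurable hr).
exists (\sum_(x <- finmap.enum_fset (fset_set (range r))) `|x|); split; first exact: num_real.
move=> M hM t Dt /=; apply: le_trans (ltW hM).
have rt : r t \in finmap.enum_fset (fset_set (range r)).
  by rewrite in_fset_set ?inE//=; [exists t|exact: hr.1].
rewrite (big_rem _ rt)/= lerDl; exact: sumr_ge0.
Qed.

Lemma simple_integral_functional phi s : simple_on D s ->
  phi (simple_integral mu D s) = \int[mu]_(t in D) (phi (s t) : R).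
Proof.
move=> hs; rewrite /simple_integral fsbig_finite; last exact: hs.1.
rewrite raddf_sum.
have mA x : measurable (D `&` s @^-1` [set x]) by exact: hs.2.
rewrite /Rintegral.
rewrite (_ : (\int[mu]_(t in D) (phi (s t))%:E = \int[mu]_(t in D)
    (\sum_(x <- finmap.enum_fset (fset_set (range s)))
      (phi x : R)%:E * (\1_(D `&` s @^-1` [set x]) t)%:E))%E); last first.
  apply: eq_integral => t /set_mem Dt.
  have st : s t \in finmap.enum_fset (fset_set (range s)).
    by rewrite in_fset_set ?inE//=; [exists t|exact: hs.1].
  rewrite (bigD1_seq (s t) st (finmap.fset_uniq _))/= big1 ?adde0; last first.
    move=> x xst; rewrite indicE memNset ?mule0//= => -[_ /= /eqP].
    by rewrite eq_sym (negbTE xst).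
  by rewrite indicE mem_set ?mule1.
have iA x : mu.-integrable D (fun t => (\1_(D `&` s @^-1` [set x]) t)%:E).
  apply: measurable_bounded_integrable => //.
  exists 1; split => // M M1 t _ /=; apply: le_trans (ltW M1).
  by rewrite indicE ger0_norm// lern1 leq_b1.
rewrite integral_sum//; last by move=> x; exact: integrableZl.
under [X in fine X]eq_bigr => x _.
  rewrite integralZl// integral_indic// setIC setIA setIid.
  rewrite -(fineK (_ : mu _ \is a fin_num)); last first.
    by rewrite ge0_fin_numE// (measure_subD_fin (mA x) (@subIsetl _ _ _)).
  rewrite -EFinM; over.
rewrite sumEFin /=; apply: eq_bigr => x _; rewrite linearZ/= -[RHS]/(_ * _).
exact: mulrC.
Qed.

Lemma simple_limit_measurable (Y : Type) (s : nat -> T -> X) h (F : X -> Y -> R)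
    (r : T -> Y) : (forall n, simple_on D (s n)) ->
  (forall t, D t -> s n t @[n --> \oo] --> h t) -> simple_on D r ->
  (forall y, continuous (F ^~ y)) -> measurable_fun D (fun t => F (h t) (r t)).
Proof.
move=> hs sh hr cF; apply: (@measurable_fun_cvg _ _ _ _ (fun n t => F (s n t) (r t))).
  move=> n; apply: (@simple_on_measurable _ _ _ _ (fun t => F (s n t) (r t))).
  exact: (simple_on_comp (fun p : X * Y => F p.1 p.2) (simple_on_pair (hs n) hr)).
by move=> t Dt; apply: (cvg_comp _ (F ^~ (r t)) (sh t Dt)); exact: cF.
Qed.

Lemma continuous_dist (y : X) : continuous (fun x : X => `|x - y|).
Proof. by move=> x; apply: cvg_norm; apply: cvgB; [exact: cvg_id|exact: cvg_cst]. Qed.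

Lemma integral_functional_dist phi (k : T -> R) h s : unit_functional phi ->
  measurable_fun D (fun t => `|h t - s t|) -> simple_on D s ->
  mu.-integrable D (EFin \o k) -> {in D, k =1 phi \o h} ->
  ((`|\int[mu]_(t in D) k t - phi (simple_integral mu D s)|)%:E
     <= \int[mu]_(t in D) (`|h t - s t|)%:E)%E.
Proof.
move=> hphi mhs hs ik kE; rewrite simple_integral_functional//.
have ips : mu.-integrable D (EFin \o (phi \o s)).
  exact: (simple_on_integrable (simple_on_comp phi hs)).
rewrite -RintegralB//.
have ikp : mu.-integrable D (EFin \o (fun t => k t - phi (s t))).
  exact: integrable_subr.
rewrite EFin_normr_Rintegral//.
apply: le_trans (le_abse_integral mu mD (measurable_int _ ikp)) _.
apply: ge0_le_integral => //.
- by apply: measurableT_comp => //; exact: measurable_int ikp.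
- exact/measurable_EFinP.
- by move=> t Dt; rewrite lee_fin kE ?inE//= -linearB; exact: hphi.
Qed.

Lemma bochner_regularization h v : is_bochner_integral mu D h v ->
  exists (N : set T) (h' : T -> X) (s : nat -> T -> X),
    [/\ [/\ measurable N, mu N = 0 & forall t, D t -> ~ N t -> h' t = h t],
        forall n, simple_on D (s n), forall t, D t -> s n t @[n --> \oo] --> h' t,
        (\int[mu]_(t in D) (`|h' t - s n t|)%:E)%E @[n --> \oo] --> 0%E &
        forall phi, unit_functional phi ->
          phi (simple_integral mu D (s n)) @[n --> \oo] --> phi v].
Proof.
move=> [s [is_ [N [mN N0 subN]] L1 SI]].
have ss n : simple_on D (s n) by have [? ? _] := is_ n.
pose h' t := if t \in N then 0 else h t.
pose s' n t := if t \in N then 0 else s n t.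
have ss' n : simple_on D (s' n) by apply: simple_on_if => //; exact: simple_on_cst.
have sh' t : D t -> s' n t @[n --> \oo] --> h' t.
  move=> Dt; rewrite /s' /h'; case: ifPn => [_|]; first exact: cvg_cst.
  by rewrite notin_setE => Nt; apply: contrapT => nc; apply/Nt/subN => /= /(_ Dt).
exists N, h', s'; split => //; first split => //.
- by move=> t _ Nt; rewrite /h' memNset.
- rewrite (_ : (fun n => _) = fun n => \int[mu]_(t in D) (`|h t - s n t|)%:E)%E//.
  apply/funext => n; apply/esym; apply: (ae_eq_integral_nonmeasurable mD mN) => //.
    apply/measurable_EFinP.
    exact: (simple_limit_measurable ss' sh' (ss' n) continuous_dist).
  by move=> t Dt Nt; rewrite /h' /s' memNset.
- move=> phi hphi; rewrite (_ : (fun n => _) = (fun n => phi (simple_integral mu D (s n)))).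
    by apply: continuous_cvg => //; exact: unit_functional_continuous.
  apply/funext => n; rewrite !simple_integral_functional// /Rintegral; congr fine.
  apply: ae_eq_integral => //.
  + by apply/measurable_EFinP; exact: (simple_on_measurable (simple_on_comp phi _)).
  + by apply/measurable_EFinP; exact: (simple_on_measurable (simple_on_comp phi _)).
  + exists N; split => // t /=; apply: contraPP => Nt; apply => Dt.
    by rewrite /s' memNset.
Qed.

Lemma regular_dist_integrable h (s : nat -> T -> X) :
  (forall n, simple_on D (s n)) -> (forall t, D t -> s n t @[n --> \oo] --> h t) ->
  (\int[mu]_(t in D) (`|h t - s n t|)%:E)%E @[n --> \oo] --> 0%E ->
  mu.-integrable D (fun t => (`|h t|)%:E).
Proof.
move=> ss sh L1.
have /L1 [n _ /(_ n (leqnn n)) /= hn] : nbhs (0 : \bar R)%E [set x | (x < 1)%E].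
  by apply: open_nbhs_nbhs; split; [exact: open_ereal_lt_ereal|rewrite /= lte01].
have md m : measurable_fun D (fun t => `|h t - s m t|).
  exact: (simple_limit_measurable ss sh (ss m) continuous_dist).
apply: (@le_integrable _ _ _ _ _ mD _
   (fun t => (`|h t - s n t|)%:E + (`|s n t|)%:E)%E).
- apply/measurable_EFinP; apply: (simple_limit_measurable (F := fun x (_ : unit) => `|x|)
    ss sh (simple_on_cst mD tt)).
  by move=> _; exact: norm_continuous.
- move=> t Dt; rewrite -EFinD !abse_EFin lee_fin normr_id ger0_norm ?addr_ge0//.
  by rewrite -{1}(subrK (s n t) (h t)) ler_normD.
- apply: integrableD => //.
    apply/integrableP; split; first exact/measurable_EFinP.
    under eq_integral do rewrite abse_EFin normr_id.
    by apply: lt_trans hn _; rewrite ltry.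
  exact: (simple_on_integrable (simple_on_comp (fun x : X => `|x|) (ss n))).
Qed.

(* [phi \o h] itself need not be measurable, whence its version [k]. *)
Lemma bochner_functional h v phi : unit_functional phi ->
  is_bochner_integral mu D h v ->
  exists k : T -> R, [/\ mu.-integrable D (EFin \o k),
    {ae mu, forall t, D t -> phi (h t) = k t} & phi v = \int[mu]_(t in D) k t].
Proof.
move=> hphi /bochner_regularization[N [h' [s [[mN N0 hh'] ss sh L1 SI]]]].
exists (phi \o h').
have cphi := unit_functional_continuous hphi.
have ih' := regular_dist_integrable ss sh L1.
have ik : mu.-integrable D (EFin \o (phi \o h')).
  apply: le_integrable ih' => //.
    apply/measurable_EFinP; apply: (simple_limit_measurable (F := fun x (_ : unit) => phi x)
      ss sh (simple_on_cst mD tt)).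
    by move=> _; exact: cphi.
  by move=> t Dt; rewrite !abse_EFin lee_fin normr_id; exact: hphi.
split => //.
  exists N; split => // t /=; apply: contraPP => Nt; apply => Dt.
  by rewrite /= hh'.
apply: (@cvg_unique _ _ (phi (simple_integral mu D (s n)) @[n --> \oo])) => //.
  exact: SI.
apply/cvgrPdist_le => e e0.
have /L1 [n _ hn] : nbhs (0 : \bar R)%E [set x | (x < e%:E)%E].
  by apply: open_nbhs_nbhs; split; [exact: open_ereal_lt_ereal|rewrite /= lte_fin].
exists n => // m /= nm; rewrite -lee_fin.
apply: le_trans (ltW (hn m nm)).
apply: integral_functional_dist => //.
exact: (simple_limit_measurable ss sh (ss m) continuous_dist).
Qed.

Lemma bochner_dominated h v : is_bochner_integral mu D h v ->
  exists (s : nat -> T -> X) (g : T -> R), [/\ forall n, simple_on D (s n),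
    {ae mu, forall t, D t -> s n t @[n --> \oo] --> h t},
    mu.-integrable D (EFin \o g) & {ae mu, forall t, D t -> `|h t| <= g t}].
Proof.
move=> /bochner_regularization[N [h' [s [[mN N0 hh'] ss sh L1 SI]]]].
exists s, (fun t => `|h' t|); split => //.
- exists N; split => // t /=; apply: contraPP => Nt; apply => Dt.
  by rewrite -hh'//; exact: sh.
- exact: (regular_dist_integrable ss sh L1).
- by exists N; split => // t /=; apply: contraPP => Nt; apply => Dt; rewrite hh'.
Qed.

Lemma dominated_bochner_integrable h (s : nat -> T -> X) (g : T -> R) :
  (forall n, simple_on D (s n)) ->
  {ae mu, forall t, D t -> s n t @[n --> \oo] --> h t} ->
  mu.-integrable D (EFin \o g) -> {ae mu, forall t, D t -> `|h t| <= g t} ->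
  bochner_integrable mu D h.
Proof.
move=> ss [N1 [mN1 N10 subN1]] ig [N2 [mN2 N20 subN2]].
pose N := N1 `|` N2.
have mN : measurable N by exact: measurableU.
have N0 : mu N = 0 by rewrite null_set_setU.
have mg : measurable_fun D g by apply/measurable_EFinP; exact: measurable_int ig.
pose E n := (D `\` N) `&` [set t | `|s n t| <= g t + 1].
have mE n : measurable (E n).
  rewrite (_ : E n = (D `&` [set t | `|s n t| <= g t + 1]) `\` N).
    apply: measurableD => //; apply: measurable_fun_le => //.
      exact: (simple_on_measurable (simple_on_comp (fun x : X => `|x|) (ss n))).
    exact: measurable_funD.
  by apply/seteqP; split=> [t [[? ?] ?]|t [[? ?] ?]].
pose s' n t := if t \in E n then s n t else 0.
pose h' t := if t \in D `\` N then h t else 0.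
have ss' n : simple_on D (s' n) by apply: simple_on_if => //; exact: simple_on_cst.
have hg t : D t -> ~ N t -> `|h t| <= g t.
  move=> Dt Nt; apply: contrapT => h1; apply: Nt; right; apply: subN2 => /=.
  by move=> /(_ Dt).
have sh' t : D t -> s' n t @[n --> \oo] --> h' t.
  move=> Dt; rewrite /s' /h'; case: ifPn => [/set_mem[_ Nt]|]; last first.
    rewrite notin_setE => DNt; rewrite (_ : (fun n => _) = (fun=> 0)).
      exact: cvg_cst.
    by apply/funext => n; rewrite memNset// => -[].
  have snh : s n t @[n --> \oo] --> h t.
    apply: contrapT => nc; apply: Nt; left; apply: subN1 => /= /(_ Dt); exact: nc.
  have lts : \forall n \near \oo, `|s n t| < g t + 1.
    have : `|h t| < g t + 1 by rewrite (le_lt_trans (hg _ Dt Nt))// ltrDl.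
    by move=> hlt; apply: (cvgr_lt (`|h t|)) => //; exact: cvg_norm.
  apply: cvg_trans snh; apply: near_eq_cvg; near=> n.
  rewrite mem_set//; split => //=; apply: ltW; near: n; exact: lts.
have g0 t : D t -> ~ N t -> 0 <= g t by move=> Dt Nt; exact: le_trans (hg _ Dt Nt).
have md n : measurable_fun D (fun t => `|h' t - s' n t|).
  exact: (simple_limit_measurable ss' sh' (ss' n) continuous_dist).
have ig1 : mu.-integrable D (EFin \o (fun t => g t + g t + 1)).
  apply: integrable_addr => //; first exact: integrable_addr.
  apply: measurable_bounded_integrable => //.
  by exists 1; split => // M M1 t _ /=; rewrite normr1 ltW.
have [||||| _ _ L1] := @dominated_convergence _ _ _ mu _ mD (fun n t => (`|h' t - s' n t|)%:E)
   (cst 0%E) (EFin \o (fun t => g t + g t + 1)).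
- by move=> n; exact/measurable_EFinP.
- exact: measurable_cst.
- apply: aeW => t Dt.
  rewrite (_ : cst 0%E t = (`|h' t - h' t|)%:E); last by rewrite subrr normr0.
  apply: cvg_EFin; first by apply: nearW => n; rewrite fin_numE.
  by apply: cvg_norm; apply: cvgB; [exact: cvg_cst|exact: sh'].
- exact: ig1.
- exists N; split => // t /=; apply: contraPP => Nt; apply => n Dt.
  rewrite lee_fin normr_id; apply: le_trans (ler_normB _ _) _.
  have h1 : `|h' t| <= g t by rewrite /h' mem_set//; exact: hg.
  have : `|s' n t| <= g t + 1.
    rewrite /s'; case: ifPn => [/set_mem[]//|_]; rewrite normr0 addr_ge0//.
    exact: g0.
  by move=> h2; rewrite -addrA lerD.
rewrite integral0 in L1.
have L1E n : (\int[mu]_(t in D) (`|h t - s' n t|)%:E =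
    \int[mu]_(t in D) (`|h' t - s' n t|)%:E)%E.
  apply: (ae_eq_integral_nonmeasurable mD mN) => //; first exact/measurable_EFinP.
  by move=> t Dt Nt; rewrite /h' mem_set.
have ih' := regular_dist_integrable ss' sh' L1.
have /cvg_ex[v SIv] : cvg (simple_integral mu D (s' n) @[n --> \oo]).
  apply/cauchy_cvgP; apply/cauchy_exP => e e0.
  have e2 : 0 < e / 2 by rewrite divr_gt0.
  have /L1 [n _ hn] : nbhs (0 : \bar R)%E [set x | (x < (e / 2)%:E)%E].
    by apply: open_nbhs_nbhs; split; [exact: open_ereal_lt_ereal|rewrite /= lte_fin].
  exists (simple_integral mu D (s' n)); exists n => // m /= nm.
  rewrite -ball_normE /ball_ /=.
  have [phi [hphi <-]] := norming_functional
    (simple_integral mu D (s' n) - simple_integral mu D (s' m)).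
  have ik : mu.-integrable D (EFin \o (phi \o h')).
    apply: le_integrable ih' => //.
      apply/measurable_EFinP.
      apply: (simple_limit_measurable (F := fun x (_ : unit) => phi x)
        ss' sh' (simple_on_cst mD tt)).
      by move=> _; exact: unit_functional_continuous.
    by move=> t Dt; rewrite !abse_EFin lee_fin normr_id; exact: hphi.
  have hk p : (n <= p)%N ->
     `|\int[mu]_(t in D) phi (h' t) - phi (simple_integral mu D (s' p))| < e / 2.
    move=> np; rewrite -lte_fin; apply: le_lt_trans (hn p np).
    by apply: integral_functional_dist.
  rewrite linearB /=; have := hk _ (leqnn n); have := hk _ nm.
  by rewrite !ltr_norml; lra.
exists v, s'; split => //.
- by move=> n; exact: simple_on_integrable_simple.
- exists N; split => // t /=; apply: contraPP => Nt; apply => Dt.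
  by have := sh' _ Dt; rewrite /h' mem_set.
- by under eq_fun do rewrite L1E.
Unshelve. all: by end_near. Qed.

Lemma bochner_integralP h : bochner_integrable mu D h ->
  is_bochner_integral mu D h (bochner_integral mu D h).
Proof. by move=> [v hv]; apply: getPex; exists v. Qed.

Lemma bochner_integral_functional h phi (k : T -> R) : unit_functional phi ->
  bochner_integrable mu D h -> measurable_fun D k ->
  {ae mu, forall t, D t -> phi (h t) = k t} ->
  phi (bochner_integral mu D h) = \int[mu]_(t in D) k t.
Proof.
move=> hphi /bochner_integralP /(bochner_functional hphi)[k' [ik' hk' ->]] mk hk.
rewrite /Rintegral; congr fine; apply: ae_eq_integral => //.
- exact: measurable_int ik'.
- exact/measurable_EFinP.
- by apply: filterS2 hk hk' => t h1 h2 Dt; rewrite /= -h1// h2.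
Qed.

End BochnerIntegral.

Section BochnerInterval.
Context {R : realType}.
Variable b : R.
Hypothesis b0 : 0 < b.
Local Notation mu := (@lebesgue_measure R).
Local Notation D := (`]0, b[%classic : set R).

Lemma itv_oo_measure_fin (a c : R) : (mu (`]a, c[%classic : set R) < +oo)%E.
Proof. by rewrite lebesgue_measure_itv/=; case: ifP => _; rewrite ?ltry ?ltNyr// -EFinB ltry. Qed.

Definition grid_index (n : nat) (t : R) : nat :=
  if t \in D then Num.truncn (n.+1%:R * t) else 0%N.

Definition grid_point (n : nat) (t : R) : R := (grid_index n t)%:R / n.+1%:R.

Lemma grid_point_simple (n : nat) : simple_on D (grid_point n).
Proof.
suff h : simple_on D (grid_index n).
  exact: (simple_on_comp (fun k : nat => k%:R / n.+1%:R) h).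
have n0 : (0 : R) < n.+1%:R by rewrite ltr0n.
split.
  apply: (@sub_finite_set _ _ `I_(Num.truncn (n.+1%:R * b)).+1); last exact: finite_II.
  move=> _ [t _ <-] /=; rewrite /grid_index; case: ifPn => // /set_mem /=.
  rewrite in_itv/= => /andP[t0 tb]; rewrite ltnS truncn_ge_nat; last first.
    by rewrite mulr_ge0 ?ltW.
  have /andP[+ _] := truncn_itv (mulr_ge0 (ltW n0) (ltW t0)).
  by move=> /le_trans; apply; rewrite ler_wpM2l ?ltW.
move=> k; rewrite (_ : _ `&` _ = D `&` `[k%:R / n.+1%:R, k.+1%:R / n.+1%:R[%classic).
  exact: measurableI.
apply/seteqP; split=> t [Dt]; rewrite /= /grid_index mem_set// => h; split => //.
  rewrite in_itv/= ler_pdivrMr// ltr_pdivlMr// mulrC -h; apply: truncn_itv.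
  by move: Dt; rewrite /= in_itv/= => /andP[? _]; rewrite mulr_ge0 ?ltW.
by apply: truncn_def; move: h; rewrite in_itv/= ler_pdivrMr// ltr_pdivlMr// mulrC.
Qed.

Lemma grid_point_cvg (t : R) : D t -> grid_point n t @[n --> \oo] --> t.
Proof.
move=> Dt; move: (Dt); rewrite /= in_itv/= => /andP[t0 _].
apply/cvgrPdist_le => e e0; near=> n.
have n0 : (0 : R) < n.+1%:R by rewrite ltr0n.
rewrite /grid_point /grid_index mem_set//.
have /andP[h1 h2] := truncn_itv (mulr_ge0 (ltW n0) (ltW t0)).
set k := Num.truncn _ in h1 h2 *.
have -> : t - k%:R / n.+1%:R = (n.+1%:R * t - k%:R) / n.+1%:R.
  by rewrite mulrBl mulrAC mulfV ?mul1r ?gt_eqF.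
rewrite ger0_norm; last by rewrite divr_ge0// subr_ge0.
rewrite ler_pdivrMr//; apply: (@le_trans _ _ 1).
  move: h2; rewrite lerBlDl natr1; exact: ltW.
rewrite -ler_pdivrMl// mulr1; near: n.
exists (Num.truncn e^-1).+1 => // m /= hm.
have /truncn_itv/andP[_] : 0 <= e^-1 by rewrite invr_ge0 ltW.
by move=> /ltW /le_trans; apply; rewrite ler_nat ltnW.
Unshelve. all: by end_near. Qed.

Context {X : completeNormedModType R}.

Lemma continuous_grid_cvg (h : R -> X) (t : R) : D t -> {for t, continuous h} ->
  h (grid_point n t) @[n --> \oo] --> h t.
Proof. by move=> Dt ch; apply: (cvg_comp _ h (grid_point_cvg Dt)). Qed.

Lemma continuous_bochner_integrable (h : R -> X) (g : R -> R) :
  {in D, continuous h} -> mu.-integrable D (EFin \o g) ->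
  (forall t, D t -> `|h t| <= g t) -> bochner_integrable mu D h.
Proof.
move=> ch ig hg.
apply: (@dominated_bochner_integrable _ _ _ _ mu _ _ _ h (fun n => h \o grid_point n) g) => //.
- exact: itv_oo_measure_fin.
- by move=> n; exact: (simple_on_comp h (grid_point_simple n)).
- by apply: aeW => t Dt; apply: continuous_grid_cvg => //; apply: ch; exact/mem_set.
- exact: aeW.
Qed.

Lemma scale_bochner_integrable (psi : R -> R) (h : R -> X) (M : R) :
  {in D, continuous psi} -> (forall t, D t -> `|psi t| <= M) ->
  bochner_integrable mu D h -> bochner_integrable mu D (fun t => psi t *: h t).
Proof.
move=> cpsi psiM [v /bochner_dominated[//||s [g [ss sh ig hg]]]].
  exact: itv_oo_measure_fin.
apply: (@dominated_bochner_integrable _ _ _ _ mu _ _ _ _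
  (fun n t => psi (grid_point n t) *: s n t) (fun t => M * g t)) => //.
- exact: itv_oo_measure_fin.
- move=> n; exact: (simple_on_comp (fun p : R * X => psi p.1 *: p.2)
    (simple_on_pair (grid_point_simple n) (ss n))).
- apply: filterS sh => t sh Dt; apply: cvgZ; last exact: sh.
  by apply: (cvg_comp _ psi (grid_point_cvg Dt)); apply: cpsi; exact/mem_set.
- exact: integrable_mulr.
- apply: filterS hg => t hg Dt; rewrite normrZ.
  by apply: ler_pM => //; [exact: psiM|exact: hg].
Qed.

Lemma continuous_functional_measurable (h : R -> X) (phi : {linear X -> R^o}) :
  unit_functional phi -> {in D, continuous h} ->
  measurable_fun D (phi \o h : R -> R).
Proof.
move=> hphi ch; apply: open_continuous_measurable_fun => // t Dt.
apply: (@cvg_comp _ _ _ h phi _ _ _ (ch t Dt)).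
exact: unit_functional_continuous.
Qed.

Lemma bochner_integral_continuous (h : R -> X) (g : R -> R)
    (phi : {linear X -> R^o}) : unit_functional phi ->
  {in D, continuous h} -> mu.-integrable D (EFin \o g) ->
  (forall t, D t -> `|h t| <= g t) ->
  phi (bochner_integral mu D h) = \int[mu]_(t in D) (phi (h t) : R).
Proof.
move=> hphi ch ig hg; apply: bochner_integral_functional => //.
- exact: itv_oo_measure_fin.
- exact: continuous_bochner_integrable ig hg.
- exact: continuous_functional_measurable.
- exact: aeW.
Qed.

Lemma bochner_functional_itv (h : R -> X) (v : X) (phi : {linear X -> R^o}) :
  unit_functional phi -> is_bochner_integral mu D h v ->
  exists k : R -> R, mu.-integrable D (EFin \o k) /\
    {ae mu, forall t, D t -> phi (h t) = k t}.
Proof.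
move=> hphi hv; have muD := itv_oo_measure_fin 0 b.
have [] := bochner_functional _ muD hphi hv; first exact: measurable_itv.
by move=> k [ik hk _]; exists k.
Qed.

Lemma bochner_integral_functional_itv (h : R -> X) (phi : {linear X -> R^o})
    (k : R -> R) : unit_functional phi -> bochner_integrable mu D h ->
  measurable_fun D k -> {ae mu, forall t, D t -> phi (h t) = k t} ->
  phi (bochner_integral mu D h) = \int[mu]_(t in D) k t.
Proof.
move=> hphi ih mk hk; apply: bochner_integral_functional => //.
exact: itv_oo_measure_fin.
Qed.

End BochnerInterval.

(** * The Abel kernel *)

Section PositivePower.
Context {R : realType}.
Implicit Types p x : R.

Lemma cvg_is_derive {V : normedModType R} (f : R -> V) x (l : V) :
  h^-1 *: (f (h + x) - f x) @[h --> 0^'] --> l -> is_derive x 1 f l.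
Proof.
move=> fl.
have fl' : h^-1 *: ((f \o shift x) (h *: (1 : R)) - f x) @[h --> 0^'] --> l.
  have e (h : R) : h *: (1 : R) = h by exact: mulr1.
  by under eq_fun do rewrite /= e.
by apply: DeriveDef; [apply/cvg_ex; exists l|apply/cvg_lim].
Qed.

Definition pospow p x : R := if 0 < x then x `^ p else 0.

Lemma pospow_ge0 p x : 0 <= pospow p x.
Proof. by rewrite /pospow; case: ifP => // _; exact: powR_ge0. Qed.

Lemma pospow_gt0E p x : 0 < x -> pospow p x = x `^ p.
Proof. by rewrite /pospow => ->. Qed.

Lemma pospow_le0E p x : x <= 0 -> pospow p x = 0.
Proof. by rewrite /pospow leNgt => /negbTE ->. Qed.

Lemma pospowS p x : pospow (p + 1) x = x * pospow p x.
Proof.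
have [x0|x0] := ltP 0 x; last by rewrite !pospow_le0E// mulr0.
rewrite !pospow_gt0E// powRD; last by rewrite (gt_eqF x0) implybT.
by rewrite powRr1 ?ltW// mulrC.
Qed.

Lemma pospow_le p x y : 0 <= p -> x <= y -> pospow p x <= pospow p y.
Proof.
move=> p0 xy; have [x0|x0] := ltP 0 x; last by rewrite pospow_le0E// pospow_ge0.
have y0 := lt_le_trans x0 xy.
by rewrite !pospow_gt0E//; apply: ge0_ler_powR => //; rewrite nnegrE ltW.
Qed.

Lemma pospow_anti p x y : p <= 0 -> 0 < x -> x <= y -> pospow p y <= pospow p x.
Proof.
move=> p0 x0 xy; have y0 := lt_le_trans x0 xy.
rewrite !pospow_gt0E// -(opprK p) !(powRN _ (- p)) lef_pV2 ?posrE ?powR_gt0//.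
by apply: ge0_ler_powR; rewrite ?oppr_ge0// nnegrE ltW.
Qed.

Lemma is_derive_pospow_gt0 p x : 0 < x ->
  is_derive x 1 (pospow p) (p * pospow (p - 1) x).
Proof.
move=> x0; rewrite pospow_gt0E//.
apply: near_eq_is_derive; last exact: is_derive1_powR.
by near=> z; rewrite pospow_gt0E//; near: z; exact: lt_nbhsr.
Unshelve. all: by end_near. Qed.

Lemma is_derive_pospow_lt0 p x : x < 0 ->
  is_derive x 1 (pospow p) (p * pospow (p - 1) x).
Proof.
move=> x0; rewrite pospow_le0E ?ltW// mulr0.
apply: (@near_eq_is_derive _ _ _ (cst 0)) => //.
near=> z; rewrite pospow_le0E// ltW//; near: z; exact: lt_nbhsl.
Unshelve. all: by end_near. Qed.

Lemma pospow_lt p x e : 0 < p -> 0 < e -> x < e `^ p^-1 -> pospow p x < e.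
Proof.
move=> p0 e0 xe; have [x0|x0] := ltP 0 x; last by rewrite pospow_le0E.
rewrite pospow_gt0E// (_ : e = (e `^ p^-1) `^ p).
  by apply: gt0_ltr_powR; rewrite ?nnegrE ?powR_ge0 ?ltW.
by rewrite -powRrM mulVf ?gt_eqF// powRr1 ?ltW.
Qed.

Lemma continuous_pospow p : 0 < p -> continuous (pospow p).
Proof.
move=> p0 x; have [x0|x0|<-] := ltgtP 0 x.
- by apply/differentiable_continuous/derivable1_diffP; have [] := is_derive_pospow_gt0 p x0.
- by apply/differentiable_continuous/derivable1_diffP; have [] := is_derive_pospow_lt0 p x0.
- apply/cvgrPdist_lt => e e0; rewrite (pospow_le0E _ (lexx 0)); near=> z.
  rewrite sub0r normrN ger0_norm ?pospow_ge0//; apply: pospow_lt => //.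
  near: z; apply: lt_nbhsl; exact: powR_gt0.
Unshelve. all: by end_near. Qed.

Lemma continuous_pospow_at p x : x != 0 -> {for x, continuous (pospow p)}.
Proof.
rewrite neq_lt => /orP[]x0; apply/differentiable_continuous/derivable1_diffP.
- by have [] := is_derive_pospow_lt0 p x0.
- by have [] := is_derive_pospow_gt0 p x0.
Qed.

Lemma is_derive_pospow p x : 1 < p ->
  is_derive x 1 (pospow p) (p * pospow (p - 1) x).
Proof.
move=> p1; have [x0|x0|<-] := ltgtP 0 x.
- exact: is_derive_pospow_gt0.
- exact: is_derive_pospow_lt0.
rewrite [X in _ * X]pospow_le0E// mulr0; apply: cvg_is_derive.
have : pospow (p - 1) h @[h --> 0^'] --> pospow (p - 1) (0 : R).
  by apply: cvg_within_filter; apply: continuous_pospow; rewrite subr_gt0.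
rewrite [X in _ --> X]pospow_le0E//; apply: cvg_trans; apply: near_eq_cvg.
near=> h; have h0 : h != 0 by near: h; exact: nbhs_dnbhs_neq.
rewrite addr0 (pospow_le0E _ (lexx 0)) subr0 -{2}(subrK 1 p) pospowS.
by rewrite -[_ *: _]/(_ * _) mulKf.
Unshelve. all: by end_near. Qed.

End PositivePower.

Section ImproperIntegral.
Context {R : realType}.
Local Notation mu := (@lebesgue_measure R).
Implicit Types (a b : R) (f F : R -> R).

Definition inner_left a b (n : nat) : R := a + (b - a) / n.+3%:R.
Definition inner_right a b (n : nat) : R := b - (b - a) / n.+3%:R.
Definition inner_itv a b (n : nat) : set R :=
  `[inner_left a b n, inner_right a b n]%classic.

Lemma cvg_inner_gap a b : (b - a) / n.+3%:R @[n --> \oo] --> (0 : R).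
Proof.
rewrite -[X in _ --> X](mulr0 (b - a)); apply: cvgM; first exact: cvg_cst.
have := @cvg_harmonic R; rewrite -(cvg_shiftn 2).
by under eq_fun do rewrite /harmonic addn2.
Qed.

Lemma inner_itv_bounds a b n : a < b ->
  [/\ a < inner_left a b n, inner_left a b n < inner_right a b n &
      inner_right a b n < b].
Proof.
move=> ab; rewrite /inner_left /inner_right.
have d0 : 0 < (b - a) / n.+3%:R by rewrite divr_gt0// subr_gt0.
have : (b - a) / n.+3%:R <= (b - a) / 3.
  by rewrite ler_pM2l ?subr_gt0// lef_pV2 ?posrE ?ltr0n// ler_nat.
by move: d0; set d := (b - a) / n.+3%:R => d0 d3; split; lra.
Qed.

Lemma inner_itv_nondecreasing a b : a < b -> nondecreasing_seq (inner_itv a b).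
Proof.
move=> ab m n mn; apply/subsetPset => x; rewrite /inner_itv /= !in_itv/=.
have : (b - a) / n.+3%:R <= (b - a) / m.+3%:R.
  by rewrite ler_pM2l ?subr_gt0// lef_pV2 ?posrE ?ltr0n// ler_nat !ltnS.
rewrite /inner_left /inner_right.
by set c := (b - a) / n.+3%:R; set d := (b - a) / m.+3%:R => cd; lra.
Qed.

Lemma bigcup_inner_itv a b : a < b ->
  \bigcup_n inner_itv a b n = (`]a, b[%classic : set R).
Proof.
move=> ab; apply/seteqP; split=> x.
  move=> [n _]; rewrite /inner_itv /= !in_itv/=.
  by have [? ? ?] := inner_itv_bounds n ab; lra.
rewrite /= in_itv/= => /andP[ax xb].
have e0 : 0 < Num.min (x - a) (b - x) by rewrite lt_min !subr_gt0 ax.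
have [n _ /(_ n (leqnn n)) /=] :=
  (cvgr0Pnorm_lt _).1 (cvg_inner_gap a b) _ e0.
rewrite lt_min => /andP[h1 h2]; exists n => //; rewrite /inner_itv /= in_itv/=.
rewrite /inner_left /inner_right.
have := ler_norm ((b - a) / n.+3%:R).
by move: h1 h2; set d := (b - a) / n.+3%:R => h1 h2 hd; lra.
Qed.

Lemma improper_integral_cvg a b f : a < b -> measurable_fun `]a, b[ f ->
  (forall x, a < x < b -> 0 <= f x) ->
  (\int[mu]_(x in inner_itv a b n) (f x)%:E)%E @[n --> \oo] -->
  (\int[mu]_(x in `]a, b[) (f x)%:E)%E.
Proof.
move=> ab mf f0; rewrite -(bigcup_inner_itv ab).
have sub n : inner_itv a b n `<=` `]a, b[.
  by rewrite -(bigcup_inner_itv ab); exact: bigcup_sup.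
apply: ge0_nondecreasing_set_cvg_integral.
- exact: inner_itv_nondecreasing.
- by move=> n; exact: measurable_itv.
- by move=> n; apply/measurable_EFinP; apply: measurable_funS mf.
- by move=> n x /sub; rewrite /= in_itv/= lee_fin; exact: f0.
Qed.

(* [f] may be unbounded at both endpoints. *)
Lemma improper_FTC2 a b F f : a < b -> {within `[a, b], continuous F} ->
  (forall x, a < x < b -> is_derive x 1 F (f x)) ->
  (forall x, a < x < b -> {for x, continuous f}) ->
  (forall x, a < x < b -> 0 <= f x) ->
  (\int[mu]_(x in `]a, b[) (f x)%:E = (F b - F a)%:E)%E.
Proof.
move=> ab cF dF cf f0.
have mf : measurable_fun `]a, b[ f.
  apply: open_continuous_measurable_fun => // x; rewrite inE/= in_itv/=.
  exact: cf.
have /(continuous_within_itvP _ ab)[_ Fa Fb] := cF.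
apply: (@cvg_unique _ _ ((\int[mu]_(x in inner_itv a b n) (f x)%:E)%E @[n --> \oo])) => //.
  exact: improper_integral_cvg.
have cl : inner_left a b n @[n --> \oo] --> a.
  rewrite -[X in _ --> X]addr0; apply: cvgD; first exact: cvg_cst.
  exact: cvg_inner_gap.
have cr : inner_right a b n @[n --> \oo] --> b.
  rewrite -[X in _ --> X]subr0; apply: cvgB; first exact: cvg_cst.
  exact: cvg_inner_gap.
have inab n x : x \in `[inner_left a b n, inner_right a b n] -> a < x < b.
  rewrite in_itv/=; have [? ? ?] := inner_itv_bounds n ab; lra.
rewrite (_ : (fun n => _) = (fun n => (F (inner_right a b n) - F (inner_left a b n))%:E)).
  apply: cvg_EFin; first by apply: nearW => n; rewrite fin_numE.
  have h (u : R^nat) c : (forall n, u n \in `[a, b]) -> c \in `[a, b] ->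
      u n @[n --> \oo] --> c -> F (u n) @[n --> \oo] --> F c.
    move=> uab cab uc; have /subspace_continuousP/(_ c cab) Fc := cF.
    apply: (cvg_comp _ F _ Fc).
    move=> A [e /= e0 eA]; have [m _ hm] := (cvgrPdist_lt _ _).1 uc e e0.
    by exists m => // k /= mk; apply: eA; [exact: hm|exact: uab].
  by apply: cvgB; apply: h => //; try (by rewrite in_itv/= lexx ltW);
    move=> n; have [? ? ?] := inner_itv_bounds n ab; rewrite in_itv/=; lra.
apply/funext => n; rewrite EFinB.
have [al lr rb] := inner_itv_bounds n ab.
apply: continuous_FTC2 => //.
- by apply: continuous_in_subspaceT => x /set_mem /inab; exact: cf.
- have cF' x : a < x < b -> F y @[y --> x] --> F x.
    by move=> h; apply/differentiable_continuous/derivable1_diffP; have [] := dF x h.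
  split=> [x xlr||].
  + have : a < x < b by apply: (inab n); exact: subset_itv_oo_cc xlr.
    by move=> /dF[].
  + by apply: cvg_within_filter; apply: cF'; lra.
  + by apply: cvg_within_filter; apply: cF'; lra.
- move=> x xlr; have : a < x < b by apply: (inab n); exact: subset_itv_oo_cc xlr.
  by move=> /dF[_]; rewrite derive1E.
Qed.

Lemma improper_FTC2_integrable a b F f : a < b -> {within `[a, b], continuous F} ->
  (forall x, a < x < b -> is_derive x 1 F (f x)) ->
  (forall x, a < x < b -> {for x, continuous f}) ->
  (forall x, a < x < b -> 0 <= f x) ->
  mu.-integrable `]a, b[ (EFin \o f).
Proof.
move=> ab cF dF cf f0; apply/integrableP; split.
  apply/measurable_EFinP; apply: open_continuous_measurable_fun => // x.
  by rewrite inE/= in_itv/=; exact: cf.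
rewrite (_ : (\int[mu]_(x in _) _ = \int[mu]_(x in `]a, b[) (f x)%:E)%E).
  by rewrite (improper_FTC2 ab cF dF cf f0) ltry.
apply: eq_integral => x /set_mem; rewrite /= in_itv/= => xab.
by rewrite ger0_norm// f0.
Qed.

End ImproperIntegral.

Section AbelKernel.
Context {R : realType}.
Local Notation mu := (@lebesgue_measure R).
Variable alpha : R.
Hypothesis halpha : 0 < alpha < 1.

Let alpha1 : 0 < 1 - alpha. Proof. by case/andP: halpha; rewrite subr_gt0. Qed.
Let alpha2 : 0 < 2 - alpha. Proof. by have := alpha1; lra. Qed.

Lemma is_derive_pospow_rev (p t x : R) : x < t ->
  is_derive x 1 (fun r => pospow p (t - r)) (- (p * pospow (p - 1) (t - x))).
Proof.
move=> xt.
have dp : is_derive (t - x) 1 (pospow p) (p * pospow (p - 1) (t - x)).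
  by apply: is_derive_pospow_gt0; rewrite subr_gt0.
have dl : is_derive x (1 : R) (fun r : R => t - r) (- 1).
  by rewrite -[X in is_derive _ _ _ X]add0r; apply: is_deriveB.
by have := @is_derive1_comp _ (pospow p) (fun r => t - r) x _ _ dp dl; rewrite mulrN1.
Qed.

Lemma continuous_pospow_rev (p t : R) : 0 < p -> continuous (fun r : R => pospow p (t - r)).
Proof.
move=> p0 x; apply: (@cvg_comp _ _ _ (fun r => t - r) (pospow p)); last first.
  exact: continuous_pospow.
by apply: cvgB; [exact: cvg_cst|exact: cvg_id].
Qed.

Lemma continuous_pospow_rev_at (p t x : R) : x < t ->
  {for x, continuous (fun r => pospow p (t - r))}.
Proof.
move=> xt; have [d _] := is_derive_pospow_rev p xt.
exact/differentiable_continuous/derivable1_diffP.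
Qed.

Let kernel_primitive (t r : R) : R := - (pospow (1 - alpha) (t - r) / (1 - alpha)).

Let kernel_primitive_cont t : continuous (kernel_primitive t).
Proof.
move=> x; apply: cvgN; apply: cvgM; last exact: cvg_cst.
exact: continuous_pospow_rev.
Qed.

Let kernel_primitive_derive (t x : R) : x < t ->
  is_derive x 1 (kernel_primitive t) (pospow (- alpha) (t - x)).
Proof.
move=> xt; rewrite /kernel_primitive.
have := is_deriveN (is_deriveZ (1 - alpha)^-1 (is_derive_pospow_rev (1 - alpha) xt)).
rewrite (_ : 1 - alpha - 1 = - alpha); last by ring.
rewrite scalerN opprK scalerA mulVf ?gt_eqF// scale1r.
apply: near_eq_is_derive; near=> r.
by rewrite -[LHS]/(- ((1 - alpha)^-1 * pospow (1 - alpha) (t - r))) mulrC.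
Unshelve. all: by end_near. Qed.

Lemma kernel_integral (a b t : R) : a < b <= t ->
  (\int[mu]_(r in `]a, b[) (pospow (- alpha) (t - r))%:E =
   ((pospow (1 - alpha) (t - a) - pospow (1 - alpha) (t - b)) / (1 - alpha))%:E)%E.
Proof.
move=> /andP[ab bt].
transitivity (kernel_primitive t b - kernel_primitive t a)%:E; last first.
  by congr EFin; rewrite /kernel_primitive; lra.
apply: improper_FTC2 => //.
- exact: continuous_subspaceT.
- by move=> x /andP[_ xb]; apply: kernel_primitive_derive; exact: lt_le_trans bt.
- by move=> x /andP[_ xb]; apply: continuous_pospow_rev_at; exact: lt_le_trans bt.
- by move=> x _; exact: pospow_ge0.
Qed.

Lemma kernel_integrable (a b t : R) : b <= t ->
  mu.-integrable `]a, b[ (fun r => (pospow (- alpha) (t - r))%:E).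
Proof.
move=> bt; have [ab|ba] := ltP a b; last first.
  by rewrite set_itv_ge -?leNgt ?bnd_simp//; exact: integrable_set0.
apply: (@improper_FTC2_integrable _ a b (kernel_primitive t)) => //.
- exact: continuous_subspaceT.
- by move=> x /andP[_ xb]; apply: kernel_primitive_derive; exact: lt_le_trans bt.
- by move=> x /andP[_ xb]; apply: continuous_pospow_rev_at; exact: lt_le_trans bt.
- by move=> x _; exact: pospow_ge0.
Qed.

Lemma kernel_ramp_integral (a t : R) : 0 <= a ->
  \int[mu]_(r in `]0, t[) (pospow (- alpha) (t - r) * pospow 1 (r - a)) =
  pospow (2 - alpha) (t - a) / ((1 - alpha) * (2 - alpha)).
Proof.
move=> a0; have [at_|ta] := ltP a t; last first.
  rewrite [RHS]mulrC pospow_le0E ?subr_le0// mulr0.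
  rewrite (@eq_Rintegral _ _ _ mu _ (cst 0)); first by rewrite /Rintegral integral0.
  move=> r /set_mem; rewrite /= in_itv/= => /andP[_ rt].
  by rewrite [X in _ * X]pospow_le0E ?mulr0// subr_le0 (le_trans (ltW rt)).
rewrite /Rintegral.
rewrite (_ : (\int[mu]_(r in _) _ = \int[mu]_(r in `]a, t[)
    (pospow (- alpha) (t - r) * pospow 1 (r - a))%:E)%E); last first.
  rewrite integral_mkcond [RHS]integral_mkcond; apply: eq_integral => r _.
  rewrite !patchE !mem_setE !in_itv/=.
  have [ar|ra] := ltP a r; first by rewrite (le_lt_trans a0 ar).
  by case: ifP => // _; rewrite [X in _ * X]pospow_le0E ?mulr0// subr_le0.
pose F r : R := - (pospow (1 - alpha) (t - r) * (r - a) / (1 - alpha))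
  - pospow (2 - alpha) (t - r) / ((1 - alpha) * (2 - alpha)).
have cF : continuous F.
  move=> x; apply: cvgB; last first.
    by apply: cvgM; [exact: continuous_pospow_rev|exact: cvg_cst].
  apply: cvgN; apply: cvgM; last exact: cvg_cst.
  apply: cvgM; first exact: continuous_pospow_rev.
  by apply: cvgB; [exact: cvg_id|exact: cvg_cst].
have E r : a < r -> pospow 1 (r - a) = r - a.
  by move=> ar; rewrite pospow_gt0E ?subr_gt0// powRr1// subr_ge0 ltW.
suff -> : (\int[mu]_(r in `]a, t[)
    (pospow (- alpha) (t - r) * pospow 1 (r - a))%:E = (F t - F a)%:E)%E.
  by rewrite /= /F !subrr !(pospow_le0E _ (lexx 0)) !(mulr0, mul0r); ring.
apply: improper_FTC2 => //.
- exact: continuous_subspaceT.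
- move=> x /andP[ax xt]; rewrite E//.
  have d1 := is_derive_pospow_rev (1 - alpha) xt.
  have d2 := is_derive_pospow_rev (2 - alpha) xt.
  have d3 : is_derive x (1 : R) (fun r : R => r - a) 1.
    by rewrite -[X in is_derive _ _ _ X]subr0; apply: is_deriveB.
  have D := is_deriveB (is_deriveN (is_deriveZ (1 - alpha)^-1 (is_deriveM d1 d3)))
    (is_deriveZ ((1 - alpha) * (2 - alpha))^-1 d2).
  apply: near_eq_is_derive; last first.
    apply: is_derive_eq D _; rewrite /GRing.scale/=.
    rewrite (_ : 1 - alpha - 1 = - alpha); last by ring.
    rewrite (_ : 2 - alpha - 1 = 1 - alpha); last by ring.
    have := gt_eqF alpha1; have := gt_eqF alpha2 => h2 h1.
    by field; rewrite h1 h2.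
  near=> r.
  rewrite -[LHS]/(- ((1 - alpha)^-1 * (pospow (1 - alpha) (t - r) * (r - a)))
    - ((1 - alpha) * (2 - alpha))^-1 * pospow (2 - alpha) (t - r)).
  by congr (- _ - _); exact: mulrC.
- move=> x /andP[ax xt]; apply: cvgM; first exact: continuous_pospow_rev_at.
  apply: (@cvg_comp _ _ _ (fun r => r - a) (pospow 1)).
    by apply: cvgB; [exact: cvg_id|exact: cvg_cst].
  by apply: continuous_pospow; exact: ltr01.
- by move=> x _; rewrite mulr_ge0 ?pospow_ge0.
Unshelve. all: by end_near. Qed.

End AbelKernel.

Section GammaBeta.
Context {R : realType}.
Local Notation mu := (@lebesgue_measure R).
Variable alpha : R.
Hypothesis halpha : 0 < alpha < 1.

Let alpha0 : 0 < alpha. Proof. by case/andP: halpha. Qed.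
Let alpha1 : 0 < 1 - alpha. Proof. by case/andP: halpha; rewrite subr_gt0. Qed.

Lemma measurable_pospow (p : R) : measurable_fun [set: R] (pospow p).
Proof.
apply: measurable_fun_ifT.
- by apply: measurable_fun_ltr; [exact: measurable_cst|exact: measurable_id].
- exact: measurable_powR.
- exact: measurable_cst.
Qed.

Lemma power_integrable (b : R) : mu.-integrable `]0, b[ (fun r => (pospow (- alpha) r)%:E).
Proof.
have [b0|b0] := ltP 0 b; last first.
  by rewrite set_itv_ge -?leNgt ?bnd_simp//; exact: integrable_set0.
apply: (@improper_FTC2_integrable _ 0 b (fun r => pospow (1 - alpha) r / (1 - alpha))) => //.
- apply: continuous_subspaceT => x.
  by apply: cvgM; [exact: continuous_pospow|exact: cvg_cst].
- move=> x /andP[x0 _]; have d := is_derive_pospow_gt0 (1 - alpha) x0.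
  apply: near_eq_is_derive; last first.
    apply: is_derive_eq (is_deriveZ (1 - alpha)^-1 d) _; rewrite /GRing.scale/=.
    rewrite (_ : 1 - alpha - 1 = - alpha); last by ring.
    by rewrite mulKf ?gt_eqF.
  by near=> r; rewrite -[LHS]/((1 - alpha)^-1 * pospow (1 - alpha) r) mulrC.
- by move=> x /andP[x0 _]; apply: continuous_pospow_at; rewrite gt_eqF.
- by move=> x _; exact: pospow_ge0.
Unshelve. all: by end_near. Qed.

Lemma pospow_ge1 (p x : R) : p <= 0 -> 0 < x <= 1 -> 1 <= pospow p x.
Proof.
move=> p0 /andP[x0 x1]; have := pospow_anti p0 x0 x1.
by rewrite [X in X <= _]pospow_gt0E// powR1.
Qed.

Lemma integrable_expRN : mu.-integrable `[0, +oo[ (fun t => (expR (- t))%:E).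
Proof.
have cexp : continuous (fun t : R => expR (- t)).
  move=> t; apply: (@cvg_comp _ _ _ -%R expR); last exact: continuous_expR.
  by apply: cvgN; exact: cvg_id.
have dE (x : R) : is_derive x (1 : R) (fun t : R => - expR (- t)) (expR (- x)).
  have d : is_derive x (1 : R) (fun t : R => - t) (- 1) by exact: is_deriveN.
  have d2 := @is_derive1_comp _ expR (fun t => - t) x _ _ (is_derive_expR (- x)) d.
  apply: near_eq_is_derive; last first.
    by apply: is_derive_eq (is_deriveN d2) _; rewrite mulrN1 opprK.
  by near=> t.
apply/integrableP; split.
  by apply/measurable_EFinP; apply: measurable_funTS; exact: continuous_measurable_fun.
under eq_integral do rewrite /= ger0_norm ?expR_ge0//.
rewrite (@ge0_continuous_FTC2y _ _ (fun t => - expR (- t)) 0 0) //.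
- by rewrite -EFinB ltry.
- exact: continuous_subspaceT.
- by rewrite -oppr0; apply: cvgN; exact: cvgr_expR.
- by apply: cvg_within_filter; apply: cvgN; exact: cexp.
- by move=> x _; rewrite derive1E; have [_ ->] := dE x.
Unshelve. all: by end_near. Qed.

Lemma Gamma_gt0 : 0 < Gamma (1 - alpha).
Proof.
rewrite /Gamma /Rintegral (_ : 1 - alpha - 1 = - alpha); last by ring.
set f := fun t : R => t `^ (- alpha) * expR (- t).
have f0 t : 0 <= f t by rewrite mulr_ge0 ?powR_ge0 ?expR_ge0.
have mf : measurable_fun [set: R] f.
  apply: measurable_funM; first exact: measurable_powR.
  apply: continuous_measurable_fun => t.
  apply: (@cvg_comp _ _ _ -%R expR); last exact: continuous_expR.
  by apply: cvgN; exact: cvg_id.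
have lb : ((expR (- 1))%:E <= \int[mu]_(t in `]0%R, +oo[) (f t)%:E)%E.
  apply: (@le_trans _ _ (\int[mu]_(t in `]0%R, 1%R[) (f t)%:E)%E); last first.
    apply: ge0_subset_integral => //.
    - by apply/measurable_EFinP; apply: measurable_funTS.
    - by move=> t _; rewrite lee_fin.
    - by apply: subset_itvl; rewrite bnd_simp.
  apply: (@le_trans _ _ (\int[mu]_(t in `]0%R, 1%R[) (cst (expR (- 1)%R)%:E) t)%E).
    by rewrite integral_cst//= lebesgue_measure_itv/= lte_fin ltr01 oppr0 adde0 mule1.
  apply: ge0_le_integral => //.
  - by move=> t _; rewrite lee_fin expR_ge0.
  - by apply/measurable_EFinP; apply: measurable_funTS.
  - move=> t; rewrite /= in_itv/= => /andP[t0 t1]; rewrite lee_fin -[leLHS]mul1r.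
    apply: ler_pM; rewrite ?expR_ge0//; last by rewrite ler_expR lerN2 ltW.
    rewrite -(@pospow_gt0E _ _ t)//; apply: pospow_ge1; last by rewrite t0 ltW.
    by rewrite oppr_le0 ltW.
have ub : (\int[mu]_(t in `]0%R, +oo[) (f t)%:E < +oo)%E.
  pose g (t : R) := (pospow (- alpha) \_ (`]0, 1[%classic : set R)) t + expR (- t).
  have ig : mu.-integrable `]0, +oo[ (EFin \o g).
    apply: integrable_addr => //.
      have -> : EFin \o (pospow (- alpha) \_ (`]0, 1[%classic : set R)) =
          (EFin \o pospow (- alpha)) \_ (`]0, 1[%classic : set R).
        by apply/funext => t; rewrite /= !patchE; case: ifP.
      apply/integrable_restrict => //.
      by apply: integrableS (power_integrable 1) => //; exact: measurableI.
    apply: (@integrableS _ _ _ mu `[0, +oo[ _ _ (measurable_itv _) (measurable_itv _)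
      _ integrable_expRN).
    by apply: subset_itvr; rewrite bnd_simp.
  have : (\int[mu]_(t in `]0%R, +oo[) (g t)%:E < +oo)%E by exact: integrable_lty.
  apply: le_lt_trans; apply: ge0_le_integral => //.
  - by move=> t _; rewrite lee_fin.
  - by apply/measurable_EFinP; apply: measurable_funTS.
  - exact: measurable_int ig.
  - move=> t; rewrite /= in_itv/= andbT lee_fin => t0.
    rewrite /f /g patchE mem_setE in_itv/= t0/=; have [t1|t1] := ltP t 1.
      rewrite pospow_gt0E//; apply: ler_wpDr; first exact: expR_ge0.
      rewrite ler_piMr ?powR_ge0// -expR0 ler_expR; lra.
    rewrite add0r ler_piMl ?expR_ge0// -(pospow_gt0E _ t0).
    apply: (@le_trans _ _ (pospow (- alpha) 1)); last by rewrite pospow_gt0E// powR1.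
    by apply: pospow_anti => //; rewrite oppr_le0 ltW.
rewrite fine_gt0// ub andbT; apply: lt_le_trans lb.
by rewrite lte_fin expR_gt0.
Qed.

Definition beta_integrand (r s t : R) : R :=
  pospow (alpha - 1) (s - t) * pospow (- alpha) (t - r).

Lemma beta_integrand_ge0 r s t : 0 <= beta_integrand r s t.
Proof. by rewrite mulr_ge0 ?pospow_ge0. Qed.

Lemma beta_integrand_continuous r s t : r < t < s ->
  {for t, continuous (beta_integrand r s)}.
Proof.
move=> /andP[rt ts]; apply: cvgM; first exact: continuous_pospow_rev_at.
apply: (@cvg_comp _ _ _ (fun x => x - r) (pospow (- alpha))).
  by apply: cvgB; [exact: cvg_id|exact: cvg_cst].
by apply: continuous_pospow_at; rewrite gt_eqF// subr_gt0.
Qed.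

Lemma measurable_beta_integrand r s : measurable_fun [set: R] (beta_integrand r s).
Proof.
by apply: measurable_funM; apply: (measurableT_comp (measurable_pospow _));
  apply: measurable_funB => //; exact: measurable_id.
Qed.

Definition beta_const : \bar R := (\int[mu]_(t in `]0%R, 1%R[) (beta_integrand 0 1 t)%:E)%E.

Lemma beta_const_gt0 : (0 < beta_const)%E.
Proof.
apply: (@lt_le_trans _ _ 1%E); first exact: lte01.
apply: (@le_trans _ _ (\int[mu]_(t in `]0%R, 1%R[) (cst 1%E) t)%E).
  by rewrite integral_cst//= lebesgue_measure_itv/= lte_fin ltr01 oppr0 adde0 mule1.
apply: ge0_le_integral => //.
  by apply/measurable_EFinP; apply: measurable_funTS; exact: measurable_beta_integrand.
move=> t; rewrite /= in_itv/= => /andP[t0 t1]; rewrite lee_fin -[leLHS]mul1r.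
have := alpha0; have := alpha1 => h1 h2.
apply: ler_pM => //; apply: pospow_ge1; lra.
Qed.

Lemma beta_integrable01 : mu.-integrable `]0, 1[ (EFin \o beta_integrand 0 1).
Proof.
have halpha' : 0 < 1 - alpha < 1 by rewrite alpha1 gtrBl alpha0.
have i1 := power_integrable 1.
have i2 := @kernel_integrable _ _ halpha' 0 1 1 (lexx 1).
rewrite (_ : - (1 - alpha) = alpha - 1) in i2; last by ring.
have i3 : mu.-integrable `]0, 1[ (EFin \o (fun t => pospow (alpha - 1) 2^-1 *
    pospow (- alpha) t + pospow (- alpha) 2^-1 * pospow (alpha - 1) (1 - t))).
  apply: integrable_addr => //; first exact: integrable_mulr.
  exact: integrable_mulr.
apply: le_integrable i3 => //.
  by apply/measurable_EFinP; apply: measurable_funTS; exact: measurable_beta_integrand.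
move=> t; rewrite /= in_itv/= => /andP[t0 t1].
rewrite lee_fin ger0_norm ?beta_integrand_ge0// ger0_norm; last first.
  by rewrite addr_ge0 ?mulr_ge0 ?pospow_ge0.
have := alpha0; have := alpha1 => h1 h2.
rewrite /beta_integrand subr0; have [th|th] := leP t 2^-1.
  apply: ler_wpDr; first by rewrite mulr_ge0 ?pospow_ge0.
  by rewrite ler_wpM2r ?pospow_ge0//; apply: pospow_anti; lra.
apply: ler_wpDl; first by rewrite mulr_ge0 ?pospow_ge0.
by rewrite mulrC ler_wpM2r ?pospow_ge0//; apply: pospow_anti; lra.
Qed.

Lemma beta_const_fin : beta_const \is a fin_num.
Proof. exact: integrable_fin_num beta_integrable01. Qed.

(* Both integrals are limits of integrals over the compact intervals
   [inner_itv], which the affine change of variables maps onto each other. *)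
Lemma beta_integral r s : r < s ->
  (\int[mu]_(t in `]r, s[) (beta_integrand r s t)%:E = beta_const)%E.
Proof.
move=> rs; have sr0 : 0 < s - r by rewrite subr_gt0.
have c1 := @improper_integral_cvg _ r s _ rs
  (measurable_funTS (measurable_beta_integrand r s)) (fun t _ => beta_integrand_ge0 r s t).
have c2 := @improper_integral_cvg _ 0 1 _ ltr01
  (measurable_funTS (measurable_beta_integrand 0 1)) (fun t _ => beta_integrand_ge0 0 1 t).
rewrite -(cvg_lim (@ereal_hausdorff R) c1) /beta_const -(cvg_lim (@ereal_hausdorff R) c2).
congr (limn _); 
apply/funext => n; rewrite /inner_itv.
pose F (x : R) : R := r + (s - r) * x.
have dF (x : R) : is_derive x (1 : R) F (s - r).
  have d := is_deriveD (is_derive_cst r x (1:R)) (is_deriveZ (s - r) (is_derive_id x (1 : R))).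
  by apply: is_derive_eq d _; rewrite add0r /GRing.scale/= mulr1.
have dFE : derive1 F = cst (s - r).
  by apply/funext => x; rewrite derive1E; have [_ ->] := dF x.
have cF : continuous F.
  by move=> x; apply/differentiable_continuous/derivable1_diffP; have [] := dF x.
have [i0 i1 i2] := @inner_itv_bounds R 0 1 n ltr01.
have [j0 j1 j2] := inner_itv_bounds n rs.
have -> : inner_left r s n = F (inner_left 0 1 n).
  by rewrite /F /inner_left add0r subr0 div1r.
have Fr : inner_right r s n = F (inner_right 0 1 n).
  by rewrite /F /inner_right subr0 div1r; ring.
rewrite Fr integration_by_substitution_increasing ?(ltW i1)//.
- apply: eq_integral => x; rewrite mem_setE in_itv/= => xi.
  have x01 : 0 < x < 1 by lra.
  rewrite dFE /= -[LHS]/((beta_integrand r s (F x) * (s - r))%:E); congr EFin.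
  have p1 : 0 < 1 - x by lra.
  have p2 : 0 < x - 0 by lra.
  rewrite /beta_integrand /F.
  rewrite (_ : s - (r + (s - r) * x) = (s - r) * (1 - x)); last by ring.
  rewrite (_ : r + (s - r) * x - r = (s - r) * (x - 0)); last by ring.
  rewrite !pospow_gt0E ?mulr_gt0// !powRM ?ltW//.
  rewrite mulrACA -powRD; last by rewrite (gt_eqF sr0) implybT.
  rewrite (_ : alpha - 1 + - alpha = -1); last by ring.
  by rewrite powR_inv1 ?ltW// mulrAC mulVf ?mul1r// gt_eqF.
- by move=> x y _ _ xy; rewrite /F ltrD2l ltr_pM2l.
- by rewrite dFE => x _; exact: cvg_cst.
- by rewrite dFE; exact: is_cvg_cst.
- by rewrite dFE; exact: is_cvg_cst.
- split; first by move=> x _; have [] := dF x.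
  + by apply: cvg_within_filter; exact: cF.
  + by apply: cvg_within_filter; exact: cF.
- apply: continuous_in_subspaceT => x /set_mem; rewrite -Fr /= in_itv/= => xi.
  apply: beta_integrand_continuous.
  have h : F (inner_left 0 1 n) = inner_left r s n.
    by rewrite /F /inner_left add0r subr0 div1r.
  by rewrite h in xi; lra.
Qed.

Lemma beta_integrable r s : r < s -> mu.-integrable `]r, s[ (EFin \o beta_integrand r s).
Proof.
move=> rs; apply/integrableP; split.
  by apply/measurable_EFinP; apply: measurable_funTS; exact: measurable_beta_integrand.
under eq_integral do rewrite /= ger0_norm ?beta_integrand_ge0//.
by rewrite beta_integral// ltey_eq beta_const_fin.
Qed.

End GammaBeta.

Section AbelInjectivity.
Context {R : realType}.
Local Notation mu := (@lebesgue_measure R).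
Variable alpha : R.
Hypothesis halpha : 0 < alpha < 1.
Variables (y : R -> R) (M : R).
Hypotheses (cy : continuous y) (yM : forall t, `|y t| <= M).

Definition abel_integral (t : R) : R :=
  \int[mu]_(r in `]0, t[) (pospow (- alpha) (t - r) * y r).

Lemma bounded_mul_integrable (D : set R) (k : R -> R) : measurable D ->
  mu.-integrable D (EFin \o k) -> mu.-integrable D (EFin \o (fun r => k r * y r)).
Proof.
move=> mD ik.
have my : measurable_fun D y by apply: measurable_funTS; exact: continuous_measurable_fun.
have mk : measurable_fun D k by apply/measurable_EFinP; exact: measurable_int ik.
have : mu.-integrable D (EFin \o (fun r => M * k r)) by exact: integrable_mulr.
apply: le_integrable => //.
  by apply/measurable_EFinP; exact: measurable_funM.
move=> r _ /=; rewrite lee_fin !normrM mulrC ler_wpM2r//.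
exact: le_trans (yM r) (ler_norm _).
Qed.

Lemma abel_integrable (t : R) :
  mu.-integrable `]0, t[ (EFin \o (fun r => pospow (- alpha) (t - r) * y r)).
Proof. by apply: bounded_mul_integrable => //; exact: kernel_integrable. Qed.

Let trunc (s r : R) : R := if (r \in `]0, s[) then y r else 0.
Let F (s : R) (p : R * R) : R := beta_integrand alpha p.2 s p.1 * trunc s p.2.

Let measurable_trunc s : measurable_fun [set: R] (trunc s).
Proof.
have -> : trunc s = y \_ (`]0, s[%classic : set R).
  by apply/funext => r; rewrite patchE mem_setE.
have my : measurable_fun (`]0, s[%classic : set R) y.
  by apply: measurable_funTS; exact: continuous_measurable_fun.
exact: (measurable_restrictT y (measurable_itv _)).1.
Qed.

Let measurable_F s : measurable_fun [set: R * R] (F s).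
Proof.
apply: measurable_funM; last exact: measurableT_comp.
apply: measurable_funM; apply: (measurableT_comp (measurable_pospow _)).
  by apply: measurable_funB => //; exact: measurable_fst.
by apply: measurable_funB; [exact: measurable_fst|exact: measurable_snd].
Qed.

Let fubini_inner_r s t : abel_integral t = 0 \/ t <= 0 \/ s <= t ->
  (\int[mu]_r (F s (t, r))%:E = 0)%E.
Proof.
move=> ht.
have [t0|t0] := leP t 0.
  rewrite integral0_eq// => r _; rewrite /F /trunc /=.
  have [r0|r0] := leP r 0; first by rewrite in_itv/= ltNge r0/= mulr0.
  by rewrite /beta_integrand [X in _ * X * _]pospow_le0E ?mulr0 ?mul0r//; lra.
have [st|ts] := leP s t.
  rewrite integral0_eq// => r _; rewrite /F /beta_integrand /=.
  by rewrite [X in X * _ * _]pospow_le0E ?mul0r// subr_le0.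
have {}ht : abel_integral t = 0 by case: ht => [//|[]]; lra.
rewrite (_ : (\int[mu]_r _ = \int[mu]_(r in `]0%R, t[)
    ((pospow (alpha - 1) (s - t))%:E * (pospow (- alpha) (t - r) * y r)%:E))%E); last first.
  rewrite [RHS]integral_mkcond; apply: eq_integral => r _.
  rewrite patchE mem_setE /F /trunc /= !in_itv/=.
  have [r0|r0] /= := leP r 0; first by rewrite mulr0.
  have [tr|rt] /= := leP t r.
    by rewrite /beta_integrand [X in _ * X * _]pospow_le0E ?mulr0 ?mul0r// subr_le0.
  by rewrite (lt_trans rt ts) -EFinM mulrA.
rewrite integralZl//; last exact: abel_integrable.
have -> : (\int[mu]_(r in `]0%R, t[) (pospow (- alpha) (t - r) * y r)%:E = 0)%E.
  rewrite -[LHS]fineK; last by apply: integrable_fin_num => //; exact: abel_integrable.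
  by congr EFin; exact: ht.
by rewrite mule0.
Qed.

Let fubini_inner_t s r :
  (\int[mu]_t (F s (t, r))%:E = (trunc s r)%:E * beta_const alpha)%E.
Proof.
rewrite /F /=; have [rs|rs] := boolP (r \in `]0, s[); last first.
  rewrite /trunc (negbTE rs) mul0e integral0_eq// => t _; by rewrite mulr0.
have /andP[r0 rs'] : 0 < r < s by move: rs; rewrite in_itv.
rewrite (_ : (\int[mu]_t _ = \int[mu]_(t in `]r, s[)
    ((trunc s r)%:E * (beta_integrand alpha r s t)%:E))%E); last first.
  rewrite [RHS]integral_mkcond; apply: eq_integral => t _.
  rewrite patchE mem_setE in_itv/= /beta_integrand.
  have [tr|rt] := leP t r.
    by rewrite [X in _ * X * _]pospow_le0E ?mulr0 ?mul0r// subr_le0.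
  have [st|ts] /= := leP s t.
    by rewrite [X in X * _ * _]pospow_le0E ?mul0r// subr_le0.
  by rewrite -EFinM mulrC.
by rewrite integralZl//; [rewrite beta_integral|exact: beta_integrable].
Qed.

Let fubini_inner_abs s r :
  (\int[mu]_t `|(F s (t, r))%:E| = `|trunc s r|%:E * beta_const alpha)%E.
Proof.
rewrite /F /=.
under eq_integral do rewrite normrM ger0_norm ?beta_integrand_ge0//.
have [rs|rs] := boolP (r \in `]0, s[); last first.
  by rewrite /trunc (negbTE rs) normr0 mul0e integral0_eq// => t _; rewrite mulr0.
have /andP[r0 rs'] : 0 < r < s by move: rs; rewrite in_itv.
rewrite (_ : (\int[mu]_t _ = \int[mu]_(t in `]r, s[)
    (`|trunc s r|%:E * (beta_integrand alpha r s t)%:E))%E); last first.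
  rewrite [RHS]integral_mkcond; apply: eq_integral => t _.
  rewrite patchE mem_setE in_itv/= /beta_integrand.
  have [tr|rt] := leP t r.
    by rewrite [X in _ * X * _]pospow_le0E ?mulr0 ?mul0r// subr_le0.
  have [st|ts] /= := leP s t.
    by rewrite [X in X * _ * _]pospow_le0E ?mul0r// subr_le0.
  by rewrite -EFinM mulrC.
by rewrite integralZl//; [rewrite beta_integral|exact: beta_integrable].
Qed.

Let trunc_integrable s : mu.-integrable [set: R] (EFin \o trunc s).
Proof.
have -> : EFin \o trunc s = (EFin \o y) \_ (`]0, s[%classic : set R).
  by apply/funext => r; rewrite patchE mem_setE /= /trunc; case: ifP.
apply/integrable_restrict => //; rewrite setTI.
apply: measurable_bounded_integrable => //.
- exact: itv_oo_measure_fin.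
- by apply: measurable_funTS; exact: continuous_measurable_fun.
- by exists M; split; [exact: num_real|move=> N MN r _ /=; exact: le_trans (yM r) (ltW MN)].
Qed.

Lemma abel_integral0 (s : R) : (forall t : R, 0 < t < s -> abel_integral t = 0) ->
  \int[mu]_(r in `]0, s[) y r = 0.
Proof.
move=> h.
have iF : (mu \x mu)%E.-integrable [set: R * R] (EFin \o F s).
  apply/(integrable21ltyP mu mu) => /=.
    by apply/measurable_EFinP; exact: measurable_F.
  rewrite (_ : (\int[mu]_r _ = \int[mu]_r (beta_const alpha * `|(trunc s r)%:E|))%E); last first.
    by apply: eq_integral => r _; rewrite fubini_inner_abs muleC.
  rewrite -(fineK (beta_const_fin halpha)) integralZl//; last first.
    by have := integrable_abse (trunc_integrable s).
  apply: lte_mul_pinfty => //.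
    by rewrite lee_fin fine_ge0// ltW// beta_const_gt0.
  by have /integrableP[_] := trunc_integrable s.
have := Fubini iF; rewrite /=.
rewrite integral0_eq; last first.
  move=> t _; apply: fubini_inner_r; have [t0|t0] := leP t 0; first by right; left.
  have [st|ts] := leP s t; first by right; right.
  by left; apply: h; rewrite t0.
under eq_integral do rewrite fubini_inner_t muleC -(fineK (beta_const_fin halpha)).
rewrite integralZl//; last exact: trunc_integrable.
move=> /esym/eqP; rewrite mule_eq0 => /orP[/eqP b0|/eqP z0].
  by have := beta_const_gt0 halpha; rewrite -(fineK (beta_const_fin halpha)) b0 ltxx.
rewrite /Rintegral integral_mkcond -[RHS]/(fine 0%E) -z0; congr fine.
by apply: eq_integral => r _; rewrite patchE mem_setE /trunc; case: ifP.
Qed.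

Lemma abel_injective (s : R) : (forall t : R, 0 < t < s -> abel_integral t = 0) ->
  forall t : R, 0 < t < s -> y t = 0.
Proof.
move=> h t /andP[t0 ts].
have iy : mu.-integrable `[0, s] (EFin \o y).
  by apply: continuous_compact_integrable; [exact: segment_compact|exact: continuous_subspaceT].
have cyt : {for t, continuous y} by exact: cy.
have [d <-] := continuous_FTC1_closed ts iy t0 cyt.
rewrite derive1E (@near_eq_derive _ _ _ _ (cst 0)); first exact: derive_cst.
near=> x.
have x0 : 0 < x by near: x; exact: lt_nbhsr.
have xs : x < s by near: x; exact: lt_nbhsl.
rewrite -Rintegral_itv_obnd_cbnd; last first.
  apply: integrableS iy => // u; rewrite /= !in_itv/= => /andP[/ltW -> /le_trans]; apply.
  exact: ltW.
rewrite -Rintegral_itv_bndo_bndc; last first.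
  apply: integrableS iy => // u; rewrite /= !in_itv/= => /andP[/ltW -> /ltW/le_trans]; apply.
  exact: ltW.
apply: abel_integral0 => u /andP[u0 ux]; apply: h; rewrite u0; exact: lt_trans ux xs.
Unshelve. all: by end_near. Qed.

End AbelInjectivity.

(** * Smooth steps and weak derivatives *)

Section SmoothStep.
Context {R : realType}.
Implicit Types (f g : R -> R) (x a b : R).

Definition flat_exp (n : nat) x : R := if 0 < x then x^-1 ^+ n * expR (- x^-1) else 0.

Lemma flat_exp_le0 n x : x <= 0 -> flat_exp n x = 0.
Proof. by rewrite /flat_exp leNgt => /negbTE ->. Qed.

Lemma flat_exp_gt0 n x : 0 < x -> 0 < flat_exp n x.
Proof. by move=> x0; rewrite /flat_exp x0 mulr_gt0 ?expR_gt0// exprn_gt0// invr_gt0. Qed.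

Lemma flat_exp_ge0 n x : 0 <= flat_exp n x.
Proof.
by have [x0|x0] := ltP 0 x; [exact/ltW/flat_exp_gt0|rewrite flat_exp_le0].
Qed.

Lemma flat_expS n x : flat_exp n.+1 x = x^-1 * flat_exp n x.
Proof. by rewrite /flat_exp; case: ifP => _; rewrite ?mulr0// exprS mulrA. Qed.

Lemma flat_exp_le n x : 0 < x -> flat_exp n x <= (n.+1)`!%:R * x.
Proof.
move=> x0; rewrite /flat_exp x0 expRN.
have ix0 : 0 < x^-1 by rewrite invr_gt0.
have := expR_ge1Dxn n (ltW ix0).
have f0 : (0 : R) < (n.+1)`!%:R by rewrite ltr0n fact_gt0.
move=> h; rewrite ler_pdivrMr ?expR_gt0//.
have h2 : x^-1 ^+ n.+1 / (n.+1)`!%:R <= expR x^-1 by apply: le_trans h; rewrite lerDr.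
apply: (@le_trans _ _ ((n.+1)`!%:R * x * (x^-1 ^+ n.+1 / (n.+1)`!%:R))); last first.
  by rewrite ler_pM2l// mulr_gt0.
rewrite exprS [X in _ <= X](_ : _ = x^-1 ^+ n)//.
by field; rewrite gt_eqF//= gt_eqF.
Qed.

Lemma is_derive_flat_exp n x :
  is_derive x 1 (flat_exp n) (flat_exp n.+2 x - n%:R * flat_exp n.+1 x).
Proof.
have [x0|x0|<-] := ltgtP 0 x.
- have xn0 : x != 0 by rewrite gt_eqF.
  have dV : is_derive x (1 : R) (fun y : R => y^-1) (- x^-1 ^+ 2).
    have := @is_deriveV _ id x 1 1 xn0 (is_derive_id x 1).
    by rewrite /GRing.scale/= mulr1 exprVn.
  have dE := @is_derive1_comp _ expR (fun y : R => - y^-1) x _ _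
    (is_derive_expR _) (is_deriveN dV).
  have dX := is_deriveX n dV.
  have dM := is_deriveM dX dE.
  apply: near_eq_is_derive; last first.
    apply: is_derive_eq dM _; rewrite /flat_exp x0 /GRing.scale/=.
    case: n dX => [|n] dX.
      by rewrite !exprfctE !expr0; ring.
    rewrite !exprfctE.
    by rewrite /= !exprS; ring.
  near=> y; have y0 : 0 < y by near: y; exact: lt_nbhsr.
  by rewrite /flat_exp y0 mulrfctE exprfctE.
- rewrite !flat_exp_le0 ?ltW// mulr0 subr0.
  apply: (@near_eq_is_derive _ _ _ (cst 0)) => //.
  near=> z; rewrite flat_exp_le0// ltW//; near: z; exact: lt_nbhsl.
- rewrite !flat_exp_le0// mulr0 subr0; apply: cvg_is_derive.
  have h0 : flat_exp n.+1 h @[h --> 0^'] --> (0 : R).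
    apply: (@cvg_to_0_linear _ _ (n.+2)`!%:R 1) => // r /andP[r0 _].
    rewrite ger0_norm ?flat_exp_ge0//; have [rp|rn] := ltP 0 r.
      by rewrite gtr0_norm//; exact: flat_exp_le.
    by rewrite flat_exp_le0// mulr_ge0.
  apply: cvg_trans h0; apply: near_eq_cvg; near=> h.
  by rewrite addr0 (flat_exp_le0 n (lexx 0)) subr0 flat_expS.
Unshelve. all: by end_near. Qed.

Definition smooth f : Prop := forall n t, derivable (derive1n n f) t 1.

(* A class of functions stable under differentiation that contains the smooth
   steps below. *)
Inductive flat_class : (R -> R) -> Prop :=
| flat_left n a : flat_class (fun x => flat_exp n (x - a))
| flat_right n b : flat_class (fun x => flat_exp n (b - x))
| flat_scale c f : flat_class f -> flat_class (fun x => c * f x)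
| flat_add f g : flat_class f -> flat_class g -> flat_class (fun x => f x + g x)
| flat_mul f g : flat_class f -> flat_class g -> flat_class (fun x => f x * g x)
| flat_inv f : flat_class f -> (forall x, f x != 0) -> flat_class (fun x => (f x)^-1).

Lemma is_derive_flat_left n a x : is_derive x 1 (fun y => flat_exp n (y - a))
  (flat_exp n.+2 (x - a) - n%:R * flat_exp n.+1 (x - a)).
Proof.
have d : is_derive x (1 : R) (fun y : R => y - a) 1.
  by rewrite -[X in is_derive _ _ _ X]subr0; apply: is_deriveB.
have := @is_derive1_comp _ (flat_exp n) (fun y => y - a) x _ _ (is_derive_flat_exp n _) d.
by rewrite mulr1.
Qed.

Lemma is_derive_flat_right n b x : is_derive x 1 (fun y => flat_exp n (b - y))
  (- (flat_exp n.+2 (b - x) - n%:R * flat_exp n.+1 (b - x))).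
Proof.
have d : is_derive x (1 : R) (fun y : R => b - y) (- 1).
  by rewrite -[X in is_derive _ _ _ X]add0r; apply: is_deriveB.
have := @is_derive1_comp _ (flat_exp n) (fun y => b - y) x _ _ (is_derive_flat_exp n _) d.
by rewrite mulrN1.
Qed.

Lemma flat_class_derive f : flat_class f ->
  exists2 g, flat_class g & forall x, is_derive x 1 f (g x).
Proof.
elim=> [n a|n b|c {}f _ [f' cf' df]|{}f g _ [f' cf' df] _ [g' cg' dg]
  |{}f g cf [f' cf' df] cg [g' cg' dg]|{}f cf [f' cf' df] f0].
- exists (fun x => flat_exp n.+2 (x - a) + (- n%:R) * flat_exp n.+1 (x - a)).
    by apply: flat_add; [exact: flat_left|apply: flat_scale; exact: flat_left].
  by move=> x; rewrite mulNr; exact: is_derive_flat_left.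
- exists (fun x => (- 1) * (flat_exp n.+2 (b - x) + (- n%:R) * flat_exp n.+1 (b - x))).
    apply: flat_scale; apply: flat_add; [exact: flat_right|apply: flat_scale; exact: flat_right].
  by move=> x; rewrite mulN1r mulNr; exact: is_derive_flat_right.
- exists (fun x => c * f' x); first exact: flat_scale.
  by move=> x; have := is_deriveZ c (df x).
- exists (fun x => f' x + g' x); first exact: flat_add.
  by move=> x; have := is_deriveD (df x) (dg x).
- exists (fun x => f x * g' x + g x * f' x).
    by apply: flat_add; exact: flat_mul.
  by move=> x; have := is_deriveM (df x) (dg x).
- exists (fun x => (- 1) * ((f x)^-1 * (f x)^-1 * f' x)).
    by apply: flat_scale; apply: flat_mul => //; apply: flat_mul; exact: flat_inv.
  move=> x; have := is_deriveV (f0 x) (df x).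
  by rewrite /GRing.scale/= -exprVn expr2 mulN1r mulNr.
Qed.

Lemma flat_class_smooth f : flat_class f -> smooth f.
Proof.
move=> cf n; have : flat_class (derive1n n f).
  elim: n => [|n IH]; first by rewrite derive1n0.
  rewrite derive1nS; have [g cg dg] := flat_class_derive IH.
  suff -> : derive1 (derive1n n f) = g by [].
  by apply/funext => x; rewrite derive1E; have [_ ->] := dg x.
by move=> /flat_class_derive[g _ dg] t; have [] := dg t.
Qed.

Lemma smoothB f g : smooth f -> smooth g -> smooth (f \- g).
Proof.
move=> sf sg n; have -> : derive1n n (f \- g) = derive1n n f \- derive1n n g.
  elim: n => [|n IH]; first by rewrite !derive1n0.
  rewrite !derive1nS IH; apply/funext => t.
  by rewrite derive1E deriveB// -!derive1E.
by move=> t; apply: derivableB; [exact: sf|exact: sg].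
Qed.

Definition step_denom a b x : R := flat_exp 0 (x - a) + flat_exp 0 (b - x).

Definition smooth_step a b x : R := flat_exp 0 (x - a) * (step_denom a b x)^-1.

Definition step_density a b x : R :=
  (flat_exp 2 (x - a) * flat_exp 0 (b - x) + flat_exp 0 (x - a) * flat_exp 2 (b - x))
    / step_denom a b x ^+ 2.

Lemma step_denom_gt0 a b x : a < b -> 0 < step_denom a b x.
Proof.
move=> ab; rewrite /step_denom; have [ax|xa] := ltP a x.
  by rewrite ltr_pwDl ?flat_exp_ge0// flat_exp_gt0// subr_gt0.
by rewrite ltr_wpDl ?flat_exp_ge0// flat_exp_gt0// subr_gt0 (le_lt_trans xa).
Qed.

Lemma smooth_step_smooth a b : a < b -> smooth (smooth_step a b).
Proof.
move=> ab; apply: flat_class_smooth; apply: flat_mul; first exact: flat_left.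
apply: flat_inv; last by move=> x; rewrite gt_eqF// step_denom_gt0.
by apply: flat_add; [exact: flat_left|exact: flat_right].
Qed.

Lemma is_derive_smooth_step a b x : a < b ->
  is_derive x 1 (smooth_step a b) (step_density a b x).
Proof.
move=> ab; have d0 : step_denom a b x != 0 by rewrite gt_eqF// step_denom_gt0.
have dl := is_derive_flat_left 0 a x; have dr := is_derive_flat_right 0 b x.
have := is_deriveM dl (is_deriveV d0 (is_deriveD dl dr)).
move/is_derive_eq; apply; rewrite /step_density /GRing.scale/= !mul0r !subr0.
by rewrite /step_denom in d0 *; field.
Qed.

Lemma step_density_ge0 a b x : 0 <= step_density a b x.
Proof. by rewrite divr_ge0 ?exprn_even_ge0// addr_ge0 ?mulr_ge0 ?flat_exp_ge0. Qed.

Lemma step_density_out a b x : ~~ (a < x < b) -> step_density a b x = 0.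
Proof.
rewrite negb_and -!leNgt => /orP[xa|bx]; rewrite /step_density.
  by rewrite !(@flat_exp_le0 _ (x - a)) ?subr_le0// !mul0r addr0 mul0r.
by rewrite !(@flat_exp_le0 _ (b - x)) ?subr_le0// !mulr0 addr0 mul0r.
Qed.

Lemma continuous_step_density a b : a < b -> continuous (step_density a b).
Proof.
move=> ab x.
have -> : step_density a b = derive1n 1 (smooth_step a b).
  by rewrite derive1n1; apply/funext => y; rewrite derive1E;
    have [_ ->] := is_derive_smooth_step y ab.
apply/differentiable_continuous/derivable1_diffP.
exact: (@smooth_step_smooth a b ab 1%N).
Qed.

Lemma smooth_step_left a b x : x <= a -> smooth_step a b x = 0.
Proof. by move=> xa; rewrite /smooth_step flat_exp_le0 ?subr_le0// mul0r. Qed.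

Lemma smooth_step_right a b x : a < b -> b <= x -> smooth_step a b x = 1.
Proof.
move=> ab bx; rewrite /smooth_step /step_denom (@flat_exp_le0 _ (b - x)) ?subr_le0//.
by rewrite addr0 mulfV// gt_eqF// flat_exp_gt0// subr_gt0 (lt_le_trans ab).
Qed.

Lemma smooth_step_itv a b x : a < b -> 0 <= smooth_step a b x <= 1.
Proof.
move=> ab; have D0 := step_denom_gt0 x ab.
rewrite /smooth_step divr_ge0 ?flat_exp_ge0 ?(ltW D0)//=.
by rewrite ler_pdivrMr// mul1r /step_denom lerDl flat_exp_ge0.
Qed.

End SmoothStep.

Section WeakDerivative.
Context {R : realType}.
Local Notation mu := (@lebesgue_measure R).

Lemma itv_support_integral (i j : interval R) (f : R -> R) :
  [set` j] `<=` [set` i] -> (forall x, x \in i -> x \notin j -> f x = 0) ->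
  \int[mu]_(x in [set` i]) f x = \int[mu]_(x in [set` j]) f x.
Proof.
move=> ji f0; rewrite /Rintegral integral_mkcond [in RHS]integral_mkcond.
congr fine; apply: eq_integral => x _; rewrite !patchE !mem_setE.
have [xj|xj] := boolP (x \in j); first by rewrite (ji x xj).
by case: ifPn => // xi; rewrite f0.
Qed.

Lemma itv_support_integrable (i j : interval R) (f : R -> R) :
  [set` j] `<=` [set` i] -> (forall x, x \in i -> x \notin j -> f x = 0) ->
  mu.-integrable [set` j] (EFin \o f) -> mu.-integrable [set` i] (EFin \o f).
Proof.
move=> ji f0 ij; apply/(@integrable_mkcond _ _ _ mu [set` i] (EFin \o f) (measurable_itv i)).
have := (@integrable_mkcond _ _ _ mu [set` j] (EFin \o f) (measurable_itv j)).1 ij.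
rewrite (_ : _ \_ [set` j] = (EFin \o f) \_ [set` i])//.
apply/funext => x; rewrite !patchE !mem_setE.
have [xj|xj] := boolP (x \in j); first by rewrite (ji x xj).
by case: ifPn => // xi; rewrite /= f0.
Qed.

Section Mollification.
Variables (tau : R) (g : R -> R).
Hypothesis cg : {in (`]0, tau[%classic : set R), continuous g}.

Lemma continuous_density_mul (a b : R) : 0 < a < b -> b < tau ->
  {within `[a, b], continuous (fun x => step_density a b x * g x)}.
Proof.
move=> /andP[a0 ab] bt; apply: continuous_in_subspaceT => x /set_mem.
rewrite /= in_itv/= => /andP[ax xb]; apply: cvgM.
  exact: continuous_step_density.
by apply: cg; rewrite inE/= in_itv/= (lt_le_trans a0)//= (le_lt_trans xb).
Qed.

Lemma density_mul_support (a b x : R) : x \in `]0, tau[ -> x \notin `[a, b] ->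
  step_density a b x * g x = 0.
Proof.
rewrite !in_itv/= => _ xab; rewrite step_density_out ?mul0r//.
by apply: contra xab => /andP[/ltW -> /ltW ->].
Qed.

Lemma sub_itv_cc_oo (a b : R) : 0 < a -> b < tau -> `[a, b] `<=` `]0, tau[.
Proof.
move=> a0 bt x; rewrite /= !in_itv/= => /andP[ax xb].
by rewrite (lt_le_trans a0 ax) (le_lt_trans xb bt).
Qed.

Lemma density_mul_integrable (a b : R) : 0 < a < b -> b < tau ->
  mu.-integrable `]0, tau[ (EFin \o (fun x => step_density a b x * g x)).
Proof.
move=> h bt; have /andP[a0 ab] := h.
apply: (@itv_support_integrable `]0, tau[ `[a, b]).
- exact: sub_itv_cc_oo.
- by move=> x; exact: density_mul_support.
- apply: continuous_compact_integrable; first exact: segment_compact.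
  exact: continuous_density_mul.
Qed.

Lemma step_density_integral (a b : R) : a < b ->
  \int[mu]_(x in `[a, b]) step_density a b x = 1.
Proof.
move=> ab; rewrite /Rintegral (@continuous_FTC2 _ _ (smooth_step a b)) //.
- by rewrite /= smooth_step_right// smooth_step_left// subr0.
- by apply: continuous_subspaceT; exact: continuous_step_density.
- have cs : continuous (smooth_step a b).
    move=> x; apply/differentiable_continuous/derivable1_diffP.
    by have [] := is_derive_smooth_step x ab.
  split; first by move=> x _; have [] := is_derive_smooth_step x ab.
  + by apply: cvg_within_filter; exact: cs.
  + by apply: cvg_within_filter; exact: cs.
- by move=> x _; rewrite derive1E; have [_ ->] := is_derive_smooth_step x ab.
Qed.

Lemma mollification (c delta : R) : 0 < c < tau -> 0 < delta ->
  exists2 e0, 0 < e0 & forall e, 0 < e <= e0 ->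
    `|\int[mu]_(x in `]0, tau[) (step_density (c - e) (c + e) x * g x) - g c| <= delta.
Proof.
move=> /andP[c0 ct] d0.
have /cvgrPdist_le/(_ _ d0) : g x @[x --> c] --> g c.
  by apply: cg; rewrite inE/= in_itv/= c0.
move=> [r /= r0 hr].
pose m := Num.min r (Num.min c (tau - c)).
have m0 : 0 < m by rewrite !lt_min r0 c0 subr_gt0.
have mr : m <= r by rewrite ge_min lexx.
have mc : m <= c by rewrite !ge_min lexx orbT.
have mt : m <= tau - c by rewrite !ge_min lexx !orbT.
exists (m / 2); first by rewrite divr_gt0.
move=> e /andP[e0 em]; set a := c - e; set b := c + e.
have a0 : 0 < a by rewrite /a; lra.
have ab : a < b by rewrite /a /b; lra.
have bt : b < tau by rewrite /b; lra.
rewrite (@itv_support_integral `]0, tau[ `[a, b]); last 2 first.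
- exact: sub_itv_cc_oo.
- by move=> x; exact: density_mul_support.
have iD : mu.-integrable `[a, b] (EFin \o step_density a b).
  apply: continuous_compact_integrable; first exact: segment_compact.
  by apply: continuous_subspaceT; exact: continuous_step_density.
have iDg : mu.-integrable `[a, b] (EFin \o (fun x => step_density a b x * g x)).
  apply: continuous_compact_integrable; first exact: segment_compact.
  by apply: continuous_density_mul; rewrite ?a0.
have iDc : mu.-integrable `[a, b] (EFin \o (fun x => g c * step_density a b x)).
  exact: integrable_mulr.
have -> : g c = \int[mu]_(x in `[a, b]) (g c * step_density a b x).
  by rewrite RintegralZl// step_density_integral// mulr1.
rewrite -RintegralB//.
have iB : mu.-integrable `[a, b] (EFin \o
    (fun x => step_density a b x * g x - g c * step_density a b x)).
  exact: integrable_subr.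
apply: le_trans (le_normr_Rintegral _ iB) _ => //.
have -> : delta = \int[mu]_(x in `[a, b]) (delta * step_density a b x).
  by rewrite RintegralZl// step_density_integral// mulr1.
apply: le_Rintegral => //.
- exact: (integrable_norm iB).
- exact: integrable_mulr.
- move=> x; rewrite /= in_itv/= => xab.
  rewrite mulrC -mulrBl normrM (ger0_norm (step_density_ge0 _ _ _)).
  rewrite ler_wpM2r ?step_density_ge0// distrC; apply: hr => /=.
  by move: xab; rewrite /a /b ltr_norml; lra.
Qed.

End Mollification.

Lemma step_test_function (tau s t e : R) : 0 < e -> e < s -> s < t -> t + e < tau ->
  test_function 0 tau (smooth_step (s - e) (s + e) \- smooth_step (t - e) (t + e)).
Proof.
move=> e0 es st te.
have supp : closure [set x | (smooth_step (s - e) (s + e) \- smooth_step (t - e) (t + e)) x != 0]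
    `<=` `[s - e, t + e].
  rewrite [X in _ `<=` X](closure_id _).1; last exact: itv_closed.
  apply: closureS => x /=; rewrite in_itv/=; apply: contraNT.
  rewrite negb_and -!ltNge => /orP[xs|tx].
    by rewrite !smooth_step_left ?subrr//; lra.
  by rewrite !smooth_step_right ?subrr//; lra.
split.
- by apply: smoothB; apply: smooth_step_smooth; lra.
- apply: subclosed_compact supp; first exact: closed_closure.
  exact: segment_compact.
- apply: subset_trans supp _; apply: sub_itv_cc_oo => //; lra.
Qed.

Lemma cvg_smooth_step (c x : R) (e : nat -> R) : (forall n, 0 < e n) ->
  e n @[n --> \oo] --> 0 -> x != c ->
  smooth_step (c - e n) (c + e n) x @[n --> \oo] --> ((c < x)%R%:R : R).
Proof.
move=> e0 ec xc.
have d0 : 0 < `|x - c| by rewrite normr_gt0 subr_eq0.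
have ne : \forall n \near \oo, e n < `|x - c|.
  apply: filterS ((cvgr0Pnorm_lt _).1 ec _ d0) => n /=.
  by rewrite gtr0_norm.
apply: (cvg_trans _ (@cvg_cst _ ((c < x)%R%:R : R) _ \oo _)).
apply: near_eq_cvg; near=> n.
have en : e n < `|x - c| by near: n; exact: ne.
have [cx|xc'] := ltP c x => /=.
  rewrite smooth_step_right//; first by have := e0 n; lra.
  by move: en; rewrite gtr0_norm ?subr_gt0//; lra.
rewrite smooth_step_left//.
by move: en; rewrite ler0_norm ?subr_le0//; lra.
Unshelve. all: by end_near. Qed.

Lemma weak_derivative_FTC (tau : R) (g g1 : R -> R) :
  {in (`]0, tau[%classic : set R), continuous g} ->
  mu.-integrable `]0, tau[ (EFin \o g1) ->
  (forall psi, test_function 0 tau psi ->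
    \int[mu]_(x in `]0, tau[) (derive1 psi x * g x) =
    - \int[mu]_(x in `]0, tau[) (psi x * g1 x)) ->
  forall s t : R, 0 < s -> s < t -> t < tau ->
  g t - g s = \int[mu]_(x in `]s, t[) g1 x.
Proof.
move=> cg ig1 hw s t s0 st ttau.
have mg1 : measurable_fun (`]0, tau[%classic : set R) g1.
  by apply/measurable_EFinP; exact: measurable_int ig1.
pose m := Num.min s (tau - t).
have m0 : 0 < m by rewrite !lt_min s0 subr_gt0.
have ms : m <= s by rewrite ge_min lexx.
have mt : m <= tau - t by rewrite !ge_min lexx orbT.
pose e n : R := (m - 0) / n.+3%:R.
have e0 n : 0 < e n by rewrite /e subr0 divr_gt0.
have em n : e n < m.
  by rewrite /e subr0 ltr_pdivrMr// ltr_pMr// ltr1n.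
have ec : e n @[n --> \oo] --> 0 by exact: cvg_inner_gap.
pose S n c := smooth_step (c - e n) (c + e n).
pose psi n := S n s \- S n t.
have tpsi n : test_function 0 tau (psi n).
  by apply: step_test_function => //; have := em n; lra.
have lhs : \int[mu]_(x in `]0, tau[) (derive1 (psi n) x * g x) @[n --> \oo] --> g s - g t.
  have dpsi n x : derive1 (psi n) x * g x =
      step_density (s - e n) (s + e n) x * g x - step_density (t - e n) (t + e n) x * g x.
    have [|d1 e1] := @is_derive_smooth_step _ (s - e n) (s + e n) x; first by have := e0 n; lra.
    have [|d2 e2] := @is_derive_smooth_step _ (t - e n) (t + e n) x; first by have := e0 n; lra.
    by rewrite derive1E deriveB// e1 e2 mulrBl.
  have mol c : 0 < c < tau ->
     \int[mu]_(x in `]0, tau[) (step_density (c - e n) (c + e n) x * g x) @[n --> \oo] --> g c.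
    move=> ctau; apply/cvgrPdist_le => d d0.
    have [r r0 hr] := mollification cg ctau d0.
    apply: filterS ((cvgr0Pnorm_lt _).1 ec _ r0) => n /=.
    by rewrite gtr0_norm// => enr; rewrite distrC; apply: hr; rewrite e0 ltW.
  rewrite (_ : (fun n => _) = (fun n =>
    \int[mu]_(x in `]0, tau[) (step_density (s - e n) (s + e n) x * g x) -
    \int[mu]_(x in `]0, tau[) (step_density (t - e n) (t + e n) x * g x))).
    by apply: cvgB; apply: mol; lra.
  apply/funext => n; rewrite -RintegralB//.
  - by apply: eq_Rintegral => x _; exact: dpsi.
  - by apply: density_mul_integrable => //; have := e0 n; have := em n; lra.
  - by apply: density_mul_integrable => //; have := e0 n; have := em n; lra.
pose G (x : R) : R := ((s < x)%R%:R - (t < x)%R%:R) * g1 x.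
have rhs : \int[mu]_(x in `]0, tau[) (psi n x * g1 x) @[n --> \oo] -->
    \int[mu]_(x in `]s, t[) g1 x.
  have [|||||| i1 _ +] := @dominated_convergence _ _ _ mu (`]0, tau[%classic : set R) _
    (fun n x => (psi n x * g1 x)%:E)
    (EFin \o G)
    (fun x => `|(g1 x)%:E|%E).
  - exact: measurable_itv.
  - move=> n; apply/measurable_EFinP; apply: measurable_funM => //.
    apply: measurable_funTS; apply: continuous_measurable_fun => x.
    apply/differentiable_continuous/derivable1_diffP.
    by have [+ _ _] := tpsi n; move=> /(_ 0%N).
  - apply/measurable_EFinP; apply: measurable_funM => //.
    by apply: measurable_funB; apply: measurable_funTS; apply: (measurableT_comp (f := fun b : bool => (b%:R : R))) => //;
      apply: measurable_fun_ltr.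
  - exists [set s; t]; split.
    + by apply: measurableU; exact: measurable_set1.
    + by rewrite null_set_setU//;
        (exact: measurable_set1 || exact: lebesgue_measure_set1).
    + move=> x /=; apply: contraPP => /not_orP[xs xt]; apply => _.
      apply: cvg_EFin; first by apply: nearW.
      apply: cvgM; last exact: cvg_cst.
      by apply: cvgB; apply: cvg_smooth_step => //; exact/eqP.
  - exact: integrable_abse.
  - apply: aeW => x n _; rewrite lee_fin normrM ler_piMl//.
    have h1 := @smooth_step_itv _ (s - e n) (s + e n) x.
    have h2 := @smooth_step_itv _ (t - e n) (t + e n) x.
    have := e0 n; rewrite /psi /S /= ler_norml => e0n.
    have {}h1 := h1 ltac:(lra); have {}h2 := h2 ltac:(lra).
    lra.
  have fin : (\int[mu]_(x in `]0%R, tau[)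
      (EFin \o G) x)%E \is a fin_num.
    exact: integrable_fin_num.
  have i1' : mu.-integrable `]s, t] (EFin \o g1).
    apply: integrableS ig1 => // x; rewrite /= !in_itv/= => /andP[sx xt].
    by rewrite (lt_trans s0 sx) (le_lt_trans xt).
  have -> : \int[mu]_(x in `]s, t[) g1 x =
      fine (\int[mu]_(x in `]0%R, tau[) ((EFin \o G) x))%E.
    rewrite Rintegral_itv_bndo_bndc; last first.
      by apply: integrableS i1' => // x; rewrite /= !in_itv/= => /andP[-> /ltW].
    rewrite -[RHS]/(\int[mu]_(x in `]0, tau[) G x).
    rewrite (@itv_support_integral `]0, tau[ `]s, t]).
    + apply: eq_Rintegral => x; rewrite inE/= in_itv/= => /andP[sx xt].
      by rewrite /G sx ltNge xt/= subr0 mul1r.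
    + move=> x; rewrite /= !in_itv/= => /andP[sx xt].
      by rewrite (lt_trans s0 sx) (le_lt_trans xt).
    + move=> x _; rewrite /G in_itv/= negb_and -leNgt -ltNge => /orP[xs|tx].
        by rewrite !ltNge xs (le_trans xs (ltW st))/= subrr mul0r.
      by rewrite tx (lt_trans st tx) subrr mul0r.
  by move=> c1; apply: fine_cvg; rewrite fineK.
have lr n : \int[mu]_(x in `]0, tau[) (derive1 (psi n) x * g x) =
    - \int[mu]_(x in `]0, tau[) (psi n x * g1 x) by exact: hw.
have lhs' : \int[mu]_(x in `]0, tau[) (derive1 (psi n) x * g x) @[n --> \oo] -->
    - \int[mu]_(x in `]s, t[) g1 x.
  by under eq_fun do rewrite lr; exact: cvgN.
have E : g s - g t = - \int[mu]_(x in `]s, t[) g1 x.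
  exact: (cvg_unique _ lhs lhs').
by rewrite -opprB E opprK.
Qed.

End WeakDerivative.

(** * Riemann-Liouville integrals and uniqueness for the Caputo derivative *)

Section AbelContinuity.
Context {R : realType}.
Local Notation mu := (@lebesgue_measure R).
Variable alpha : R.
Hypothesis halpha : 0 < alpha < 1.
Variables (y : R -> R) (M : R).
Hypotheses (cy : continuous y) (yM : forall t, `|y t| <= M).

Let alpha1 : 0 < 1 - alpha. Proof. by case/andP: halpha; rewrite subr_gt0. Qed.
Let M0 : 0 <= M. Proof. exact: le_trans (yM 0). Qed.

Definition kernel_mass (t : R) : R := pospow (1 - alpha) t / (1 - alpha).

Lemma kernel_Rintegral (a b t : R) : a < b <= t ->
  \int[mu]_(r in `]a, b[) pospow (- alpha) (t - r) =
  kernel_mass (t - a) - kernel_mass (t - b).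
Proof. by move=> abt; rewrite /Rintegral kernel_integral//= /kernel_mass mulrBl. Qed.

Lemma kernel_mass0 : kernel_mass 0 = 0.
Proof. by rewrite /kernel_mass pospow_le0E// mul0r. Qed.

Lemma abel_integral_le (t : R) : 0 < t -> `|abel_integral alpha y t| <= M * kernel_mass t.
Proof.
move=> t0; have iy := abel_integrable halpha cy yM t.
apply: le_trans (le_normr_Rintegral _ iy) _ => //.
have ik : mu.-integrable `]0, t[ (EFin \o (fun r => pospow (- alpha) (t - r))).
  exact: kernel_integrable.
have -> : M * kernel_mass t = \int[mu]_(r in `]0, t[) (M * pospow (- alpha) (t - r)).
  by rewrite RintegralZl// kernel_Rintegral ?t0 ?lexx// subr0 subrr kernel_mass0 subr0.
apply: le_Rintegral => //.
- exact: (integrable_norm iy).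
- exact: integrable_mulr.
- by move=> r _; rewrite normrM ger0_norm ?pospow_ge0// mulrC ler_wpM2r ?pospow_ge0.
Qed.

Lemma abel_integral_diff (t t' : R) : 0 < t -> t < t' ->
  `|abel_integral alpha y t' - abel_integral alpha y t| <= 2 * M * kernel_mass (t' - t).
Proof.
move=> t0 tt'; have t0' := lt_trans t0 tt'.
pose k (s r : R) := pospow (- alpha) (s - r).
have sub : `]0, t[ `<=` `]0, t'[.
  by move=> r; rewrite /= !in_itv/= => /andP[-> /lt_trans]; apply.
have sub' : `[t, t'[ `<=` `]0, t'[.
  by move=> r; rewrite /= !in_itv/= => /andP[/(lt_le_trans t0) -> ->].
have k0 r : r \in `]0, t'[ -> r \notin `]0, t[ -> k t r = 0.
  rewrite !in_itv/= => /andP[-> _] /=; rewrite -leNgt => tr.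
  by rewrite /k pospow_le0E// subr_le0.
have ik' : mu.-integrable `]0, t'[ (EFin \o k t') by exact: kernel_integrable.
have ik : mu.-integrable `]0, t'[ (EFin \o k t).
  by apply: (itv_support_integrable sub k0); exact: kernel_integrable.
have Ik : \int[mu]_(r in `]0, t'[) k t r = kernel_mass t.
  rewrite (itv_support_integral sub k0) kernel_Rintegral ?t0 ?lexx//.
  by rewrite subr0 subrr kernel_mass0 subr0.
have Ik' : \int[mu]_(r in `]0, t'[) k t' r = kernel_mass t'.
  by rewrite kernel_Rintegral ?t0' ?lexx// subr0 subrr kernel_mass0 subr0.
pose q (r : R) : R := if t <= r then k t' r else 0.
have q0 r : r \in `]0, t'[ -> r \notin `[t, t'[ -> q r = 0.
  by rewrite /q !in_itv/= => /andP[_ ->]; rewrite andbT => /negbTE ->.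
have qE r : r \in `[t, t'[ -> q r = k t' r.
  by rewrite /q in_itv/= => /andP[->].
have ik2 : mu.-integrable `[t, t'[ (EFin \o k t') by exact: integrableS ik'.
have iq : mu.-integrable `]0, t'[ (EFin \o q).
  apply: (itv_support_integrable sub' q0); move: ik2.
  by apply: eq_integrable => // r; rewrite mem_setE => /qE /= ->.
have Iq : \int[mu]_(r in `]0, t'[) q r = kernel_mass (t' - t).
  rewrite (itv_support_integral sub' q0).
  rewrite (@eq_Rintegral _ _ _ mu _ (k t')).
    rewrite -Rintegral_itv_obnd_cbnd; last first.
      by apply: integrableS ik2 => //; apply: subset_itvr; rewrite bnd_simp.
    by rewrite kernel_Rintegral ?tt' ?lexx// subrr kernel_mass0 subr0.
  by move=> r; rewrite mem_setE => /qE.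
have iky (f : R -> R) : mu.-integrable `]0, t'[ (EFin \o f) ->
    mu.-integrable `]0, t'[ (EFin \o (fun r => f r * y r)).
  by move=> ?; apply: (bounded_mul_integrable cy yM).
have -> : abel_integral alpha y t = \int[mu]_(r in `]0, t'[) (k t r * y r).
  rewrite /abel_integral (@itv_support_integral _ `]0, t'[ `]0, t[)//.
  by move=> r rt' rt; rewrite k0// mul0r.
have iD : mu.-integrable `]0, t'[ (EFin \o (fun r => (k t' r - k t r) * y r)).
  by apply: iky; exact: integrable_subr.
rewrite -[X in `|X|]RintegralB//; [|exact: iky|exact: iky].
rewrite (@eq_Rintegral _ _ _ mu _ (fun r => (k t' r - k t r) * y r)); last first.
  by move=> r _; rewrite mulrBl.
apply: le_trans (le_normr_Rintegral _ iD) _ => //.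
pose B (r : R) := M * (k t r - k t' r) + M * (2 * q r).
have i1 : mu.-integrable `]0, t'[ (EFin \o (fun r => M * (k t r - k t' r))).
  by apply: integrable_mulr => //; exact: integrable_subr.
have i2 : mu.-integrable `]0, t'[ (EFin \o (fun r => M * (2 * q r))).
  by apply: integrable_mulr => //; exact: integrable_mulr.
apply: (@le_trans _ _ (\int[mu]_(r in `]0, t'[) B r)).
  apply: le_Rintegral => //.
  - exact: (integrable_norm iD).
  - exact: integrable_addr.
  - move=> r; rewrite /= in_itv/= => /andP[r0 rt'].
    rewrite normrM mulrC /B -mulrDr; apply: ler_pM => //.
    have a0 : 0 < alpha by case/andP: halpha.
    rewrite /q; have [tr|rt] := leP t r.
      rewrite /k [pospow _ (t - r)]pospow_le0E; last by rewrite subr_le0.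
      rewrite subr0 sub0r ger0_norm ?pospow_ge0//.
      by have := pospow_ge0 (- alpha) (t' - r); lra.
    rewrite mulr0 addr0 distrC.
    by rewrite ger0_norm// subr_ge0; apply: pospow_anti; lra.
rewrite RintegralD// RintegralZl//; last exact: integrable_subr.
rewrite RintegralB// RintegralZl//; last exact: integrable_mulr.
rewrite RintegralZl// Ik Ik' Iq.
have : kernel_mass t <= kernel_mass t'.
  rewrite /kernel_mass ler_pM2r ?invr_gt0//; apply: pospow_le; [exact: ltW|lra].
by move=> h; have := ler_wpM2l M0 h; lra.
Qed.

Lemma continuous_abel_integral (t : R) : 0 < t -> {for t, continuous (abel_integral alpha y)}.
Proof.
move=> t0; apply/cvgrPdist_le => e e0.
have cK : (2 * M * kernel_mass `|t - s|) @[s --> t] --> (0 : R).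
  rewrite -[X in _ --> X](_ : 2 * M * kernel_mass `|t - t| = 0); last first.
    by rewrite subrr normr0 kernel_mass0 mulr0.
  apply: cvgM; first exact: cvg_cst.
  apply: cvgM; last exact: cvg_cst.
  apply: (@cvg_comp _ _ _ (fun s => `|t - s|) (pospow (1 - alpha))); last first.
    exact: continuous_pospow.
  by apply: cvg_norm; apply: cvgB; [exact: cvg_cst|exact: cvg_id].
near=> s.
have s0 : 0 < s by near: s; exact: lt_nbhsr.
have : `|2 * M * kernel_mass `|t - s| | <= e.
  by near: s; apply: filterS ((cvgr0Pnorm_lt _).1 cK _ e0) => x; exact: ltW.
apply: le_trans; apply: le_trans (ler_norm _).
have [st|ts|->] := ltgtP s t.
- by rewrite (@gtr0_norm _ (t - s)) ?subr_gt0//; exact: abel_integral_diff.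
- rewrite distrC (distrC t) (@gtr0_norm _ (s - t)) ?subr_gt0//.
  exact: abel_integral_diff.
- by rewrite !subrr normr0 kernel_mass0 mulr0.
Unshelve. all: by end_near. Qed.

End AbelContinuity.

Section Clamp.
Context {R : realType}.
Variable tau : R.
Hypothesis tau0 : 0 < tau.

Definition clamp (t : R) : R := Num.max 0 (Num.min t tau).

Lemma clamp_itv t : clamp t \in `[0, tau].
Proof. by rewrite in_itv/= /clamp le_max lexx/= ge_max ge_min lexx orbT ltW. Qed.

Lemma clamp_id t : t \in `[0, tau] -> clamp t = t.
Proof. by rewrite in_itv/= /clamp => /andP[t0 tt]; rewrite min_l// max_r. Qed.

Lemma clamp_lip s t : `|clamp s - clamp t| <= `|s - t|.
Proof.
rewrite /clamp ler_norml.
have := ler_norm (s - t); have := ler_norm (t - s); rewrite distrC.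
rewrite /Num.max /Num.min; do 4! case: ifP; move=> *; lra.
Qed.

Lemma continuous_clamp {V : topologicalType} (y : R -> V) :
  {within `[0, tau], continuous y} -> continuous (y \o clamp).
Proof.
move=> /subspace_continuousP cy t.
apply: (@cvg_comp _ _ _ clamp y _ (within `[0, tau] (nbhs (clamp t)))).
  move=> A [e /= e0 eA]; exists e => // s /= se; apply: eA; last exact: clamp_itv.
  exact: le_lt_trans (clamp_lip _ _) se.
exact: cy (clamp_itv t).
Qed.

Lemma clamp_bounded {X : normedModType R} (y : R -> X) :
  {within `[0, tau], continuous y} -> exists M, forall t, `|y (clamp t)| <= M.
Proof.
move=> cy; have [|c _ hc] := @EVT_max _ (fun t => `|y t|) 0 tau (ltW tau0).
  by move=> t; apply: (continuous_comp (cy t)); exact: norm_continuous.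
by exists `|y c| => t; apply: hc; exact: clamp_itv.
Qed.

End Clamp.

Section RiemannLiouville.
Context {R : realType} {X : completeNormedModType R}.
Local Notation mu := (@lebesgue_measure R).
Variable alpha : R.
Hypothesis halpha : 0 < alpha < 1.
Local Notation G := (Gamma (1 - alpha)).
Implicit Types (phi : {linear X -> R^o}) (y u v w : R -> X).

Lemma rl_kernelE t : rl_kernel (1 - alpha) t = G^-1 * pospow (- alpha) t.
Proof.
rewrite /rl_kernel /pospow; case: ifP => _; last by rewrite mulr0.
by rewrite mulrC; congr (_ * _ `^ _); ring.
Qed.

Section Functional.
Variables (tau : R) (y : R -> X).
Hypotheses (tau0 : 0 < tau) (cy : {within `[0, tau], continuous y}).

Lemma continuous_functional_clamp phi : unit_functional phi ->
  continuous (fun r => phi (y (clamp tau r)) : R).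
Proof.
move=> hphi t; apply: (@cvg_comp _ _ _ (y \o clamp tau) phi); last first.
  exact: unit_functional_continuous.
exact: continuous_clamp.
Qed.

Lemma functional_clamp_bounded phi : unit_functional phi ->
  exists M, forall t, `|(phi (y (clamp tau t)) : R)| <= M.
Proof.
move=> hphi; have [M hM] := clamp_bounded tau0 cy.
by exists M => t; exact: le_trans (hphi _) (hM t).
Qed.

Lemma rl_integral_functional phi t : unit_functional phi -> 0 < t <= tau ->
  phi (rl_integral (1 - alpha) y t) =
  G^-1 * abel_integral alpha (fun r => phi (y (clamp tau r))) t.
Proof.
move=> hphi /andP[t0 tt]; have [M hM] := clamp_bounded tau0 cy.
have G0 := Gamma_gt0 halpha.
have [cyo _ _] := (continuous_within_itvP _ tau0).1 cy.
have iN : mu.-integrable `]0, t[ (EFin \o (fun r => G^-1 * M * pospow (- alpha) (t - r))).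
  by apply: integrable_mulr => //; exact: kernel_integrable.
rewrite /rl_integral (bochner_integral_continuous t0 hphi _ iN); last 2 first.
- move=> r; rewrite inE/= in_itv/= => /andP[r0 rt].
  apply: cvgZ; last by apply: cyo; rewrite in_itv/= r0 (lt_le_trans rt).
  under eq_cvg do rewrite rl_kernelE; rewrite rl_kernelE.
  by apply: cvgM; [exact: cvg_cst|exact: continuous_pospow_rev_at].
- move=> r; rewrite /= in_itv/= => /andP[r0 rt].
  have rc : clamp tau r = r.
    by apply: clamp_id; rewrite in_itv/= (ltW r0) (le_trans (ltW rt)).
  rewrite normrZ rl_kernelE ger0_norm ?mulr_ge0 ?pospow_ge0 ?invr_ge0 ?(ltW G0)//.
  rewrite mulrAC ler_wpM2r ?pospow_ge0// ler_wpM2l ?invr_ge0 ?(ltW G0)//.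
  by rewrite -rc.
have [N hN] := functional_clamp_bounded hphi.
rewrite -RintegralZl//; last first.
  by apply: (abel_integrable halpha _ hN); exact: continuous_functional_clamp.
apply: eq_Rintegral => r; rewrite inE/= in_itv/= => /andP[r0 rt].
rewrite clamp_id; last by rewrite in_itv/= (ltW r0) (le_trans (ltW rt)).
by rewrite linearZ rl_kernelE /GRing.scale/= mulrA.
Qed.

Lemma rl_functional_continuous phi t : unit_functional phi -> 0 < t ->
  {for t, continuous (fun s => G^-1 * abel_integral alpha (fun r => phi (y (clamp tau r))) s)}.
Proof.
move=> hphi t0; have [N hN] := functional_clamp_bounded hphi.
apply: cvgM; first exact: cvg_cst.
by apply: (continuous_abel_integral halpha _ hN) => //; exact: continuous_functional_clamp.
Qed.

Lemma W11_functional_FTC phi : unit_functional phi ->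
  W11 0 tau (rl_integral (1 - alpha) y) ->
  exists k : R -> R, mu.-integrable `]0, tau[ (EFin \o k) /\
    forall s t : R, 0 < s -> s < t -> t < tau ->
      phi (rl_integral (1 - alpha) y t) - phi (rl_integral (1 - alpha) y s) =
      \int[mu]_(x in `]s, t[) k x.
Proof.
move=> hphi [iy [y' [[v' iy'] weak]]].
pose g s := G^-1 * abel_integral alpha (fun r => phi (y (clamp tau r))) s.
have gE s : 0 < s < tau -> phi (rl_integral (1 - alpha) y s) = g s.
  by move=> /andP[s0 st]; rewrite rl_integral_functional// s0 ltW.
have [k [ik kE]] := bochner_functional_itv hphi iy'.
have mk : measurable_fun (`]0, tau[%classic : set R) k.
  by apply/measurable_EFinP; exact: measurable_int ik.
have cg : {in (`]0, tau[%classic : set R), continuous g}.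
  move=> s; rewrite inE/= in_itv/= => /andP[s0 _].
  exact: rl_functional_continuous.
have cont_psi (psi : R -> R) n : test_function 0 tau psi -> continuous (derive1n n psi).
  move=> [h _ _] x; apply/differentiable_continuous/derivable1_diffP; exact: h.
have bnd_psi (psi : R -> R) n : test_function 0 tau psi ->
    exists M, forall t, `]0, tau[%classic t -> `|derive1n n psi t| <= M.
  move=> /(cont_psi _ n) cp.
  have [|c _ hc] := @EVT_max _ (fun t => `|derive1n n psi t|) 0 tau (ltW tau0).
    apply: continuous_subspaceT => x; apply: (@cvg_comp _ _ _ (derive1n n psi) Num.norm).
      exact: cp.
    exact: norm_continuous.
  exists `|derive1n n psi c| => t; rewrite /= in_itv/= => /andP[t0 tt].
  by apply: hc; rewrite in_itv/= !ltW.
have mpsi (psi : R -> R) n : test_function 0 tau psi ->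
    measurable_fun (`]0, tau[%classic : set R) (derive1n n psi).
  by move=> /(cont_psi _ n) cp; apply: measurable_funTS; exact: continuous_measurable_fun.
exists k; split => // s t s0 st ttau.
rewrite !gE ?s0 ?(lt_trans s0 st) ?(lt_trans st)//.
apply: (weak_derivative_FTC cg ik) => // psi tpsi.
have := congr1 phi (weak psi tpsi).
have [M0 hM0] := bnd_psi psi 0%N tpsi; have [M1 hM1] := bnd_psi psi 1%N tpsi.
rewrite linearN.
rewrite (@bochner_integral_functional_itv _ _ _ _ _
  (fun x => derive1 psi x * g x))//; last 3 first.
- apply: (@scale_bochner_integrable _ _ tau0 _ _ _ M1) => //.
    by move=> x _; have := cont_psi psi 1%N tpsi x.
- apply: measurable_funM; first by have := mpsi psi 1%N tpsi.
  apply: open_continuous_measurable_fun => //.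
- apply: aeW => x; rewrite /= in_itv/= => xt.
  by rewrite linearZ gE.
rewrite (@bochner_integral_functional_itv _ _ _ _ _
  (fun x => psi x * k x))//.
- apply: (@scale_bochner_integrable _ _ tau0 _ _ _ M0) => //; last by exists v'.
  by move=> x _; have := cont_psi psi 0%N tpsi x.
- by apply: measurable_funM => //; have := mpsi psi 0%N tpsi.
- apply: filterS kE; first exact: (ae_filter_ringOfSetsType mu).
  by move=> x kx Dx; rewrite linearZ kx.
Qed.

End Functional.
End RiemannLiouville.

Section CaputoUniqueness.
Context {R : realType} {X : completeNormedModType R}.
Local Notation mu := (@lebesgue_measure R).
Variable alpha : R.
Hypothesis halpha : 0 < alpha < 1.
Local Notation G := (Gamma (1 - alpha)).
Implicit Types (phi : {linear X -> R^o}) (u v w : R -> X).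

Lemma is_derive_cvg {V : normedModType R} (f : R -> V) (x : R) (l : V) :
  is_derive x 1 f l -> h^-1 *: (f (h + x) - f x) @[h --> 0^'] --> l.
Proof.
move=> [d <-]; move: d; rewrite /derivable /derive => d.
have e (h : R) : h *: (1 : R) = h by exact: mulr1.
have -> : (fun h : R => h^-1 *: (f (h + x) - f x)) =
    (fun h : R => h^-1 *: ((f \o shift x) (h *: 1) - f x)).
  by apply/funext => h; rewrite /= e.
exact: d.
Qed.

Lemma functional_is_derive phi (f : R -> X) (x : R) (l : X) : unit_functional phi ->
  is_derive x 1 f l -> is_derive x 1 (fun s => phi (f s) : R) (phi l).
Proof.
move=> hphi /is_derive_cvg fl; apply: cvg_is_derive.
have -> : (fun h : R => h^-1 *: ((phi (f (h + x)) : R) - phi (f x))) =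
    phi \o (fun h : R => h^-1 *: (f (h + x) - f x)).
  by apply/funext => h; rewrite /= linearZ/= (raddfB phi).
apply: (@cvg_comp _ _ _ _ phi _ _ _ fl).
exact: unit_functional_continuous.
Qed.

Lemma abel_integralB (y1 y2 : R -> R) (M1 M2 t : R) :
  continuous y1 -> (forall r, `|y1 r| <= M1) ->
  continuous y2 -> (forall r, `|y2 r| <= M2) ->
  abel_integral alpha (fun r => y1 r - y2 r) t =
  abel_integral alpha y1 t - abel_integral alpha y2 t.
Proof.
move=> c1 h1 c2 h2; rewrite /abel_integral -RintegralB//.
- by apply: eq_Rintegral => r _; rewrite mulrBr.
- exact: (abel_integrable halpha c1 h1).
- exact: (abel_integrable halpha c2 h2).
Qed.

Lemma within_continuousB_cst (A : set R) (y : R -> X) (c : X) :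
  {within A, continuous y} -> {within A, continuous (fun r => y r - c)}.
Proof. by move=> cy t; apply: cvgB; [exact: cy|exact: cvg_cst]. Qed.

Lemma ae_derive0_constant (tau s' : R) (g k : R -> R) : s' <= tau ->
  mu.-integrable `]0, tau[ (EFin \o k) ->
  (forall s t : R, 0 < s -> s < t -> t < tau ->
     g t - g s = \int[mu]_(x in `]s, t[) k x) ->
  {ae mu, forall t, 0 < t < s' -> is_derive t (1 : R) g 0} ->
  forall s t, 0 < s -> s < t -> t < s' -> g t = g s.
Proof.
move=> stau ik hg dg s t s0 st ts'.
have tt : t < tau by exact: lt_le_trans stau.
apply/eqP; rewrite -subr_eq0 hg//; apply/eqP.
pose kp : R -> R := k \_ (`]0, tau[%classic : set R).
have lkp : locally_integrable [set: R] kp.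
  by apply: integrable_locally => //; exact: measurable_itv.
have ikp : mu.-integrable [set: R] (EFin \o kp).
  have := (@integrable_mkcond _ _ _ mu `]0, tau[ (EFin \o k) (measurable_itv _)).1 ik.
  rewrite (_ : _ \_ _ = EFin \o kp)//.
  by apply/funext => x; rewrite /= /kp !patchE; case: ifP.
have ikx (i : interval R) : mu.-integrable [set` i] (EFin \o kp).
  by apply: integrableS ikp => //; exact: measurable_itv.
have kpE x : 0 < x < tau -> kp x = k x.
  by move=> h; rewrite /kp patchE mem_set//= in_itv.
have aeFTC := @FTC1 _ kp (BRight s) (fun y => ikx _) lkp.
have k0 : {ae mu, forall x, `]s, t[%classic x -> k x = 0}.
  apply: filterS2 dg aeFTC; first exact: (ae_filter_ringOfSetsType mu).
  move=> x dgx; rewrite /= in_itv/= => + /andP[sx xt] => /(_ sx)[dF F'].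
  have x0 := lt_trans s0 sx; have xs' := lt_trans xt ts'.
  have {}dgx : is_derive x (1 : R) g 0 by apply: dgx; rewrite x0.
  rewrite -kpE ?x0 ?(lt_le_trans xs')// -F' derive1E.
  suff : is_derive x (1 : R) (fun y => \int[mu]_(r in [set` Interval (BRight s) (BRight y)]) kp r) 0.
    by case.
  apply: (@near_eq_is_derive _ _ _ (fun y => g y - g s)); last first.
    have := is_deriveB dgx (is_derive_cst (g s) x (1 : R)).
    by rewrite subr0.
  near=> y.
  have sy : s < y by near: y; exact: lt_nbhsr.
  have ytau : y < tau by near: y; apply: lt_nbhsl; exact: lt_le_trans stau.
  rewrite hg// Rintegral_itv_bndo_bndc; last first.
    apply: integrableS ik => //.
    by move=> r; rewrite /= !in_itv/= => /andP[/(lt_trans s0) -> /lt_trans]; apply.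
  apply: eq_Rintegral => r; rewrite inE/= in_itv/= => /andP[sr ry].
  by rewrite kpE// (lt_trans s0 sr) (le_lt_trans ry).
rewrite /Rintegral (ae_eq_integral (cst 0%E)) ?integral0//.
- have : mu.-integrable `]s, t[ (EFin \o k).
    apply: integrableS ik => //.
    by move=> r; rewrite /= !in_itv/= => /andP[/(lt_trans s0) -> /lt_trans]; apply.
  exact: measurable_int.
- apply: filterS k0; first exact: (ae_filter_ringOfSetsType mu).
  by move=> x kx Dx; rewrite /= kx.
Unshelve. all: by end_near. Qed.

Lemma caputo_unique (tau s' : R) u v (wu wv : R -> X) : 0 < s' <= tau ->
  is_caputo alpha tau u wu -> is_caputo alpha tau v wv -> v 0 = u 0 ->
  (forall t, 0 < t < s' -> wv t = wu t) -> forall t, 0 < t < s' -> v t = u t.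
Proof.
move=> /andP[s'0 s'tau] [cu Wu du] [cv Wv dv] vu0 wvu.
have tau0 : 0 < tau by exact: lt_le_trans s'tau.
have G0 := Gamma_gt0 halpha.
suff key phi : unit_functional phi -> forall t, 0 < t < s' -> phi (v t) = phi (u t).
  move=> t ht; have [phi [hphi nphi]] := norming_functional (v t - u t).
  apply/eqP; rewrite -subr_eq0 -normr_eq0 -nphi linearB/=.
  by rewrite (key phi hphi t ht) subrr.
move=> hphi.
have [ku [iku hku]] := W11_functional_FTC halpha tau0 cu hphi Wu.
have [kv [ikv hkv]] := W11_functional_FTC halpha tau0 cv hphi Wv.
pose Y (r : R) : R := phi (v (clamp tau r)) - phi (u (clamp tau r)).
have cfu := continuous_functional_clamp tau0 cu hphi.
have cfv := continuous_functional_clamp tau0 cv hphi.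
have [Mu hMu] := functional_clamp_bounded tau0 cu hphi.
have [Mv hMv] := functional_clamp_bounded tau0 cv hphi.
have cY : continuous Y by move=> r; apply: cvgB; [exact: cfv|exact: cfu].
have YM r : `|Y r| <= Mv + Mu.
  by apply: le_trans (ler_normB _ _) _; apply: lerD; [exact: hMv|exact: hMu].
pose g (t : R) : R := phi (rl_integral (1 - alpha) v t) - phi (rl_integral (1 - alpha) u t).
have gE t : 0 < t <= tau -> g t = G^-1 * abel_integral alpha Y t.
  move=> ht; rewrite /g (rl_integral_functional halpha tau0 cv hphi ht).
  rewrite (rl_integral_functional halpha tau0 cu hphi ht) -mulrBr.
  by rewrite (abel_integralB _ cfv hMv cfu hMu).
pose g' (t : R) : R := phi (rl_integral (1 - alpha) (fun r => v r - v 0) t)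
  - phi (rl_integral (1 - alpha) (fun r => u r - u 0) t).
have g'E t : 0 < t <= tau -> g' t = G^-1 * abel_integral alpha Y t.
  have cu0 := within_continuousB_cst (c := u 0) cu.
  have cv0 := within_continuousB_cst (c := v 0) cv.
  have cfu0 := continuous_functional_clamp tau0 cu0 hphi.
  have cfv0 := continuous_functional_clamp tau0 cv0 hphi.
  have [Mu0 hMu0] := functional_clamp_bounded tau0 cu0 hphi.
  have [Mv0 hMv0] := functional_clamp_bounded tau0 cv0 hphi.
  move=> ht; rewrite /g' (rl_integral_functional halpha tau0 cv0 hphi ht).
  rewrite (rl_integral_functional halpha tau0 cu0 hphi ht) -mulrBr.
  rewrite -(abel_integralB _ cfv0 hMv0 cfu0 hMu0); congr (_ * abel_integral _ _ _).
  apply/funext => r; rewrite /Y !linearB/= vu0; ring.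
have dg : {ae mu, forall t, 0 < t < s' -> is_derive t (1 : R) g 0}.
  apply: filterS2 du dv; first exact: (ae_filter_ringOfSetsType mu).
  move=> t dut dvt /andP[t0 ts'].
  have ttau : t < tau by exact: lt_le_trans s'tau.
  have tin : t \in `]0, tau[ by rewrite in_itv/= t0.
  have dphiu := functional_is_derive hphi (dut tin).
  have dphiv := functional_is_derive hphi (dvt tin).
  apply: (@near_eq_is_derive _ _ _ g'); last first.
    apply: is_derive_eq (is_deriveB dphiv dphiu) _.
    by rewrite wvu ?t0// subrr.
  near=> s; rewrite gE ?g'E//.
    apply/andP; split; first by near: s; exact: lt_nbhsr.
    by apply: ltW; near: s; exact: lt_nbhsl.
  apply/andP; split; first by near: s; exact: lt_nbhsr.
  by apply: ltW; near: s; exact: lt_nbhsl.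
have ik : mu.-integrable `]0, tau[ (EFin \o (fun x => kv x - ku x)).
  by apply: integrable_subr => //; exact: measurable_itv.
have hk (s t : R) : 0 < s -> s < t -> t < tau ->
    g t - g s = \int[mu]_(x in `]s, t[) (kv x - ku x).
  move=> s0 st tt.
  have sub : `]s, t[ `<=` `]0, tau[.
    by move=> x; rewrite /= !in_itv/= => /andP[/(lt_trans s0) -> /lt_trans]; apply.
  rewrite RintegralB//; last 2 first.
  - by apply: integrableS ikv.
  - by apply: integrableS iku.
  have swap (a b c d : R) : a - b - (c - d) = a - c - (b - d) by ring.
  by rewrite -(hku s t s0 st tt) -(hkv s t s0 st tt); exact: swap.
have gconst := ae_derive0_constant s'tau ik hk dg.
have g0 t : 0 < t < s' -> g t = 0.
  move=> /andP[t0 ts']; apply/eqP; rewrite -normr_eq0 eq_le normr_ge0 andbT.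
  have cK : G^-1 * ((Mv + Mu) * kernel_mass alpha s) @[s --> 0^'+] --> (0 : R).
    rewrite -[X in _ --> X](_ : G^-1 * ((Mv + Mu) * kernel_mass alpha 0) = 0); last first.
      by rewrite kernel_mass0 !mulr0.
    apply: cvg_within_filter.
    apply: cvgM; first exact: cvg_cst.
    apply: cvgM; first exact: cvg_cst.
    apply: cvgM; last exact: cvg_cst.
    by apply: continuous_pospow; case/andP: halpha => _; rewrite subr_gt0.
  rewrite leNgt; apply/negP => gt0.
  near ((0 : R)^'+) => s.
  have s0 : 0 < s by near: s; exact: nbhs_right_gt.
  have st : s < t by near: s; exact: nbhs_right_lt.
  have : `|G^-1 * ((Mv + Mu) * kernel_mass alpha s)| < `|g t|.
    by near: s; exact: (cvgr0Pnorm_lt _).1 cK _ gt0.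
  rewrite (gconst s t)// gE; last by rewrite s0 ltW// (lt_trans st) ?(lt_le_trans ts').
  apply/negP; rewrite -leNgt normrM [X in _ <= X]normrM; apply: ler_wpM2l => //.
  apply: le_trans (abel_integral_le halpha cY YM s0) _.
  exact: ler_norm.
move=> t ht; apply/eqP; rewrite -subr_eq0; apply/eqP.
have ttau : 0 <= t <= tau.
  by case/andP: ht => t0 ts'; rewrite (ltW t0) (le_trans (ltW ts')).
have <- : Y t = phi (v t) - phi (u t) by rewrite /Y clamp_id// in_itv.
apply: (abel_injective halpha cY YM _ ht) => s /andP[s0 ss'].
have := g0 s; rewrite s0 ss' => /(_ isT)/eqP.
rewrite gE ?s0 ?(le_trans (ltW ss'))// mulf_eq0 invr_eq0 (gt_eqF G0)/=.
by move/eqP.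
Unshelve. all: by end_near. Qed.

End CaputoUniqueness.

(** * The Caputo derivative of a piecewise linear path *)

Section ScalarExample.
Context {R : realType}.
Local Notation mu := (@lebesgue_measure R).

Lemma test_function_margin (tau : R) (psi : R -> R) : 0 < tau -> test_function 0 tau psi ->
  exists c d : R, [/\ 0 < c, c < d, d < tau &
    forall x, ~~ (c < x < d) -> psi x = 0].
Proof.
move=> tau0 [_ cK sub]; set K := closure _ in cK sub.
have KE x : psi x != 0 -> K x by move=> ?; exact: subset_closure.
have [K0|K0] := pselect (K !=set0); last first.
  exists (tau / 3), (tau / 2); split; try lra.
  move=> x _; apply: contrapT => /eqP/KE Kx; apply: K0; by exists x.
have cid : {within K, continuous (@id R)}.
  by apply: continuous_subspaceT => x; exact: cvg_id.
have [a /set_mem Ka ha] := compact_EVT_min K0 cK cid.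
have [b /set_mem Kb hb] := compact_EVT_max K0 cK cid.
have := sub _ Ka; rewrite /= in_itv/= => /andP[a0 at_].
have := sub _ Kb; rewrite /= in_itv/= => /andP[b0 bt].
have ab : a <= b by apply: hb; exact/mem_set.
exists (a / 2), ((b + tau) / 2); split; try lra.
move=> x; apply: contraNeq => /KE/mem_set Kx.
have := ha _ Kx; have := hb _ Kx => /=; lra.
Qed.

Lemma weak_derivative_by_parts (tau : R) (g g1 psi : R -> R) : 0 < tau ->
  (forall t, 0 < t < tau -> is_derive t (1 : R) g (g1 t)) ->
  (forall t, 0 < t < tau -> {for t, continuous g1}) ->
  test_function 0 tau psi ->
  \int[mu]_(x in `]0, tau[) (derive1 psi x * g x) =
  - \int[mu]_(x in `]0, tau[) (psi x * g1 x).
Proof.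
move=> tau0 dg cg1 tpsi; have [c [d [c0 cd dt supp]]] := test_function_margin tau0 tpsi.
have dpsi x : derivable psi x 1 by have [h _ _] := tpsi; exact: (h 0%N).
have cpsi : continuous psi.
  by move=> x; apply/differentiable_continuous/derivable1_diffP.
have cpsi' : continuous (derive1 psi).
  move=> x; apply/differentiable_continuous/derivable1_diffP.
  by have [h _ _] := tpsi; have := h 1%N x; rewrite derive1n1.
have cg t : 0 < t < tau -> {for t, continuous g}.
  by move=> ht; apply/differentiable_continuous/derivable1_diffP; have [] := dg t ht.
have sub x : x \in `[c, d] -> 0 < x < tau by rewrite in_itv/=; lra.
have sub' : `[c, d] `<=` `]0, tau[.
  by move=> x; rewrite /= => /sub; rewrite in_itv.
have dpsi0 x : x \notin `[c, d] -> derive1 psi x = 0.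
  rewrite in_itv/= negb_and -!ltNge derive1E => /orP[xc|dx].
    rewrite (@near_eq_derive _ _ _ _ (cst 0)); first exact: derive_cst.
    near=> y; apply: supp; rewrite negb_and -!leNgt.
    by apply/orP; left; apply: ltW; near: y; exact: lt_nbhsl.
  rewrite (@near_eq_derive _ _ _ _ (cst 0)); first exact: derive_cst.
  near=> y; apply: supp; rewrite negb_and -!leNgt.
  by apply/orP; right; apply: ltW; near: y; exact: lt_nbhsr.
rewrite (@itv_support_integral _ `]0, tau[ `[c, d])//; last first.
  by move=> x _ xcd; rewrite dpsi0// mul0r.
rewrite (@itv_support_integral _ `]0, tau[ `[c, d])//; last first.
  move=> x _ xcd; rewrite supp ?mul0r//; move: xcd; rewrite in_itv/=.
  by apply: contra => /andP[/ltW -> /ltW ->].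
have /= := @Rintegration_by_parts _ psi g (derive1 psi) g1 c d cd.
rewrite (supp c) ?ltxx// (supp d) ?ltxx ?andbF// !mul0r subr0 sub0r => ->.
- by rewrite opprK.
- exact: continuous_subspaceT.
- split; first by move=> x _; exact: dpsi.
  + by apply: cvg_within_filter; exact: cpsi.
  + by apply: cvg_within_filter; exact: cpsi.
- by [].
- apply: continuous_in_subspaceT => x /set_mem; rewrite /= => /sub; exact: cg1.
- split.
  + by move=> x xcd; have [] := dg x (sub _ (subset_itv_oo_cc xcd)).
  + by apply: cvg_within_filter; apply: cg; lra.
  + by apply: cvg_within_filter; apply: cg; lra.
- by move=> x xcd; rewrite derive1E; have [_ ->] := dg x (sub _ (subset_itv_oo_cc xcd)).
Unshelve. all: by end_near. Qed.

Definition grid (k : nat) : R := 1 - k.+1%:R^-1.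
Definition mesh (k : nat) : R := grid k.+1 - grid k.

Lemma grid0 : grid 0 = 0.
Proof. by rewrite /grid invr1 subrr. Qed.

Lemma grid_ge0 k : 0 <= grid k.
Proof. by rewrite /grid subr_ge0 invf_le1 ?ler1n ?ltr0n. Qed.

Lemma grid_lt1 k : grid k < 1.
Proof. by rewrite /grid ltrBlDr ltrDl invr_gt0 ltr0n. Qed.

Lemma mesh_gt0 k : 0 < mesh k.
Proof.
have : (k.+2%:R^-1 : R) < k.+1%:R^-1 by rewrite ltf_pV2 ?posrE ?ltr0n// ltr_nat.
rewrite /mesh /grid.
set a := k.+2%:R^-1; set b := k.+1%:R^-1; lra.
Qed.

Lemma grid_le k l : (k <= l)%N -> grid k <= grid l.
Proof.
by move=> kl; rewrite /grid lerD2l lerN2 lef_pV2 ?posrE ?ltr0n// ler_nat ltnS.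
Qed.

Lemma mesh_le k : mesh k <= k.+1%:R^-1.
Proof.
rewrite /mesh /grid.
have : 0 <= (k.+2%:R^-1 : R) by rewrite invr_ge0.
set a := k.+2%:R^-1; set b := k.+1%:R^-1; lra.
Qed.

Definition cell (t : R) : nat := Num.truncn (1 - t)^-1.

Lemma lt_grid_cell t : t < 1 -> t < grid (cell t).
Proof.
move=> t1; have d0 : 0 < 1 - t by rewrite subr_gt0.
have /truncn_itv/andP[_] : 0 <= (1 - t)^-1 by rewrite invr_ge0 ltW.
rewrite -/(cell t) /grid => h.
have : (cell t).+1%:R^-1 < 1 - t by rewrite -(invrK (1 - t)) ltf_pV2 ?posrE ?invr_gt0 ?ltr0n.
set x := _.+1%:R^-1; lra.
Qed.

Lemma cell_gt0 t : 0 <= t < 1 -> (0 < cell t)%N.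
Proof.
move=> /andP[t0 t1]; have d0 : 0 < 1 - t by rewrite subr_gt0.
by rewrite /cell truncn_ge_nat ?invr_ge0 ?(ltW d0)// invf_ge1//; lra.
Qed.

Lemma grid_cell_le t : 0 <= t < 1 -> grid (cell t).-1 <= t.
Proof.
move=> t01; have c0 := cell_gt0 t01; have /andP[t0 t1] := t01.
have d0 : 0 < 1 - t by rewrite subr_gt0.
have /truncn_itv/andP[h _] : 0 <= (1 - t)^-1 by rewrite invr_ge0 ltW.
rewrite /grid prednK//; rewrite -/(cell t) in h.
have : 1 - t <= (cell t)%:R^-1 by rewrite -(invrK (1 - t)) lef_pV2 ?posrE ?invr_gt0 ?ltr0n.
set x := _%:R^-1; lra.
Qed.

Definition ramp_between (p : R) (k : nat) (t : R) : R :=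
  (pospow p (t - grid k) - pospow p (t - grid k.+1)) / mesh k.

Lemma ramp_between_left p k t : t <= grid k -> ramp_between p k t = 0.
Proof.
move=> tk; have tk1 : t <= grid k.+1 by exact: le_trans (grid_le (leqnSn k)).
by rewrite /ramp_between !pospow_le0E ?subr_le0// subrr mul0r.
Qed.

Lemma ramp_between1_right k t : grid k.+1 <= t -> ramp_between 1 k t = 1.
Proof.
move=> kt; have := mesh_gt0 k; rewrite /mesh => h0.
have k1 : grid k < t by apply: lt_le_trans kt; rewrite -subr_gt0.
have r1 x : 0 <= x -> pospow 1 x = x.
  rewrite le_eqVlt => /predU1P[<-|x0]; first by rewrite pospow_le0E.
  by rewrite pospow_gt0E// powRr1// ltW.
rewrite /ramp_between !r1 ?subr_ge0// ?(ltW k1)// /mesh.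
by rewrite (_ : t - _ - _ = grid k.+1 - grid k) ?mulfV ?gt_eqF//; ring.
Qed.

Lemma ramp_between1_itv k t : 0 <= ramp_between 1 k t <= 1.
Proof.
have h0 := mesh_gt0 k.
have r1 x : pospow 1 x = Num.max x 0.
  have [x0|x0] := ltP 0 x; first by rewrite pospow_gt0E// powRr1 ?ltW.
  by rewrite pospow_le0E.
rewrite /ramp_between ler_pdivlMr// mul0r ler_pdivrMr// mul1r !r1.
move: h0; rewrite /mesh /Num.max; case: ifP; case: ifP; lra.
Qed.

Lemma continuous_ramp_between p k : 0 < p -> continuous (ramp_between p k).
Proof.
move=> p0 t; apply: cvgM; last exact: cvg_cst.
have c (a : R) : pospow p (s - a) @[s --> t] --> pospow p (t - a).
  apply: (@cvg_comp _ _ _ (fun s => s - a) (pospow p)); last exact: continuous_pospow.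
  by apply: cvgB; [exact: cvg_id|exact: cvg_cst].
by apply: cvgB; exact: c.
Qed.

Lemma is_derive_ramp_between p k t : 1 < p ->
  is_derive t (1 : R) (ramp_between p k) (p * ramp_between (p - 1) k t).
Proof.
move=> p1.
have d (a : R) : is_derive t (1 : R) (fun s => pospow p (s - a)) (p * pospow (p - 1) (t - a)).
  have d1 : is_derive t (1 : R) (fun s : R => s - a) 1.
    by rewrite -[X in is_derive _ _ _ X]subr0; apply: is_deriveB.
  have := @is_derive1_comp _ (pospow p) (fun s => s - a) t _ _ (is_derive_pospow _ p1) d1.
  by rewrite mulr1.
have D := is_deriveZ (mesh k)^-1 (is_deriveB (d (grid k)) (d (grid k.+1))).
apply: near_eq_is_derive; last first.
  apply: is_derive_eq D _; rewrite /GRing.scale/= /ramp_between; ring.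
near=> s; rewrite /ramp_between [RHS]mulrC //.
Unshelve. all: by end_near. Qed.

Variable alpha : R.
Hypothesis halpha : 0 < alpha < 1.

Lemma abel_integral_ramp k t : 0 < t ->
  abel_integral alpha (ramp_between 1 k) t =
  ramp_between (2 - alpha) k t / ((1 - alpha) * (2 - alpha)).
Proof.
move=> t0; rewrite /abel_integral.
have ir (a : R) : mu.-integrable `]0, t[
    (EFin \o (fun r => pospow (- alpha) (t - r) * pospow 1 (r - a))).
  apply: (@le_integrable _ _ _ mu _ (measurable_itv _) _
    (EFin \o (fun r => pospow 1 (t - a) * pospow (- alpha) (t - r)))).
  - apply/measurable_EFinP; apply: measurable_funTS; apply: measurable_funM.
      by apply: (measurableT_comp (measurable_pospow _)); exact: measurable_funB.
    by apply: (measurableT_comp (measurable_pospow _)); exact: measurable_funB.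
  - move=> r; rewrite /= in_itv/= => /andP[r0 rt].
    rewrite lee_fin !ger0_norm ?mulr_ge0 ?pospow_ge0// mulrC.
    rewrite ler_wpM2r ?pospow_ge0//; apply: pospow_le => //; lra.
  - apply: integrable_mulr => //; exact: kernel_integrable.
have E : \int[mu]_(r in `]0, t[) (pospow (- alpha) (t - r) * ramp_between 1 k r) =
   \int[mu]_(r in `]0, t[) ((mesh k)^-1 * (pospow (- alpha) (t - r) * pospow 1 (r - grid k)
     - pospow (- alpha) (t - r) * pospow 1 (r - grid k.+1))).
  by apply: eq_Rintegral => r _; rewrite /ramp_between; ring.
rewrite E RintegralZl//; last by apply: integrable_subr.
rewrite RintegralB// !kernel_ramp_integral ?grid_ge0//.
by rewrite /ramp_between; ring.
Qed.

Lemma abel_integral_cst c t : 0 < t ->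
  abel_integral alpha (fun=> c) t = c * kernel_mass alpha t.
Proof.
move=> t0; rewrite /abel_integral.
rewrite (@eq_Rintegral _ _ _ mu _ (fun r => c * pospow (- alpha) (t - r))); last first.
  by move=> r _; rewrite mulrC.
rewrite RintegralZl//; last exact: kernel_integrable.
by rewrite kernel_Rintegral// ?t0 ?lexx// subr0 subrr kernel_mass0 subr0.
Qed.

Lemma abel_integral_combination c (e : nat -> R) M t : 0 < t ->
  abel_integral alpha (fun r => c + \sum_(k < M) ramp_between 1 k r * e k) t =
  c * kernel_mass alpha t +
  \sum_(k < M) ramp_between (2 - alpha) k t / ((1 - alpha) * (2 - alpha)) * e k.
Proof.
move=> t0; elim: M => [|M IH].
  rewrite big_ord0 addr0 -(abel_integral_cst c t0); congr abel_integral.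
  by apply/funext => r; rewrite big_ord0 addr0.
have cr k : continuous (ramp_between 1 k) by apply: continuous_ramp_between.
have cs N : continuous (fun r : R => c + \sum_(k < N) ramp_between 1 k r * e k).
  elim: N => [|N IHN].
    rewrite (_ : (fun r => _) = cst c); first by move=> r; exact: cvg_cst.
    by apply/funext => r; rewrite big_ord0 addr0.
  rewrite (_ : (fun r => _) = (fun r => (c + \sum_(k < N) ramp_between 1 k r * e k)
      + ramp_between 1 N r * e N)).
    by move=> r; apply: cvgD; [exact: IHN|apply: cvgM; [exact: cr|exact: cvg_cst]].
  by apply/funext => r; rewrite big_ord_recr/= addrA.
have bs N : exists B, forall r, `|c + \sum_(k < N) ramp_between 1 k r * e k| <= B.
  exists (`|c| + \sum_(k < N) `|e k|) => r; apply: le_trans (ler_normD _ _) _.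
  rewrite lerD2l; apply: le_trans (ler_norm_sum _ _ _) _; apply: ler_sum => k _.
  rewrite normrM ler_piMl//; have /andP[? ?] := ramp_between1_itv k r.
  by rewrite ger0_norm.
have br r : `|ramp_between 1 M r * e M| <= `|e M|.
  rewrite normrM ler_piMl//; have /andP[? ?] := ramp_between1_itv M r.
  by rewrite ger0_norm.
have crM : continuous (fun r => ramp_between 1 M r * e M).
  by move=> r; apply: cvgM; [exact: cr|exact: cvg_cst].
have [B hB] := bs M.
rewrite big_ord_recr/= addrA -IH -(abel_integral_ramp _ t0).
rewrite (_ : abel_integral alpha (ramp_between 1 M) t * e M =
  abel_integral alpha (fun r => ramp_between 1 M r * e M) t); last first.
  rewrite /abel_integral mulrC -RintegralZl//.
    by apply: eq_Rintegral => r _; ring.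
  apply: (@abel_integrable _ _ halpha _ 1); first exact: cr.
  by move=> r; have /andP[? ?] := ramp_between1_itv M r; rewrite ger0_norm.
rewrite /abel_integral -RintegralD//.
- by apply: eq_Rintegral => r _; rewrite big_ord_recr/= addrA mulrDr.
- exact: (abel_integrable halpha (cs M) hB).
- exact: (abel_integrable halpha crM br).
Qed.

End ScalarExample.

Section PiecewiseLinear.
Context {R : realType} {X : completeNormedModType R}.
Local Notation mu := (@lebesgue_measure R).
Variable alpha : R.
Hypothesis halpha : 0 < alpha < 1.
Local Notation G := (Gamma (1 - alpha)).
Variable d : nat -> X.

Let G0 : 0 < G. Proof. exact: Gamma_gt0. Qed.
Let alpha1 : 0 < 1 - alpha. Proof. by case/andP: halpha; rewrite subr_gt0. Qed.
Let alpha2 : 1 < 2 - alpha. Proof. by case/andP: halpha; lra. Qed.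

Lemma functional_separation (x y : X) :
  (forall phi : {linear X -> R^o}, unit_functional phi -> phi x = phi y) -> x = y.
Proof.
move=> h; have [phi [hphi nphi]] := norming_functional (x - y).
by apply/eqP; rewrite -subr_eq0 -normr_eq0 -nphi linearB/= (h phi hphi) subrr.
Qed.

Definition combination (c : nat -> R -> R) (M : nat) (t : R) : X :=
  \sum_(k < M) c k t *: d k.

Lemma continuous_combination (c : nat -> R -> R) M t :
  (forall k, {for t, continuous (c k)}) -> {for t, continuous (combination c M)}.
Proof.
move=> cc; elim: M => [|M IH].
  rewrite (_ : combination c 0 = cst 0); first exact: cvg_cst.
  by apply/funext => s; rewrite /combination big_ord0.
rewrite (_ : combination c M.+1 = (fun s => combination c M s + c M s *: d M)).
  by apply: cvgD; [exact: IH|apply: cvgZ; [exact: cc|exact: cvg_cst]].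
by apply/funext => s; rewrite /combination big_ord_recr.
Qed.

Lemma is_derive_combination (c c' : nat -> R -> R) M (t : R) :
  (forall k, is_derive t (1 : R) (c k) (c' k t)) ->
  is_derive t (1 : R) (combination c M) (combination c' M t).
Proof.
move=> dc; elim: M => [|M IH].
  rewrite (_ : combination c 0 = cst 0); last first.
    by apply/funext => s; rewrite /combination big_ord0.
  by rewrite /combination big_ord0; exact: is_derive_cst.
rewrite (_ : combination c M.+1 = (fun s => combination c M s + c M s *: d M)); last first.
  by apply/funext => s; rewrite /combination big_ord_recr.
rewrite (_ : combination c' M.+1 t = combination c' M t + c' M t *: d M); last first.
  by rewrite /combination big_ord_recr.
apply: cvg_is_derive.
rewrite (_ : (fun h => _) = (fun h : R => h^-1 *: (combination c M (h + t) - combination c M t)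
    + (h^-1 *: (c M (h + t) - c M t)) *: d M)).
  by apply: cvgD; [exact: is_derive_cvg IH|apply: cvgZ; [exact: is_derive_cvg (dc M)|exact: cvg_cst]].
apply/funext => h; rewrite -scalerA scalerBl -scalerDr; congr (_ *: _).
by rewrite opprD addrACA.
Qed.

Lemma combination_functional (phi : {linear X -> R^o}) c M t :
  (phi (combination c M t) : R) = \sum_(k < M) c k t * phi (d k).
Proof. by rewrite /combination raddf_sum; apply: eq_bigr => k _; exact: linearZ_LR. Qed.

Definition rl_coef (k : nat) (t : R) : R :=
  G^-1 * (ramp_between (2 - alpha) k t / ((1 - alpha) * (2 - alpha))).

Definition caputo_coef (k : nat) (t : R) : R :=
  G^-1 * (ramp_between (1 - alpha) k t / (1 - alpha)).

Lemma is_derive_rl_coef k t : is_derive t (1 : R) (rl_coef k) (caputo_coef k t).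
Proof.
have D := is_deriveZ G^-1 (is_deriveZ ((1 - alpha) * (2 - alpha))^-1
  (is_derive_ramp_between k t alpha2)).
apply: near_eq_is_derive; last first.
  apply: is_derive_eq D _; rewrite /GRing.scale/= /caputo_coef.
  rewrite (_ : 2 - alpha - 1 = 1 - alpha); last by ring.
  have h2 : 2 - alpha != 0 by rewrite gt_eqF// (lt_trans ltr01 alpha2).
  have h1 : 1 - alpha != 0 by rewrite gt_eqF.
  by field; rewrite h1 h2 gt_eqF.
near=> s.
rewrite -[LHS]/(G^-1 * (((1 - alpha) * (2 - alpha))^-1 * ramp_between (2 - alpha) k s)).
by congr (_ * _); exact: mulrC.
Unshelve. all: by end_near. Qed.

Lemma continuous_caputo_coef k : continuous (caputo_coef k).
Proof.
move=> t; apply: cvgM; first exact: cvg_cst.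
by apply: cvgM; [exact: continuous_ramp_between|exact: cvg_cst].
Qed.

Lemma continuous_rl_coef k : continuous (rl_coef k).
Proof.
move=> t; apply: cvgM; first exact: cvg_cst.
apply: cvgM; last exact: cvg_cst.
exact: (continuous_ramp_between (lt_trans ltr01 alpha2)).
Qed.

Definition piecewise_linear (c : X) (M : nat) (t : R) : X :=
  c + combination (ramp_between 1) M t.

Lemma continuous_piecewise_linear c M : continuous (piecewise_linear c M).
Proof.
move=> t; apply: cvgD; first exact: cvg_cst.
by apply: continuous_combination => k; exact: continuous_ramp_between.
Qed.

Section OnInterval.
Variables (tau : R) (c : X) (M : nat) (y : R -> X).
Hypotheses (tau0 : 0 < tau) (yE : {in `[0, tau], y =1 piecewise_linear c M}).

Lemma piecewise_linear_within : {within `[0, tau], continuous y}.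
Proof.
apply: (@subspace_eq_continuous _ _ _ (piecewise_linear c M)).
  by move=> t /set_mem /= ht; apply/esym; exact: yE.
exact: continuous_subspaceT (@continuous_piecewise_linear c M).
Qed.

Lemma rl_integral_piecewise_linear t : 0 < t <= tau ->
  rl_integral (1 - alpha) y t =
  (G^-1 * kernel_mass alpha t) *: c + combination rl_coef M t.
Proof.
move=> ht; have /andP[t0 tt] := ht; apply: functional_separation => phi hphi.
rewrite (rl_integral_functional halpha tau0 piecewise_linear_within hphi ht).
rewrite (_ : abel_integral _ _ t = abel_integral alpha
    (fun r => (phi c : R) + \sum_(k < M) ramp_between 1 k r * phi (d k)) t); last first.
  apply: eq_Rintegral => r; rewrite inE/= in_itv/= => /andP[r0 rt].
  have rin : r \in `[0, tau] by rewrite in_itv/= (ltW r0) (le_trans (ltW rt)).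
  by rewrite clamp_id// yE// linearD/= combination_functional.
rewrite (abel_integral_combination halpha (phi c) (fun k => phi (d k)) M t0).
rewrite linearD/= combination_functional linearZ/=.
rewrite mulrDr mulr_sumr -[_ *: _]/(_ * _); congr (_ + _); first by ring.
by apply: eq_bigr => k _; rewrite /rl_coef mulrA.
Qed.

End OnInterval.

Lemma continuous_bounded_itv (f : R -> X) (tau : R) : 0 < tau -> continuous f ->
  exists B, forall t, 0 < t < tau -> `|f t| <= B.
Proof.
move=> tau0 cf; have [B hB] := clamp_bounded tau0 (continuous_subspaceT cf).
exists B => t /andP[t0 tt]; rewrite -(@clamp_id _ tau t) ?hB//.
by rewrite in_itv/= !ltW.
Qed.

Lemma caputo_piecewise_linear (tau : R) (c : X) (M : nat) (y : R -> X) : 0 < tau ->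
  {in `[0, tau], y =1 piecewise_linear c M} ->
  is_caputo alpha tau y (combination caputo_coef M).
Proof.
move=> tau0 yE.
have y0 : y 0 = c.
  rewrite yE ?in_itv/= ?lexx ?ltW// /piecewise_linear /combination big1 ?addr0// => k _.
  by rewrite ramp_between_left ?scale0r// grid_ge0.
have cy := piecewise_linear_within yE.
pose J (t : R) : X := (G^-1 * kernel_mass alpha t) *: c + combination rl_coef M t.
pose J' (t : R) : X := (G^-1 * pospow (- alpha) t) *: c + combination caputo_coef M t.
have JE t : 0 < t <= tau -> rl_integral (1 - alpha) y t = J t.
  exact: rl_integral_piecewise_linear.
have cJ : continuous J.
  move=> t; apply: cvgD.
    apply: cvgZ; last exact: cvg_cst.
    apply: cvgM; first exact: cvg_cst.
    by apply: cvgM; [exact: continuous_pospow|exact: cvg_cst].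
  by apply: continuous_combination => k; exact: continuous_rl_coef.
have cJ' t : 0 < t -> {for t, continuous J'}.
  move=> t0; apply: cvgD.
    apply: cvgZ; last exact: cvg_cst.
    apply: cvgM; first exact: cvg_cst.
    by apply: continuous_pospow_at; rewrite gt_eqF.
  by apply: continuous_combination => k; exact: continuous_caputo_coef.
have dJ (t : R) : 0 < t -> is_derive t (1 : R) J (J' t).
  move=> t0.
  have dk : is_derive t (1 : R) (fun s => G^-1 * kernel_mass alpha s) (G^-1 * pospow (- alpha) t).
    have D := is_deriveZ G^-1 (is_deriveZ (1 - alpha)^-1 (is_derive_pospow_gt0 (1 - alpha) t0)).
    apply: near_eq_is_derive; last first.
      apply: is_derive_eq D _; rewrite /GRing.scale/=.
      rewrite (_ : 1 - alpha - 1 = - alpha); last by ring.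
      by rewrite mulKf// gt_eqF.
    near=> s; rewrite -[LHS]/(G^-1 * ((1 - alpha)^-1 * pospow (1 - alpha) s)).
    by congr (_ * _); exact: mulrC.
  have dk' : is_derive t (1 : R) (fun s => (G^-1 * kernel_mass alpha s) *: c)
      ((G^-1 * pospow (- alpha) t) *: c).
    apply: cvg_is_derive; rewrite (_ : (fun h => _) = (fun h : R =>
       (h^-1 *: (G^-1 * kernel_mass alpha (h + t) - G^-1 * kernel_mass alpha t)) *: c)).
      by apply: cvgZ; [exact: is_derive_cvg dk|exact: cvg_cst].
    by apply/funext => h; rewrite -scalerBl scalerA.
  have := is_deriveD dk' (is_derive_combination M (is_derive_rl_coef ^~ t)).
  by [].
have crl : {in (`]0, tau[%classic : set R), continuous (rl_integral (1 - alpha) y)}.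
  move=> t; rewrite inE/= in_itv/= => /andP[t0 tt].
  rewrite /continuous_at JE ?t0 ?ltW//; apply: cvg_trans (cJ t); apply: near_eq_cvg.
  near=> s; apply/esym/JE; apply/andP; split; first by near: s; exact: lt_nbhsr.
  by apply: ltW; near: s; exact: lt_nbhsl.
have icst (B : R) : mu.-integrable `]0, tau[ (EFin \o (fun=> B)).
  apply: measurable_bounded_integrable => //; first exact: itv_oo_measure_fin.
  by exists `|B|; split; [exact: num_real|move=> N hN r _ /=; exact: ltW].
have [B hB] := continuous_bounded_itv tau0 cJ.
have [B' hB'] : exists B', forall t, 0 < t < tau ->
    `|J' t| <= G^-1 * `|c| * pospow (- alpha) t + B'.
  have cc : continuous (combination caputo_coef M).
    by move=> t; apply: continuous_combination => k; exact: continuous_caputo_coef.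
  have [B' hB'] := continuous_bounded_itv tau0 cc.
  exists B' => t ht; apply: le_trans (ler_normD _ _) _; apply: lerD; last exact: hB'.
  by rewrite normrZ ger0_norm ?mulr_ge0 ?pospow_ge0 ?invr_ge0 ?(ltW G0)// mulrAC.
have iJ' : mu.-integrable `]0, tau[ (EFin \o (fun t => G^-1 * `|c| * pospow (- alpha) t + B')).
  by apply: integrable_addr => //; apply: integrable_mulr => //; exact: power_integrable.
have cJ'in : {in (`]0, tau[%classic : set R), continuous J'}.
  by move=> t; rewrite inE/= in_itv/= => /andP[t0 _]; exact: cJ'.
have irl : bochner_integrable mu `]0, tau[ (rl_integral (1 - alpha) y).
  apply: (continuous_bochner_integrable tau0 crl (icst B)).
  by move=> t; rewrite /= in_itv/= => ht; rewrite JE ?hB//; case/andP: ht => -> /ltW.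
have iJ'b : bochner_integrable mu `]0, tau[ J'.
  apply: (continuous_bochner_integrable tau0 cJ'in iJ').
  by move=> t; rewrite /= in_itv/=; exact: hB'.
split => //.
- split => //; exists J'; split => // psi tpsi.
  apply: functional_separation => phi hphi.
  have cpsi n : continuous (derive1n n psi).
    move=> x; apply/differentiable_continuous/derivable1_diffP.
    by have [h _ _] := tpsi; exact: h.
  have bpsi n : exists B, forall t, `]0, tau[%classic t -> `|derive1n n psi t| <= B.
    have [N hN] := @clamp_bounded _ tau tau0 R^o (derive1n n psi) (continuous_subspaceT (cpsi n)).
    exists N => t; rewrite /= in_itv/= => /andP[t0 tt].
    by rewrite -(@clamp_id _ tau t) ?hN// in_itv/= !ltW.
  have mphi (f : R -> X) : {in (`]0, tau[%classic : set R), continuous f} ->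
      measurable_fun (`]0, tau[%classic : set R) (phi \o f : R -> R).
    by move=> ?; exact: continuous_functional_measurable.
  have mpsi n : measurable_fun (`]0, tau[%classic : set R) (derive1n n psi).
    by apply: measurable_funTS; exact: continuous_measurable_fun.
  have [N0 hN0] := bpsi 0%N; have [N1 hN1] := bpsi 1%N.
  rewrite linearN.
  rewrite (@bochner_integral_functional_itv _ _ _ _ _ (fun x => derive1 psi x * phi (J x)))//.
  + rewrite (@bochner_integral_functional_itv _ _ _ _ _ (fun x => psi x * phi (J' x)))//.
    * apply: weak_derivative_by_parts => // t /andP[t0 tt].
        exact: functional_is_derive (dJ t t0).
      apply: (@cvg_comp _ _ _ J' phi _ _ _ (cJ' t t0)); exact: unit_functional_continuous.
    * apply: (scale_bochner_integrable tau0 _ hN0 iJ'b) => x _.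
      by have := cpsi 0%N x.
    * by apply: measurable_funM; [have := mpsi 0%N|exact: mphi].
    * by apply: aeW => x _; rewrite linearZ.
  + apply: (scale_bochner_integrable tau0 _ hN1 irl) => x _.
    by have := cpsi 1%N x.
  + apply: measurable_funM; first by have := mpsi 1%N.
    by apply: mphi => x _; exact: cJ.
  + apply: aeW => x; rewrite /= in_itv/= => /andP[x0 xt].
    by rewrite linearZ JE// x0 ltW.
- apply: aeW => t; rewrite in_itv/= => /andP[t0 tt].
  have yE0 : {in `[0, tau], (fun r => y r - y 0) =1 piecewise_linear 0 M}.
    by move=> r hr /=; rewrite yE// y0 /piecewise_linear addrAC subrr.
  apply: (@near_eq_is_derive _ _ _ (combination rl_coef M)); last first.
    by apply: is_derive_combination => k; exact: is_derive_rl_coef.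
  near=> s; rewrite (rl_integral_piecewise_linear tau0 yE0) ?scaler0 ?add0r//.
  apply/andP; split; first by near: s; exact: lt_nbhsr.
  by apply: ltW; near: s; exact: lt_nbhsl.
Unshelve. all: by end_near. Qed.

End PiecewiseLinear.

(** * The counterexample *)

Section Coordinates.
Context {R : realType} {X : normedModType R}.
Variables (X0 : set X) (v : nat -> X) (vs : nat -> X -> R).
Hypothesis hX0 : closed_subspace X0.
Hypothesis hv : schauder_basis X0 v.
Hypothesis hvs : forall n, in_dual X0 (vs n).
Hypothesis hvs1 : forall n, dual_norm X0 (vs n) = 1%E.
Hypothesis hvvs : forall x, X0 x -> series (fun n => vs n x *: v n) @ \oo --> x.

Lemma subspace0 : X0 0.
Proof. by have [_ [+ _]] := hX0 => /set_mem. Qed.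

Lemma subspaceDZ a x y : X0 x -> X0 y -> X0 (a *: x + y).
Proof.
by move=> hx hy; have [_ [_ h]] := hX0; apply/set_mem; apply: h; exact/mem_set.
Qed.

Lemma subspaceZ a x : X0 x -> X0 (a *: x).
Proof. by move=> hx; have := subspaceDZ a hx subspace0; rewrite addr0. Qed.

Lemma subspaceD x y : X0 x -> X0 y -> X0 (x + y).
Proof. by move=> hx hy; have := subspaceDZ 1 hx hy; rewrite scale1r. Qed.

Lemma subspaceB x y : X0 x -> X0 y -> X0 (x - y).
Proof. by move=> hx hy; have := subspaceDZ (- 1) hy hx; rewrite scaleN1r addrC. Qed.

Lemma dual0 n : vs n 0 = 0.
Proof.
have [h _] := hvs n; have := h 1 0 0 subspace0 subspace0.
by rewrite scale1r addr0 mul1r; lra.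
Qed.

Lemma dualZ n a x : X0 x -> vs n (a *: x) = a * vs n x.
Proof.
move=> hx; have [h _] := hvs n; have := h a x 0 hx subspace0.
by rewrite addr0 dual0 addr0.
Qed.

Lemma dualD n x y : X0 x -> X0 y -> vs n (x + y) = vs n x + vs n y.
Proof.
by move=> hx hy; have [h _] := hvs n; have := h 1 x y hx hy; rewrite scale1r mul1r.
Qed.

Lemma dualB n x y : X0 x -> X0 y -> vs n (x - y) = vs n x - vs n y.
Proof.
move=> hx hy; rewrite -scaleN1r dualD//; last exact: subspaceZ.
by rewrite dualZ// mulN1r.
Qed.

Lemma dual_le n x : X0 x -> `|vs n x| <= `|x|.
Proof.
move=> hx; have [->|x0] := eqVneq x 0; first by rewrite dual0 !normr0.
have nx : 0 < `|x| by rewrite normr_gt0.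
have hy : X0 (`|x|^-1 *: x) by exact: subspaceZ.
have : ((`|vs n (`|x|^-1 *: x)|)%:E <= 1)%E.
  rewrite -(hvs1 n); apply: ereal_sup_ubound; exists (`|x|^-1 *: x) => //.
  by split => //=; rewrite normrZ normfV normr_id mulVf// gt_eqF.
by rewrite lee_fin dualZ// normrM normfV normr_id ler_pdivrMl// mulr1.
Qed.

Lemma basis_in n : X0 (v n).
Proof. by have [h _] := hv. Qed.

Lemma dual_basis n m : vs n (v m) = (n == m)%:R.
Proof.
have [_ /(_ _ (basis_in m))[a [_ ua]]] := hv.
have e1 := ua _ (hvvs (basis_in m)).
have e2 : a = fun n => (n == m)%:R.
  apply: ua.
  rewrite (_ : series _ = fun N => (m < N)%N%:R *: v m).
    apply: (cvg_trans _ (@cvg_cst _ (v m) _ \oo _)); apply: near_eq_cvg.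
    by exists m.+1 => // N /= mN; rewrite mN scale1r.
  apply/funext => N; rewrite /series /=; elim: N => [|N IH].
    by rewrite big_geq// ltn0 scale0r.
  rewrite big_nat_recr//= IH ltnS; case: (ltngtP N m) => [Nm|mN|->].
  - by rewrite !scale0r addr0.
  - by rewrite !scale0r addr0.
  - by rewrite !scale0r add0r.
by have := congr1 (@^~ n) e1; rewrite e2 => <-.
Qed.

End Coordinates.

Section Cutoff.
Context {R : realType}.

Definition cutoff (z : R) : R := Num.min 1 (Num.max 0 (2 - z)).

Lemma cutoff_lip z z' : `|cutoff z - cutoff z'| <= `|z - z'|.
Proof.
have := ler_norm (z - z'); have := ler_norm (z' - z); rewrite distrC ler_norml.
by rewrite /cutoff /Num.min /Num.max; do 4! case: ifP; move=> *; lra.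
Qed.

Lemma cutoff1 z : z <= 1 -> cutoff z = 1.
Proof. by move=> z1; rewrite /cutoff max_r ?min_l//; lra. Qed.

Lemma cutoff0 z : 2 <= z -> cutoff z = 0.
Proof. by move=> z2; rewrite /cutoff max_l ?min_r//; lra. Qed.

Lemma continuous_cutoff : continuous cutoff.
Proof.
move=> z; apply/cvgrPdist_le => e e0; near=> z'.
apply: le_trans (cutoff_lip _ _) _; near: z'.
by exists e => //= z' /= /ltW.
Unshelve. all: by end_near. Qed.

End Cutoff.

Lemma bounded_setP {R : realType} (V : normedModType R) (A : set V) :
  bounded_set A <-> exists K : R, forall x, A x -> `|x| <= K.
Proof.
split=> [[K [_ hK]]|[K hK]].
  by exists (K + 1) => x Ax; apply: (hK (K + 1)) => //; rewrite ltrDl.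
exists K; split; first exact: num_real.
by move=> K' KK' x Ax; apply: le_trans (hK x Ax) (ltW KK').
Qed.

Section Counterexample.
Context {R : realType} {X : completeNormedModType R}.
Variables (X0 : set X) (v : nat -> X) (vs : nat -> X -> R).
Hypothesis hX0 : closed_subspace X0.
Hypothesis hv : schauder_basis X0 v.
Hypothesis hv1 : forall n, `|v n| = 1.
Hypothesis hvs : forall n, in_dual X0 (vs n).
Hypothesis hvs1 : forall n, dual_norm X0 (vs n) = 1%E.
Hypothesis hvvs : forall x, X0 x -> series (fun n => vs n x *: v n) @ \oo --> x.
Variable alpha : R.
Hypothesis halpha : 0 < alpha < 1.
Local Notation G := (Gamma (1 - alpha)).

Let G0 : 0 < G. Proof. exact: Gamma_gt0. Qed.
Let alpha1 : 0 < 1 - alpha. Proof. by case/andP: halpha; rewrite subr_gt0. Qed.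

Definition increment (k : nat) : X := v k.+1 - v k.

Definition path (t : R) : X := piecewise_linear increment (v 0) (cell t) t.

Definition forcing (t : R) : X := combination increment (caputo_coef alpha) (cell t) t.

Lemma combination_stable (d : nat -> X) (c : nat -> R -> R) (M N : nat) (t : R) :
  (forall k, t <= grid k -> c k t = 0) -> t <= grid M -> t <= grid N ->
  combination d c M t = combination d c N t.
Proof.
move=> c0; wlog MN : M N / (M <= N)%N.
  move=> h tM tN; have [MN|NM] := leqP M N; first exact: h.
  by apply/esym; apply: h => //; exact: ltnW.
move=> tM _; rewrite /combination -!(big_mkord xpredT (fun k => c k t *: d k)).
rewrite [RHS](@big_cat_nat _ _ _ M)//=.
suff -> : \sum_(M <= k < N) c k t *: d k = 0 by rewrite addr0.
rewrite big_nat_cond big1// => k /andP[/andP[Mk _] _]; rewrite c0 ?scale0r//.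
exact: le_trans tM (grid_le Mk).
Qed.

Lemma caputo_coef_left k t : t <= grid k -> caputo_coef alpha k t = 0.
Proof. by move=> tk; rewrite /caputo_coef ramp_between_left// mul0r mulr0. Qed.

Lemma pathE M t : t < 1 -> t <= grid M -> path t = piecewise_linear increment (v 0) M t.
Proof.
move=> t1 tM; rewrite /path /piecewise_linear; congr (_ + _).
apply: combination_stable => //; first by move=> k; exact: ramp_between_left.
exact/ltW/lt_grid_cell.
Qed.

Lemma forcingE M t : t < 1 -> t <= grid M ->
  forcing t = combination increment (caputo_coef alpha) M t.
Proof.
move=> t1 tM; apply: combination_stable => //; first by move=> k; exact: caputo_coef_left.
exact/ltW/lt_grid_cell.
Qed.

Lemma path_segment t : 0 <= t < 1 ->
  let j := (cell t).-1 in let l := ramp_between 1 j t in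
  path t = (1 - l) *: v j + l *: v j.+1.
Proof.
move=> t01 j l; have cj : cell t = j.+1 by rewrite prednK// cell_gt0.
rewrite /path cj /piecewise_linear /combination big_ord_recr/= -/l.
rewrite (eq_bigr (fun k : 'I_j => v k.+1 - v k)); last first.
  move=> k _; rewrite ramp_between1_right ?scale1r//.
  exact: le_trans (grid_le (ltn_ord k)) (grid_cell_le t01).
rewrite -(big_mkord xpredT (fun k => v k.+1 - v k)) telescope_sumr//.
rewrite addrA (addrC (v 0)) subrK scalerBr scalerBl scale1r.
by rewrite addrA addrAC.
Qed.

Lemma path_in t : 0 <= t < 1 -> X0 (path t).
Proof.
move=> t01; rewrite path_segment//.
by apply: (subspaceD hX0); apply: (subspaceZ hX0); exact: basis_in hv _.
Qed.

Lemma path_coord t i : 0 <= t < 1 ->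
  let j := (cell t).-1 in let l := ramp_between 1 j t in
  vs i (path t) = (1 - l) * (i == j)%:R + l * (i == j.+1)%:R.
Proof.
move=> t01 j l; rewrite path_segment// -/j -/l.
have hb n := basis_in hv n.
rewrite (dualD hvs)//; [|exact: (subspaceZ hX0)..].
by rewrite !(dualZ hX0 hvs)// !(dual_basis hv hvvs).
Qed.

Lemma path_norm t : 0 <= t < 1 -> `|path t| <= 1.
Proof.
move=> t01; rewrite path_segment//.
set l := ramp_between 1 _ t; have /andP[l0 l1] : 0 <= l <= 1 by exact: ramp_between1_itv.
clearbody l; apply: le_trans (ler_normD _ _) _.
rewrite !normrZ !hv1 !mulr1 (ger0_norm l0).
by rewrite ger0_norm ?subr_ge0// subrK.
Qed.

Lemma path_separated s t : 0 <= s < 1 -> 0 <= t < 1 -> ((cell s).+1 < cell t)%N ->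
  2^-1 <= `|path s - path t|.
Proof.
move=> s01 t01 st.
have hB : X0 (path s - path t) by apply: (subspaceB hX0); exact: path_in.
set j := (cell s).-1; set i := (cell t).-1; set l := ramp_between 1 j s.
have cs := cell_gt0 s01; have ct := cell_gt0 t01.
have ji : (j.+1 < i)%N by rewrite /i /j; case: (cell s) cs st => // a _; case: (cell t).
have h1 := dual_le hX0 hvs hvs1 j hB; have h2 := dual_le hX0 hvs hvs1 j.+1 hB.
move: h1 h2; rewrite !(dualB hX0 hvs)//; [|exact: path_in..].
rewrite !path_coord// -/j -/i -/l !eqxx.
have e1 : (j == i) = false by apply/negbTE; rewrite neq_ltn (ltn_trans _ ji).
have e2 : (j == i.+1) = false by apply/negbTE; rewrite neq_ltn ltnS ltnW// ltnW.
have e3 : (j.+1 == i) = false by apply/negbTE; rewrite neq_ltn ji.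
have e4 : (j.+1 == i.+1) = false by rewrite eqSS.
have e5 : (j == j.+1) = false by apply/negbTE; rewrite neq_ltn ltnSn.
have e6 : (j.+1 == j) = false by rewrite eq_sym.
rewrite e1 e2 e3 e4 e5 e6 /= !mulr0 !addr0 add0r !mulr1 !subr0.
set n := `|path s - path t| => h1 h2.
have := ler_norm l; have := ler_norm (1 - l); lra.
Qed.

Lemma path_no_limit (x : X) :
  exists eta : R, [/\ 0 <= eta, eta < 1 & forall t, eta <= t < 1 -> 4^-1 <= `|x - path t|].
Proof.
have [h|] := pselect (forall t, 0 <= t < 1 -> 4^-1 <= `|x - path t|).
  by exists 0; split.
move=> /existsNP[s /not_implyP[s01 /negP]]; rewrite -ltNge => hs.
exists (grid (cell s).+1); split; [exact: grid_ge0|exact: grid_lt1|].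
move=> t /andP[st t1].
have t01 : 0 <= t < 1 by rewrite t1 (le_trans (grid_ge0 _) st).
have cst : ((cell s).+1 < cell t)%N.
  rewrite ltnNge; apply/negP => cc.
  by have := lt_grid_cell t1; rewrite ltNge (le_trans (grid_le cc) st).
have := path_separated s01 t01 cst.
have := ler_normB (x - path t) (x - path s).
rewrite (_ : _ - _ - _ = path s - path t); last by rewrite opprB addrC addrA subrK.
by move: hs; lra.
Qed.

Definition nonlinearity (p : R * X) : X :=
  if p.1 < 1 then cutoff (`|p.2 - path p.1| / (1 - p.1)) *: forcing p.1 else 0.

Lemma nonlinearity_tube t x : t < 1 -> `|x - path t| <= 1 - t ->
  nonlinearity (t, x) = forcing t.
Proof.
move=> t1 h; rewrite /nonlinearity/= t1 cutoff1 ?scale1r//.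
by rewrite ler_pdivrMr ?mul1r// subr_gt0.
Qed.

Lemma nonlinearity_near1 (x0 : X) : exists2 eps : R, 0 < eps &
  forall t x, 1 - eps < t -> `|x0 - x| < eps -> nonlinearity (t, x) = 0.
Proof.
have [eta [eta0 eta1 h]] := path_no_limit x0.
pose eps := Num.min (1 - eta) 16^-1.
have e0 : 0 < eps by rewrite lt_min subr_gt0 eta1/= invr_gt0.
have e1 : eps <= 1 - eta by rewrite ge_min lexx.
have e2 : eps <= 16^-1 by rewrite ge_min lexx orbT.
exists eps => // t x te xe; rewrite /nonlinearity/=; case: ifPn => // t1.
rewrite cutoff0 ?scale0r//; rewrite ler_pdivlMr ?subr_gt0//.
have := h t; rewrite t1 andbT => /(_ _) h'.
have : 4^-1 <= `|x0 - path t| by apply: h'; lra.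
have := ler_normD (x0 - x) (x - path t); rewrite addrA subrK.
lra.
Qed.

Lemma continuous_nonlinearity_lt (p : R * X) : p.1 < 1 -> {for p, continuous nonlinearity}.
Proof.
move=> p1; set M := cell p.1.
have pM : p.1 < grid M by exact: lt_grid_cell.
pose F (q : R * X) : X :=
  cutoff (`|q.2 - piecewise_linear increment (v 0) M q.1| / (1 - q.1)) *:
    combination increment (caputo_coef alpha) M q.1.
have c1 : (q : R * X).1 @[q --> p] --> p.1 by case: p {p1 M pM F} => a b; exact: cvg_fst.
have c2 : (q : R * X).2 @[q --> p] --> p.2 by case: p {p1 M pM F c1} => a b; exact: cvg_snd.
have cF : {for p, continuous F}.
  apply: cvgZ; last first.
    apply: (@cvg_comp _ _ _ (fun q : R * X => q.1) (combination _ _ M) _ _ _ c1).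
    by apply: continuous_combination => k; exact: continuous_caputo_coef.
  apply: (@cvg_comp _ _ _ (fun q : R * X => _ : R) cutoff); last exact: continuous_cutoff.
  apply: cvgM.
    apply: cvg_norm; apply: cvgB; first exact: c2.
    apply: (@cvg_comp _ _ _ (fun q : R * X => q.1) (piecewise_linear _ _ M) _ _ _ c1).
    exact: continuous_piecewise_linear.
  apply: cvgV; first by rewrite gt_eqF// subr_gt0.
  by apply: cvgB; [exact: cvg_cst|exact: c1].
have n1 : \forall q \near p, q.1 < 1 /\ q.1 < grid M.
  have : \forall t \near p.1, t < 1 /\ t < grid M.
    by near=> t; split; near: t; exact: lt_nbhsl.
  exact: c1.
have E q : q.1 < 1 -> q.1 < grid M -> nonlinearity q = F q.
  by move=> q1 qM; rewrite /nonlinearity q1 (pathE q1 (ltW qM)) (forcingE q1 (ltW qM)).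
have Ep : nonlinearity p = F p by exact: E.
move: cF; rewrite /prop_for /continuous_at -Ep; apply: cvg_trans; apply: near_eq_cvg.
by apply: filterS n1 => q [q1 qM]; rewrite E.
Unshelve. all: by end_near. Qed.

Lemma continuous_nonlinearity : continuous nonlinearity.
Proof.
move=> p; have [p1|p1] := ltP p.1 1; first exact: continuous_nonlinearity_lt.
have [eps e0 h] := nonlinearity_near1 p.2.
have np : nonlinearity p = 0 by rewrite /nonlinearity ltNge p1.
have c0 : cst (0 : X) q @[q --> p] --> (0 : X) by exact: cvg_cst.
move: c0; rewrite -{2}np; apply: cvg_trans; apply: near_eq_cvg.
have c1 : (q : R * X).1 @[q --> p] --> p.1 by case: p {p1 h np} => a b; exact: cvg_fst.
have c2 : (q : R * X).2 @[q --> p] --> p.2 by case: p {p1 h np c1} => a b; exact: cvg_snd.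
have n1 : \forall q \near p, 1 - eps < q.1 /\ `|p.2 - q.2| < eps.
  have h1 : \forall q \near p, 1 - eps < (q : R * X).1.
    have : \forall t \near p.1, 1 - eps < t.
      by apply: lt_nbhsr; apply: lt_le_trans p1; rewrite ltrBlDr ltrDl.
    exact: c1.
  have h2 : \forall q \near p, `|p.2 - (q : R * X).2| < eps.
    exact: ((cvgrPdist_lt _ _).1 c2 eps e0).
  by apply: filterS2 h1 h2.
by apply: filterS n1 => -[t x] [/= ? ?]; rewrite h.
Qed.

Lemma nonlinearity_locally_lipschitz : locally_lipschitz nonlinearity.
Proof.
move=> [t0 x0] _; have [t1|t1] := ltP t0 1; last first.
  have [eps e0 h] := nonlinearity_near1 x0; exists 1, eps; split => //.
  move=> t x y _ [/= tt0 xx0] [_ /= yy0].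
  have te : 1 - eps < t by move: tt0; rewrite -ball_normE /ball_/= ltr_norml; lra.
  rewrite !h ?subrr ?normr0 ?mul1r//.
    by move: yy0; rewrite -ball_normE.
  by move: xx0; rewrite -ball_normE.
set M := cell t0.
have tM : t0 < grid M by exact: lt_grid_cell.
have cw : {for t0, continuous (combination increment (caputo_coef alpha) M)}.
  by apply: continuous_combination => k; exact: continuous_caputo_coef.
have /cvgrPdist_lt/(_ _ ltr01)[r1 /= r10 hr1] := cw.
pose B := `|combination increment (caputo_coef alpha) M t0| + 1.
have B0 : 0 < B by rewrite ltr_wpDl.
pose r := Num.min r1 (Num.min (grid M - t0) ((1 - t0) / 2)).
have r0 : 0 < r by rewrite !lt_min r10 subr_gt0 tM divr_gt0// subr_gt0.
have rr1 : r <= r1 by rewrite ge_min lexx.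
have rM : r <= grid M - t0 by rewrite !ge_min lexx orbT.
have rt : r <= (1 - t0) / 2 by rewrite !ge_min lexx !orbT.
exists (B / ((1 - t0) / 2)), r; split => //.
  by rewrite divr_gt0// divr_gt0// subr_gt0.
move=> t x y _ [/= tt0 _] _.
have ht : `|t0 - t| < r by move: tt0; rewrite -ball_normE.
have tM' : t < grid M by move: ht; rewrite ltr_norml; lra.
have t1' : t < 1 by exact: lt_trans tM' (grid_lt1 _).
have dt : (1 - t0) / 2 <= 1 - t by move: ht; rewrite ltr_norml; lra.
have d0 : 0 < (1 - t0) / 2 by rewrite divr_gt0// subr_gt0.
have dt0 : 0 < 1 - t by rewrite subr_gt0.
have wB : `|forcing t| <= B.
  rewrite (forcingE t1' (ltW tM')).
  have := hr1 t (lt_le_trans ht rr1).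
  set a := combination _ _ _ t0; set b := combination _ _ _ t => ab.
  have := ler_normB a (a - b); rewrite opprB addrC subrK /B -/a; lra.
rewrite /nonlinearity/= t1' -scalerBl normrZ mulrC -mulrA.
apply: ler_pM => //.
apply: le_trans (cutoff_lip _ _) _; rewrite -mulrBl normrM normfV (gtr0_norm dt0) mulrC.
apply: ler_pM => //; first by rewrite invr_ge0 ltW.
  by rewrite lef_pV2 ?posrE.
apply: le_trans (ler_dist_dist _ _) _.
by rewrite opprB addrA subrK.
Qed.

Lemma forcing_unbounded (K : R) : exists2 t, 0 <= t < 1 & K < `|forcing t|.
Proof.
have [n hn] : exists n : nat, `|K| * (1 - alpha) * G < n.+1%:R `^ alpha.
  set a := `|K| * _ * _.
  have a0 : 0 <= a by rewrite !mulr_ge0// ltW.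
  have alpha0 : 0 < alpha by case/andP: halpha.
  exists (Num.truncn (a `^ alpha^-1)).
  rewrite [X in X < _](_ : a = (a `^ alpha^-1) `^ alpha); last first.
    by rewrite -powRrM mulVf ?gt_eqF// powRr1.
  apply: gt0_ltr_powR => //; rewrite ?nnegrE ?powR_ge0//.
  by have /truncn_itv/andP[] := powR_ge0 a alpha^-1.
exists (grid n.+1); first by rewrite grid_ge0 grid_lt1.
have hb := basis_in hv.
have hd k : X0 (increment k) by apply: (subspaceB hX0).
have hC (c : nat -> R -> R) M t : X0 (combination increment c M t).
  rewrite /combination; elim: M => [|M IH]; first by rewrite big_ord0; exact: (subspace0 hX0).
  by rewrite big_ord_recr/=; apply: (subspaceD hX0) => //; exact: (subspaceZ hX0).
have dk (c : nat -> R -> R) M t : (M <= n)%N -> vs n.+1 (combination increment c M t) = 0.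
  elim: M => [|M IH] Mn; first by rewrite /combination big_ord0 (dual0 hX0 hvs).
  rewrite /combination big_ord_recr/= (dualD hvs); [|exact: (hC c M)|exact: (subspaceZ hX0)].
  rewrite -/(combination _ _ _ _) IH ?(ltnW Mn)// add0r (dualZ hX0 hvs)//.
  rewrite (dualB hX0 hvs)// !(dual_basis hv hvvs).
  by rewrite !gtn_eqF ?subrr ?mulr0// ltnS// ltnW.
rewrite (@forcingE n.+1) ?grid_lt1 ?lexx//.
apply: lt_le_trans (dual_le hX0 hvs hvs1 n.+1 (hC _ _ _)).
rewrite /combination big_ord_recr/= (dualD hvs)//; last 2 first.
- exact: (hC (caputo_coef alpha) n).
- exact: (subspaceZ hX0).
rewrite -/(combination _ _ _ _) dk// add0r (dualZ hX0 hvs)// (dualB hX0 hvs)//.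
rewrite !(dual_basis hv hvvs) eqxx gtn_eqF// subr0 mulr1.
rewrite /caputo_coef /ramp_between subrr (pospow_le0E _ (lexx 0)) subr0 -/(mesh n).
have m0 : 0 < mesh n :> R by exact: mesh_gt0.
rewrite pospow_gt0E// ger0_norm; last first.
  by rewrite !mulr_ge0 ?invr_ge0 ?powR_ge0// ltW.
have -> : mesh n `^ (1 - alpha) / mesh n = (mesh n)^-1 `^ alpha.
  rewrite powRB; last by rewrite (gt_eqF m0) implybT.
  rewrite powRr1 ?ltW// mulrAC mulfV ?gt_eqF// mul1r.
  by rewrite -[(mesh n)^-1]powR_inv1 ?ltW// -powRrM mulN1r powRN.
rewrite mulrC ltr_pdivlMr// ltr_pdivlMr//.
apply: le_lt_trans (_ : `|K| * (1 - alpha) * G < _); last first.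
  apply: lt_le_trans hn _; apply: ge0_ler_powR.
  - by case/andP: halpha => /ltW.
  - by rewrite nnegrE.
  - by rewrite nnegrE invr_ge0 ltW.
  - by rewrite -(invrK n.+1%:R) lef_pV2 ?posrE ?invr_gt0 ?ltr0n// mesh_le.
by rewrite mulrAC !ler_pM2r// ler_norm.
Qed.

Lemma nonlinearity_unbounded : ~ maps_bounded_to_bounded nonlinearity.
Proof.
move=> h; pose B := [set p : R * X | exists2 t, 0 <= t < 1 & p = (t, path t)].
have /bounded_setP[K hK] : bounded_set (nonlinearity @` B).
  apply: h; first by move=> _ [t /andP[t0 _] ->].
  apply/bounded_setP; exists 1 => _ [t t01 ->].
  rewrite prod_normE ge_max path_norm// andbT /=.
  by case/andP: t01 => t0 t1; rewrite ger0_norm// ltW.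
have [t t01 Kt] := forcing_unbounded K.
have t1 : t < 1 by case/andP: t01.
have : `|nonlinearity (t, path t)| <= K.
  by apply: hK; exists (t, path t) => //; exists t.
rewrite nonlinearity_tube ?subrr ?normr0 ?subr_ge0 ?(ltW t1)//.
by rewrite leNgt Kt.
Qed.

Lemma path0 : path 0 = v 0.
Proof.
rewrite (@pathE 0) ?ltr01 ?grid0 ?lexx// /piecewise_linear /combination big_ord0.
exact: addr0.
Qed.

Lemma path_caputo (tau : R) : 0 < tau < 1 ->
  is_caputo alpha tau path (combination increment (caputo_coef alpha) (cell tau)).
Proof.
move=> /andP[tau0 tau1]; apply: (@caputo_piecewise_linear _ _ _ halpha _ tau (v 0)) => //.
move=> t; rewrite in_itv/= => /andP[_ tt]; apply: pathE; first exact: le_lt_trans tau1.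
by apply: le_trans tt _; exact/ltW/lt_grid_cell.
Qed.

Lemma path_local_solution (tau : R) : 0 < tau < 1 ->
  local_solution alpha nonlinearity (v 0) tau path.
Proof.
move=> tau01; have /andP[tau0 tau1] := tau01; split => //; first exact: path0.
exists (combination increment (caputo_coef alpha) (cell tau)); split.
- apply: continuous_subspaceT => t.
  by apply: continuous_combination => k; exact: continuous_caputo_coef.
- exact: path_caputo.
- move=> t; rewrite in_itv/= => /andP[_ tt]; have t1 := le_lt_trans tt tau1.
  rewrite nonlinearity_tube ?subrr ?normr0 ?subr_ge0 ?(ltW t1)//.
  by rewrite (@forcingE (cell tau) t t1)// (le_trans tt)//; exact/ltW/lt_grid_cell.
Qed.

Lemma path_unique (tau : R) (y : R -> X) : 0 < tau < 1 ->
  local_solution alpha nonlinearity (v 0) tau y -> {in `[0, tau], y =1 path}.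
Proof.
move=> tau01 [_ y0 [w [cw hy wE]]]; have /andP[tau0 tau1] := tau01.
have hp := path_caputo tau01; have [cy _ _] := hy; have [cp _ _] := hp.
pose z (t : R) : X := y (clamp tau t) - path (clamp tau t).
have cz : continuous z.
  by move=> t; apply: cvgB; [exact: (continuous_clamp tau0 cy)|exact: (continuous_clamp tau0 cp)].
have zE t : 0 <= t <= tau -> z t = y t - path t.
  by move=> ht; rewrite /z clamp_id// in_itv.
suff zz : forall t, 0 <= t <= tau -> z t = 0.
  by move=> t; rewrite in_itv/= => ht; apply/eqP; rewrite -subr_eq0 -zE// zz.
have z0 : z 0 = 0 by rewrite zE ?lexx ?ltW// y0 path0 subrr.
(* Inside the tube the equation has the right-hand side [forcing]. *)
have step (s' : R) : 0 < s' <= tau -> (forall t, 0 < t < s' -> `|z t| <= 1 - tau) ->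
    forall t, 0 < t < s' -> z t = 0.
  move=> /andP[s'0 s't] hz t ht; have /andP[t0 ts'] := ht.
  rewrite zE; last by rewrite (ltW t0) (le_trans (ltW ts')).
  apply/eqP; rewrite subr_eq0; apply/eqP.
  apply: (@caputo_unique _ _ _ halpha tau s' path y _ w _ hp hy) => //.
  - by rewrite s'0.
  - by rewrite y0 path0.
  move=> r hr; have /andP[r0 rs'] := hr; have rt := le_trans (ltW rs') s't.
  have r1 := le_lt_trans rt tau1.
  rewrite wE; last by rewrite in_itv/= (ltW r0).
  rewrite nonlinearity_tube//.
    by rewrite (@forcingE (cell tau) r r1)// (le_trans rt)//; exact/ltW/lt_grid_cell.
  by rewrite -zE ?(ltW r0)//; apply: le_trans (hz r hr) _; rewrite lerD2l lerN2.
pose S := [set s | 0 <= s <= tau /\ forall t, 0 <= t <= s -> z t = 0].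
have S0 : S 0.
  split; first by rewrite lexx ltW.
  by move=> t /andP[t0 t0']; rewrite (_ : t = 0)//; apply/eqP; rewrite eq_le t0 t0'.
have hS : has_sup S by split; [exists 0|exists tau => s [/andP[]]].
pose m := sup S.
have m0 : 0 <= m by apply: ub_le_sup => //; case: hS.
have mt : m <= tau by apply: ge_sup; [exists 0|move=> s [/andP[]]].
have zm t : 0 <= t < m -> z t = 0.
  move=> /andP[t0 tm]; have e0 : 0 < m - t by rewrite subr_gt0.
  have [s [_ hs] ms] := sup_adherent e0 hS.
  by apply: hs; rewrite t0/= -/m in ms *; lra.
have zm0 : z m = 0.
  have [m0'|->//] : 0 < m \/ m = 0.
    by move: m0; rewrite le_eqVlt => /predU1P[<-|]; [right|left].
  apply/eqP; rewrite -normr_le0; apply/ler_addgt0Pr => e e0; rewrite add0r.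
  have /cvgrPdist_le/(_ _ e0)[r /= r0 hr] := cz m.
  pose t := Num.max 0 (m - r / 2).
  have tm : t < m by rewrite /t gt_max m0' ltrBlDr ltrDl divr_gt0.
  have t0 : 0 <= t by rewrite le_max lexx.
  have tr : m - r / 2 <= t by rewrite le_max lexx orbT.
  have := hr t; rewrite (zm t) ?t0// subr0; apply => /=.
  by rewrite ger0_norm; lra.
have [mt'|mtau] := ltP m tau; last first.
  have Em : m = tau by apply/eqP; rewrite eq_le mt.
  move=> t /andP[t0 tt]; have [tm|tm] := ltP t m; first by apply: zm; rewrite t0.
  by rewrite (_ : t = m)//; apply/eqP; rewrite eq_le tm Em tt.
exfalso.
have e0 : 0 < 1 - tau by rewrite subr_gt0.
have /cvgrPdist_le/(_ _ e0)[r /= r0 hr] := cz m.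
pose s' := Num.min tau (m + r / 2).
have ms' : m < s' by rewrite lt_min mt' ltrDl divr_gt0.
have s't : s' <= tau by rewrite ge_min lexx.
have s'r : s' <= m + r / 2 by rewrite ge_min lexx orbT.
have hz : forall t, 0 < t < s' -> z t = 0.
  apply: step; first by rewrite s't (le_lt_trans m0 ms').
  move=> t /andP[t0 ts']; have [tm|tm] := ltP t m.
    by rewrite zm ?normr0 ?(ltW e0)// (ltW t0).
  by have := hr t; rewrite zm0 sub0r normrN; apply => /=; rewrite ler0_norm; lra.
have : S ((m + s') / 2).
  split; first by lra.
  move=> t /andP[]; rewrite le_eqVlt => /predU1P[<-//|t0] tm.
  by apply: hz; rewrite t0/=; lra.
by move=> /(ub_le_sup hS.2); rewrite -/m; lra.
Qed.

Lemma path_no_continuation :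
  ~ exists tau y, is_continuation alpha nonlinearity (v 0) 1 path tau y.
Proof.
move=> [tau [y [tau1 [tau0 _ [w [_ [cy _ _] _]]] yE]]].
have [eta [eta0 eta1 h]] := path_no_limit (y 1).
have cz := continuous_clamp tau0 cy.
have e0 : (0 : R) < 8^-1 by rewrite invr_gt0.
have /cvgrPdist_le/(_ _ e0)[r /= r0 hr] := cz 1.
pose t := Num.max eta (1 - r / 2).
have t1 : t < 1 by rewrite gt_max eta1 ltrBlDr ltrDl divr_gt0.
have et : eta <= t by rewrite le_max lexx.
have tr : 1 - r / 2 <= t by rewrite le_max lexx orbT.
have := h t; rewrite et t1 => /(_ isT).
have := hr t; rewrite !clamp_id ?in_itv/= ?ler01 ?tau1 ?(le_trans eta0)//; last first.
  by rewrite (le_trans (ltW t1)).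
have yt : y t = path t by apply: yE; rewrite in_itv/= t1 (le_trans eta0).
rewrite yt => h1 h2.
have : `|y 1 - path t| <= 8^-1 by apply: h1; rewrite ger0_norm; lra.
lra.
Qed.

End Counterexample.

(* The sequences are indexed from 0: [v n] is the (n+1)-st basis vector. *)
Theorem theorem18 (R : realType) (X : completeNormedModType R)
    (X0 : set X) (v : nat -> X) (vs : nat -> X -> R) (alpha : R)
    (hX : infinite_dimensional [set: X])
    (hX0 : closed_subspace X0) (hX0dim : infinite_dimensional X0)
    (hv : schauder_basis X0 v) (hv1 : forall n, `|v n| = 1)
    (hvs : forall n, in_dual X0 (vs n))
    (hvs1 : forall n, dual_norm X0 (vs n) = 1%E)
    (hvvs : forall x, X0 x -> series (fun n => vs n x *: v n) @ \oo --> x)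
    (halpha : 0 < alpha < 1) :
  exists f : R * X -> X,
    [/\ {within half_space, continuous f},
        locally_lipschitz f,
        ~ maps_bounded_to_bounded f &
        exists u : R -> X,
          maximal_local_solution alpha f (v 0%N) 1 u /\
          bounded_set (u @` `[0, 1[)].
Proof.
exists (nonlinearity v alpha); split.
- by apply: continuous_subspaceT; exact: (continuous_nonlinearity hX0 hv hvs hvs1 hvvs halpha).
- exact: (nonlinearity_locally_lipschitz hX0 hv hvs hvs1 hvvs halpha).
- exact: (nonlinearity_unbounded hX0 hv hv1 hvs hvs1 hvvs halpha).
- exists (path v); split; first split.
  + move=> tau tau01; split; first exact: (path_local_solution v halpha).
    by move=> y; exact: (path_unique halpha).
  + exact: (path_no_continuation hX0 hv hvs hvs1 hvvs).
  + apply/bounded_setP; exists 1 => _ [t /= + <-].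
    by rewrite in_itv/= => t01; exact: path_norm.
Qed.
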